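(* Let $k:(0,\infty)\times(0,\infty)\to\mathbb{R}$ be Borel-measurable and homogeneous of degree $\beta-1$ for some $\beta\in(0,2)$ (i.e. $k(t,ts)=t^{\beta-1}k(1,s)$ for $t>0$, $s\in(0,1)$), with $k(1,\cdot)\in L^{1+\varepsilon}((0,1))$ for some $\varepsilon>0$. Let $\hat\Phi(\lambda)=\sum_{n\ge0}\hat c_n\lambda^n$ with $\hat c_0=1$, $\hat c_n=\hat c_{n-1}\int_0^1k(1,s)s^{\beta(n-1)}ds$, and suppose $x\mapsto\hat\Phi(-x)$ is completely monotone on $(0,\infty)$. Then: (i) Let $\gamma\in(\beta,2]$ and $\delta\in[\gamma,2]\setminus\{\gamma/\beta\}$. If $A_{\gamma/\delta}$ is a nonnegative random variable with Laplace transform $x\mapsto\hat\Phi(-x^{\gamma/\delta})$ and $(Y^{(\delta,0,\beta/\gamma)}_t)_{t\ge0}$ is a symmetric linear fractional stable motion independent of $A_{\gamma/\delta}$, then $(A_{\gamma/\delta}^{1/\delta}Y^{(\delta,0,\beta/\gamma)}_t)_{t\ge0}$ provides a stochastic solution to $$u(t,x)=u_0(x)+\int_0^tk(t,s)\Delta^{\gamma/2}u(s,x)ds\ (t>0,x\in\mathbb{R}),\qquad \lim_{t\searrow0}u(t,x)=u_0(x)\ (x\in\mathbb{R}).$$ (ii) Let $\beta\ne1$, $\delta\in(\beta,2]\setminus\{1\}$ and $\rho\in[-1,1]$. If $A$ is a nonnegative random variable with Laplace transform $\hat\Phi(-\cdot)$ and $(Y^{(\delta,\rho,\beta/\delta)}_t)_{t\ge0}$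 is a linear fractional stable motion independent of $A$, then $(A^{1/\delta}Y^{(\delta,\rho,\beta/\delta)}_t)_{t\ge0}$ provides a stochastic solution to $$u(t,x)=u_0(x)+\int_0^tk(t,s)L_{\delta,\rho_0}u(s,x)ds\ (t>0,x\in\mathbb{R}),\qquad \lim_{t\searrow0}u(t,x)=u_0(x)\ (x\in\mathbb{R}),$$ where $\rho_0=\rho$ if $\beta\in(1,2)$, and if $\beta\in(0,1)$, $$\rho_0=\rho\,\frac{\frac1\beta-\int_0^\infty\big(x^{(\beta-1)/\delta}-(1+x)^{(\beta-1)/\delta}\big)^\delta dx}{\frac1\beta+\int_0^\infty\big(x^{(\beta-1)/\delta}-(1+x)^{(\beta-1)/\delta}\big)^\delta dx}.$$
   Context: Dimension $d=1$. For $\delta\in(0,2]$ and $\rho\in[-1,1]$ (with $\rho=0$ if $\delta=1$), $\psi_{\delta,\rho}(p)=|p|^\delta(1-i\rho\,\mathrm{sign}(p)\tan(\pi\delta/2))$, and $L_{\delta,\rho}$ is the pseudo-differential operator $L_{\delta,\rho}\varphi=\mathfrak{F}^{-1}[(-\psi_{\delta,\rho})\mathfrak{F}\varphi]$ on the Schwartz space $S(\mathbb{R})$ ($\mathfrak{F}\varphi(p)=(2\pi)^{-1/2}\int e^{-ipx}\varphi(x)dx$), closed in $C_\infty(\mathbb{R})$; $\Delta^{\delta/2}:=L_{\delta,0}$ (symbol $-|p|^\delta$). A stable random measure $M_{\delta,\rho}$ is a $\sigma$-additive map from the Borel sets of $\mathbb{R}$ to real random variables with independent values on pairwise disjoint sets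 and $\mathbb{E}[e^{ipM_{\delta,\rho}(A)}]=e^{-\mathrm{Leb}(A)\psi_{\delta,\rho}(p)}$. For $H\in(0,1)\setminus\{1/\delta\}$, the linear fractional stable motion is $Y^{(\delta,\rho,H)}_t=\frac1{K_{\delta,H}}\int_{\mathbb{R}}\big((t-x)_+^{H-1/\delta}-(-x)_+^{H-1/\delta}\big)M_{\delta,\rho}(dx)$, $t\ge0$, with $K_{\delta,H}=\big(\int_0^\infty|(1+x)^{H-1/\delta}-x^{H-1/\delta}|^\delta dx+\frac1{\delta H}\big)^{1/\delta}$; ''symmetric'' means $\rho=0$. A real-valued process $(X_t)_{t\ge0}$ with $X_0=0$ a.s. provides a stochastic solution to an equation of the displayed form if for every $u_0\in S(\mathbb{R})$ the function $u(t,x)=\mathbb{E}[u_0(x+X_t)]$ solves it. *)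

(* Defs.v *)
From HB Require Import structures.
From mathcomp Require Import all_boot all_order all_algebra.
From mathcomp Require Import all_classical all_reals all_analysis.
Set Implicit Arguments. Unset Strict Implicit. Unset Printing Implicit Defensive.
Import Order.TTheory GRing.Theory Num.Theory.
Import numFieldNormedType.Exports.
Local Open Scope classical_set_scope.
Local Open Scope ring_scope.

Section Analytic.
Variable R : realType.
Local Notation leb := (@lebesgue_measure R).

Definition pospow (x a : R) : R := if 0 < x then x `^ a else 0.

Definition smooth (f : R -> R) : Prop :=
  forall (n : nat) (x : R), derivable (derive1n n f) x 1.
Definition schwartz (f : R -> R) : Prop :=
  smooth f /\ forall m n : nat, exists C : R, forall x : R, `|x ^+ m * derive1n n f x| <= C.

Definition C_infty (f : R -> R) : Prop :=
  continuous f /\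
  forall e : R, 0 < e -> exists M : R, forall x : R, M < `|x| -> `|f x| < e.

(** Fourier transform  F phi (p) = (2 pi)^{-1/2} int e^{-ipx} phi(x) dx
    = Fc phi p - i * Fs phi p   (phi real valued) *)
Definition Fc (phi : R -> R) (p : R) : R :=
  (Num.sqrt (2 * pi))^-1 * Rintegral leb setT (fun x => cos (p * x) * phi x).
Definition Fs (phi : R -> R) (p : R) : R :=
  (Num.sqrt (2 * pi))^-1 * Rintegral leb setT (fun x => sin (p * x) * phi x).

Definition psiRe (delta : R) (p : R) : R := `|p| `^ delta.
Definition psiIm (delta rho : R) (p : R) : R :=
  - (`|p| `^ delta * rho * Num.sg p * tan (pi * delta / 2)).

(** L_{delta,rho} phi = F^{-1}[(-psi) F phi] on S(R) (real part written out;
    the result is real-valued for real phi). With g = (-psi) * F phi: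
    Re g = -psiRe*Fc - psiIm*Fs,  Im g = -psiIm*Fc + psiRe*Fs. *)
Definition Lop (delta rho : R) (phi : R -> R) (x : R) : R :=
  (Num.sqrt (2 * pi))^-1 * Rintegral leb setT (fun p =>
     cos (p * x) * (- psiRe delta p * Fc phi p - psiIm delta rho p * Fs phi p)
   - sin (p * x) * (- psiIm delta rho p * Fc phi p + psiRe delta p * Fs phi p)).

Definition unif_cvg (f : nat -> R -> R) (g : R -> R) : Prop :=
  forall e : R, 0 < e -> exists N : nat, forall n : nat, (N <= n)%N ->
    forall x : R, `|f n x - g x| < e.

(** graph of the closure in C_infty(R) of L_{delta,rho} with domain S(R):
    Lbar delta rho u g  <->  u is in the domain of the closure and (closure) u = g *)
Definition Lbar (delta rho : R) (u g : R -> R) : Prop :=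
  C_infty u /\ C_infty g /\
  exists phi : nat -> R -> R, (forall n, schwartz (phi n)) /\
    unif_cvg phi u /\ unif_cvg (fun n => Lop delta rho (phi n)) g.

Definition solves (Lrel : (R -> R) -> (R -> R) -> Prop) (k : R -> R -> R)
    (u0 : R -> R) (u : R -> R -> R) : Prop :=
  exists G : R -> R -> R,
    (forall s : R, 0 < s -> Lrel (u s) (G s)) /\
    (forall t x : R, 0 < t ->
       leb.-integrable `]0, t[ (fun s => (k t s * G s x)%:E) /\
       u t x = u0 x + Rintegral leb `]0, t[ (fun s => k t s * G s x)) /\
    (forall x : R, u t x @[t --> 0^'+] --> u0 x).

Definition kernel_measurable (k : R -> R -> R) : Prop :=
  measurable_fun [set z : R * R | 0 < z.1 /\ 0 < z.2] (fun z => k z.1 z.2).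
Definition homogeneous (k : R -> R -> R) (beta : R) : Prop :=
  forall t s : R, 0 < t -> 0 < s < 1 -> k t (t * s) = t `^ (beta - 1) * k 1 s.
Definition in_L1eps (k : R -> R -> R) (eps : R) : Prop :=
  measurable_fun (`]0, 1[ : set R) (k 1) /\
  (\int[leb]_(s in (`]0%R, 1%R[ : set R)) (`|k 1 s| `^ (1 + eps))%:E < +oo)%E.

Fixpoint chat (k : R -> R -> R) (beta : R) (n : nat) : R :=
  match n with
  | 0 => 1
  | n'.+1 => chat k beta n' *
      Rintegral leb `]0, 1[ (fun s => k 1 s * s `^ (beta * n'%:R))
  end.

Definition Phi_partial (k : R -> R -> R) (beta lam : R) (N : nat) : R :=
  \sum_(n < N) chat k beta n * lam ^+ n.
Definition Phihat (k : R -> R -> R) (beta lam : R) : R :=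
  lim (Phi_partial k beta lam @ \oo).

Definition completely_monotone (f : R -> R) : Prop :=
  forall (n : nat) (x : R), 0 < x ->
    derivable (derive1n n f) x 1 /\ 0 <= (-1) ^+ n * derive1n n f x.

Definition rho0 (delta beta rho : R) : R :=
  if 1 < beta then rho else
  let I := Rintegral leb `]0, +oo[
      (fun x => (x `^ ((beta - 1) / delta) - (1 + x) `^ ((beta - 1) / delta)) `^ delta) in
  rho * ((beta^-1 - I) / (beta^-1 + I)).

Definition KdH (delta H : R) : R :=
  (Rintegral leb `]0, +oo[
     (fun x => `|(1 + x) `^ (H - delta^-1) - x `^ (H - delta^-1)| `^ delta)
   + (delta * H)^-1) `^ (delta^-1).

Definition lfsm_kernel (delta H t : R) (x : R) : R :=
  pospow (t - x) (H - delta^-1) - pospow (- x) (H - delta^-1).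

End Analytic.

Section Probabilistic.
Variables (R : realType) (d : measure_display) (T : measurableType d)
  (P : probability T R).
Local Notation leb := (@lebesgue_measure R).

Definition expect (f : T -> R) : R := fine (\int[P]_w (f w)%:E).

Definition mutually_indep (n : nat) (X : 'I_n -> T -> R) : Prop :=
  forall B : 'I_n -> set R, (forall i, measurable (B i)) ->
    P (\bigcap_(i in [set: 'I_n]) (X i @^-1` B i)) = (\prod_(i < n) P (X i @^-1` B i))%E.

Definition stable_random_measure (delta rho : R) (M : set R -> T -> R) : Prop :=
  (forall A, measurable A -> (leb A < +oo)%E -> measurable_fun setT (M A)) /\
  (forall F : nat -> set R, (forall n, measurable (F n)) -> trivIset setT F ->
     (leb (\bigcup_n F n) < +oo)%E ->
     {ae P, forall w, (fun N => \sum_(i < N) M (F i) w) @ \oo --> M (\bigcup_n F n) w}) /\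
  (forall (n : nat) (F : 'I_n -> set R),
     (forall i, measurable (F i) /\ (leb (F i) < +oo)%E) -> trivIset setT F ->
     mutually_indep (fun i => M (F i))) /\
  (forall A, measurable A -> (leb A < +oo)%E -> forall p : R,
     let l := fine (leb A) in
     expect (fun w => cos (p * M A w)) =
       expR (- (l * psiRe delta p)) * cos (l * psiIm delta rho p) /\
     expect (fun w => sin (p * M A w)) =
       - (expR (- (l * psiRe delta p)) * sin (l * psiIm delta rho p))).

Definition simple_adm (s : seq (R * set R)) : Prop :=
  forall c, c \in s -> measurable c.2 /\ (leb c.2 < +oo)%E.
Definition sf_eval (s : seq (R * set R)) (x : R) : R :=
  \sum_(c <- s) c.1 * \1_(c.2) x.
Definition sf_int (M : set R -> T -> R) (s : seq (R * set R)) (w : T) : R :=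
  \sum_(c <- s) c.1 * M c.2 w.

Definition stoch_int (M : set R -> T -> R) (delta : R) (f : R -> R) (X : T -> R) : Prop :=
  measurable_fun setT X /\
  exists s : nat -> seq (R * set R), (forall n, simple_adm (s n)) /\
    (fun n => (\int[leb]_x (`|sf_eval (s n) x - f x| `^ delta)%:E)%E) @ \oo --> 0%E /\
    (forall e : R, 0 < e ->
       (fun n => P [set w | e < `|sf_int M (s n) w - X w|]) @ \oo --> 0%E).

Definition is_lfsm (M : set R -> T -> R) (delta H : R) (Y : R -> T -> R) : Prop :=
  forall t : R, 0 <= t ->
    stoch_int M delta (lfsm_kernel delta H t) (fun w => KdH delta H * Y t w).

Definition indep_rv_process (A : T -> R) (Y : R -> T -> R) : Prop :=
  forall (n : nat) (ts : 'I_n -> R) (B : set R) (Bs : 'I_n -> set R),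
    (forall i, 0 <= ts i) -> measurable B -> (forall i, measurable (Bs i)) ->
    P (A @^-1` B `&` \bigcap_(i in [set: 'I_n]) (Y (ts i) @^-1` Bs i)) =
    (P (A @^-1` B) * P (\bigcap_(i in [set: 'I_n]) (Y (ts i) @^-1` Bs i)))%E.

Definition nonneg_rv_laplace (A : T -> R) (Lap : R -> R) : Prop :=
  measurable_fun setT A /\ (forall w, 0 <= A w) /\
  forall x : R, 0 < x -> expect (fun w => expR (- (x * A w))) = Lap x.

Definition stochastic_solution (X : R -> T -> R)
    (Lrel : (R -> R) -> (R -> R) -> Prop) (k : R -> R -> R) : Prop :=
  {ae P, forall w, X 0 w = 0} /\
  forall u0 : R -> R, schwartz u0 ->
    solves Lrel k u0 (fun t x => expect (fun w => u0 (x + X t w))).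

End Probabilistic.

(* Main.v *)
(** The process enters the equation only through its one-dimensional
    characteristic functions.  If, for every [s > 0], [E e^(ip X_s)] is the
    power series [sum_n chat_n s^(beta n) (- psi p)^n], then integrating this
    series against [k t s] term by term and using homogeneity,
    [chat_n * int_0^t k(t,s) s^(beta n) ds = chat_(n+1) t^(beta (n+1))],
    so that [E e^(ip X_t) = 1 - psi p * int_0^t k(t,s) E e^(ip X_s) ds].
    Fourier inversion of [u0] turns this into the integral equation, with
    [G s x = E ((L u0) (x + X_s))]; clipping [X_s] to [[-n, n]] gives Schwartz
    functions approximating [u s] in the graph norm of [L].

    The characteristic function of [Y_t] is obtained from simple integrands by
    independence and a limit in probability; the scale [t^(delta H)] and the
    skewness come from the integrals of [|f_1|^delta] and
    [sign f_1 * |f_1|^delta] of the kernel.  Conditioning on [A], in case (i)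
    the Laplace transform of [A] gives the series at once.  In case (ii) the
    argument is complex, so one first extracts the moments [E A^n = n! chat_n]
    from the behaviour of the Laplace transform at [0] (Fatou and the
    alternating Taylor remainders of [e^(-y)]) and then sums the complex
    exponential series. *)
Require Import Defs.
From HB Require Import structures.
From mathcomp Require Import all_boot all_order all_algebra.
From mathcomp Require Import all_classical all_reals all_analysis.
Import Order.TTheory GRing.Theory Num.Theory.
Import numFieldNormedType.Exports.
Local Open Scope classical_set_scope.
Local Open Scope ring_scope.
From mathcomp Require Import measurable_realfun complex ring lra.
Set Implicit Arguments.
Unset Strict Implicit.
Unset Printing Implicit Defensive.

Section real_integrals.
Context d (T : measurableType d) (R : realType).
Variable mu : {measure set T -> \bar R}.
Implicit Types (D : set T) (f g : T -> R).

Lemma integrable_measurable_fun D f : mu.-integrable D (EFin \o f) ->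
  measurable_fun D f.
Proof. by move=> /integrableP[/measurable_EFinP]. Qed.

Lemma integrable_dominated D f g : measurable D -> measurable_fun D f ->
  (forall x, D x -> `|f x| <= g x) -> mu.-integrable D (EFin \o g) ->
  mu.-integrable D (EFin \o f).
Proof.
move=> mD mf fg ig; apply: (le_integrable mD _ _ ig).
  exact/measurable_EFinP.
by move=> x Dx /=; rewrite lee_fin (le_trans (fg _ Dx))// ler_norm.
Qed.

Lemma integrableZl_EFin D (r : R) f : measurable D ->
  mu.-integrable D (EFin \o f) ->
  mu.-integrable D (EFin \o (fun x => r * f x)).
Proof. by move=> mD /(integrableZl mD r); apply: eq_integrable. Qed.

Lemma integrableD_EFin D f g : measurable D ->
  mu.-integrable D (EFin \o f) -> mu.-integrable D (EFin \o g) ->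
  mu.-integrable D (EFin \o (fun x => f x + g x)).
Proof.
by move=> mD intf intg; have := integrableD mD intf intg; apply: eq_integrable.
Qed.

Lemma integrableB_EFin D f g : measurable D ->
  mu.-integrable D (EFin \o f) -> mu.-integrable D (EFin \o g) ->
  mu.-integrable D (EFin \o (fun x => f x - g x)).
Proof.
by move=> mD intf intg; have := integrableB mD intf intg; apply: eq_integrable.
Qed.

Lemma integrableM_bounded D f g (C : R) : measurable D ->
  measurable_fun D g -> (forall x, D x -> `|g x| <= C) ->
  mu.-integrable D (EFin \o f) ->
  mu.-integrable D (EFin \o (fun x => g x * f x)).
Proof.
move=> mD mg gC intf.
apply: (@integrable_dominated D _ (fun x => C * `|f x|)) => //.
- by apply: measurable_funM => //; exact: integrable_measurable_fun.
- by move=> x Dx; rewrite normrM ler_wpM2r// gC.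
- by apply: integrableZl_EFin => //; exact: integrable_norm.
Qed.

Section finite_sums.
Variables (I : Type) (D : set T) (F : I -> T -> R).
Hypotheses (mD : measurable D) (intF : forall i,
  mu.-integrable D (EFin \o F i)).

Lemma integrable_sum_EFin (s : seq I) (Q : pred I) :
  mu.-integrable D (EFin \o (fun x => \sum_(i <- s | Q i) F i x)).
Proof.
have := integrable_sum mD s (P := Q) (fun i _ => intF i).
by apply: eq_integrable => // x _ /=; rewrite sumEFin.
Qed.

Lemma Rintegral_sum (s : seq I) (Q : pred I) :
  \int[mu]_(x in D) (\sum_(i <- s | Q i) F i x) =
  \sum_(i <- s | Q i) \int[mu]_(x in D) F i x.
Proof.
elim: s => [|i s IH]; last rewrite big_cons -IH.
  by rewrite big_nil; under eq_Rintegral do rewrite big_nil;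
    rewrite /Rintegral integral0.
under eq_Rintegral do rewrite big_cons.
by case: ifP => // _; rewrite RintegralD//; exact: integrable_sum_EFin.
Qed.

End finite_sums.

Lemma normr_Rintegral_le D f g : measurable D -> measurable_fun D f ->
  (forall x, D x -> `|f x| <= g x) -> mu.-integrable D (EFin \o g) ->
  `|\int[mu]_(x in D) f x| <= \int[mu]_(x in D) g x.
Proof.
move=> mD mf fg ig; have intf := integrable_dominated mD mf fg ig.
apply: (le_trans (le_normr_Rintegral mD intf)).
by apply: le_Rintegral => //; exact: integrable_norm.
Qed.

Lemma Rintegral_dominated_cvg D (f_ : nat -> T -> R) f g : measurable D ->
  (forall n, measurable_fun D (f_ n)) ->
  (forall x, D x -> f_ n x @[n --> \oo] --> f x) ->
  mu.-integrable D (EFin \o g) ->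
  (forall n x, D x -> `|f_ n x| <= g x) ->
  \int[mu]_(x in D) f_ n x @[n --> \oo] --> \int[mu]_(x in D) f x.
Proof.
move=> mD mf_ f_f ig f_g.
have mf : measurable_fun D f by exact: (measurable_fun_cvg mf_ f_f).
have [||||intf _ lim_f] := @dominated_convergence _ _ _ mu D mD
    (fun n => EFin \o f_ n) (EFin \o f) (EFin \o g) _ _ _ ig.
- by move=> n; exact/measurable_EFinP.
- exact/measurable_EFinP.
- by apply: aeW => x Dx; apply: cvg_EFin; [exact: nearW|exact: f_f].
- by apply: aeW => x n Dx /=; rewrite lee_fin f_g.
by apply: fine_cvg; rewrite fineK//; exact: integrable_fin_num.
Qed.

Lemma continuous_Rintegral D (F : R -> T -> R) g : measurable D ->
  (forall x, measurable_fun D (F x)) ->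
  (forall y, D y -> continuous (F ^~ y)) ->
  (forall x y, D y -> `|F x y| <= g y) ->
  mu.-integrable D (EFin \o g) ->
  continuous (fun x => \int[mu]_(y in D) F x y).
Proof.
move=> mD mF cF Fg intg x; apply/(@cvg_nbhsP _ R^o) => u ux.
apply: (Rintegral_dominated_cvg mD _ _ intg) => // [y Dy|n y Dy].
  by apply: (cvg_comp u (F ^~ y) ux); exact: cF.
exact: Fg.
Qed.

End real_integrals.

Lemma Rintegral_pushforward d1 d2 (T1 : measurableType d1)
    (T2 : measurableType d2) (R : realType) (mu : {measure set T1 -> \bar R})
    (nu : {measure set T2 -> \bar R}) (phi : T1 -> T2) (f : T2 -> R) :
  measurable_fun setT phi ->
  (forall A, measurable A -> nu A = mu (phi @^-1` A)) ->
  measurable_fun setT f -> mu.-integrable setT (EFin \o (f \o phi)) ->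
  \int[nu]_y f y = \int[mu]_x f (phi x).
Proof.
move=> mphi nuE mf intf; rewrite /Rintegral; congr fine.
have mEf : measurable_fun setT (EFin \o f) by exact/measurable_EFinP.
have <- := integral_pushforward mphi mEf intf measurableT.
by apply: eq_measure_integral => A mA _; exact: nuE.
Qed.

Section dominated_fubini.
Context d1 d2 (T1 : measurableType d1) (T2 : measurableType d2) (R : realType).
Variables (m1 : {sigma_finite_measure set T1 -> \bar R})
  (m2 : {sigma_finite_measure set T2 -> \bar R}).
Variables (F : T1 -> T2 -> R) (f : T1 -> R) (g : T2 -> R).
Hypothesis mF : measurable_fun setT (fun z : T1 * T2 => F z.1 z.2).
Hypothesis intf : m1.-integrable setT (EFin \o f).
Hypothesis intg : m2.-integrable setT (EFin \o g).
Hypothesis Ffg : forall x y, `|F x y| <= f x * g y.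

Lemma integrable_tensor :
  (m1 \x m2)%E.-integrable setT (EFin \o (fun z : T1 * T2 => f z.1 * g z.2)).
Proof.
have mf := integrable_measurable_fun intf.
have mg := integrable_measurable_fun intg.
have mnf : measurable_fun setT (fun x => (`|f x|)%:E).
  exact/measurable_EFinP/(measurableT_comp _ mf).
have mng : measurable_fun setT (fun y => (`|g y|)%:E).
  exact/measurable_EFinP/(measurableT_comp _ mg).
apply/integrable12ltyP.
  by apply/measurable_EFinP/measurable_funM; exact: measurableT_comp.
under eq_integral do under eq_integral do rewrite /= normrM EFinM.
under eq_integral do rewrite ge0_integralZl//.
have /integrableP[_ /= gfin] := intg; have /integrableP[_ /= ffin] := intf.
rewrite ge0_integralZr//; last exact: integral_ge0.
by apply: lte_mul_pinfty => //; [exact: integral_ge0|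
  rewrite ge0_fin_numE//; exact: integral_ge0].
Qed.

Lemma integrable_dominated_prod :
  (m1 \x m2)%E.-integrable setT (EFin \o (fun z : T1 * T2 => F z.1 z.2)).
Proof.
by apply: (integrable_dominated _ mF _ integrable_tensor) => // z _; exact: Ffg.
Qed.

Let intF2 x : m2.-integrable setT (EFin \o (F x)).
Proof.
apply: (@integrable_dominated _ _ _ _ _ _ (fun y => f x * g y)) => //.
  exact: (measurable_fun_pair2 x mF).
exact: integrableZl_EFin.
Qed.

Let intF1 y : m1.-integrable setT (EFin \o (F ^~ y)).
Proof.
apply: (@integrable_dominated _ _ _ _ _ _ (fun x => g y * f x)) => //.
- exact: (measurable_fun_pair1 y mF).
- by move=> x _; rewrite mulrC Ffg.
- exact: integrableZl_EFin.
Qed.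

Lemma integrable_Rintegral :
  m1.-integrable setT (EFin \o (fun x => \int[m2]_y F x y)).
Proof.
have := integrable_fubini_F integrable_dominated_prod.
apply: eq_integrable => // x _ /=.
by rewrite /fubini_F /Rintegral fineK//;
  exact: (integrable_fin_num _ (intF2 x)).
Qed.

Lemma Rintegral_prod : \int[m1]_x \int[m2]_y F x y =
  \int[(m1 \x m2)%E]_z F z.1 z.2.
Proof.
rewrite [RHS]/Rintegral -(integral12_prod_meas1 integrable_dominated_prod).
congr fine; apply: eq_integral => x _.
by rewrite /Rintegral fineK//; exact: (integrable_fin_num _ (intF2 x)).
Qed.

Lemma Rintegral_fubini :
  \int[m1]_x \int[m2]_y F x y = \int[m2]_y \int[m1]_x F x y.
Proof.
rewrite Rintegral_prod [LHS]/Rintegral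
  -(integral21_prod_meas1 integrable_dominated_prod).
congr fine; apply: eq_integral => y _.
by rewrite /fubini_G /Rintegral fineK//;
  exact: (integrable_fin_num _ (intF1 y)).
Qed.

End dominated_fubini.

Lemma Rintegral_mscale d (T : measurableType d) (R : realType)
    (mu : {measure set T -> \bar R}) (k : {nonneg R}) (f : T -> R) :
  mu.-integrable setT (EFin \o f) ->
  \int[mscale k mu]_x f x = k%:num * \int[mu]_x f x.
Proof.
move=> intf; have mf := measurable_int mu intf.
rewrite /Rintegral -[k%:num in RHS]/(fine k%:num%:E) -fineM//; last first.
  exact: integrable_fin_num.
congr fine; rewrite [LHS]integralE (integralE mu).
rewrite ge0_integral_mscale//; last exact: measurable_funepos.
rewrite ge0_integral_mscale//; last exact: measurable_funeneg.
by rewrite [RHS]muleBr//; exact: integrable_add_def.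
Qed.

Section affine_change_of_variables.
Variable R : realType.
Local Notation leb := (@lebesgue_measure R).
Implicit Types (a b : R) (f : R -> R).

Let measurable_affine a b : measurable_fun setT (fun x : R => a * x + b).
Proof. by apply: measurable_funD => //; exact: measurable_funM. Qed.

Let preimage_affine_itv_oc a b (u v : R) : a != 0 ->
  leb ((fun x : R => a * x + b) @^-1` `]u, v]) =
  (`|a|^-1%:E * leb (`]u, v] : set R))%E.
Proof.
move=> a0; have [a_gt0|a_le0] := ltP 0 a.
- have -> : (fun x : R => a * x + b) @^-1` `]u, v] =
      `]((u - b) / a), ((v - b) / a)]%classic.
    apply/seteqP; split => x /=; rewrite !in_itv/=;
      by rewrite ltr_pdivrMr// ler_pdivlMr// ltrBlDr lerBrDr (mulrC x).
  rewrite !lebesgue_measure_itv/= !lte_fin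
    ltr_pM2r ?invr_gt0// ltrD2r gtr0_norm//.
  case: ifPn => uv; last by rewrite mule0.
  by rewrite -!EFinD -EFinM; congr EFin; field.
- have a_lt0 : a < 0 by rewrite lt_neqAle a0.
  have -> : (fun x : R => a * x + b) @^-1` `]u, v] =
      `[((v - b) / a), ((u - b) / a)[%classic.
    apply/seteqP; split => x /=; rewrite !in_itv/=;
      by rewrite ltr_ndivlMr// ler_ndivrMr// ltrBlDr lerBrDr (mulrC x) andbC.
  rewrite !lebesgue_measure_itv/= !lte_fin
    ltr_nM2r ?invr_lt0// ltrD2r ltr0_norm//.
  case: ifPn => uv; last by rewrite mule0.
  by rewrite -!EFinD -EFinM; congr EFin; field.
Qed.

Lemma lebesgue_preimage_affine a b (A : set R) : a != 0 -> measurable A ->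
  leb ((fun x => a * x + b) @^-1` A) = (`|a|^-1%:E * leb A)%E.
Proof.
move=> a0 mA; pose phi : R -> measurableTypeR R := fun x => a * x + b.
have mphi : measurable_fun setT phi by exact: measurable_affine.
have na0 : 0 < `|a| by rewrite normr_gt0.
have [m mE] : exists m : measure (measurableTypeR R) R,
    forall B, m B = (`|a|%:E * leb (phi @^-1` B))%E.
  unshelve eexists (mscale (NngNum (ltW na0)) (pushforward leb phi)).
    exact: mphi.
  by [].
suff -> : leb A = (`|a|%:E * leb (phi @^-1` A))%E.
  by rewrite muleA -EFinM mulVf ?mul1e// gt_eqF.
rewrite -mE; apply: lebesgue_measure_unique => // X [[u v]] _ <-.
by rewrite mE preimage_affine_itv_oc// muleA -EFinM mulfV ?mul1e// gt_eqF.
Qed.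

Section integral.
Variables (a b : R) (f : R -> R).
Hypotheses (a_neq0 : a != 0) (intf : leb.-integrable setT (EFin \o f)).

Lemma integrable_affine :
  leb.-integrable setT (EFin \o (fun x => f (a * x + b))).
Proof.
have naV0 : 0 < `|a|^-1 by rewrite invr_gt0 normr_gt0.
have mphi : measurable_fun (setT : set (measurableTypeR R))
    ((fun x => a * x + b) : measurableTypeR R -> measurableTypeR R).
  exact: measurable_affine.
have mf := integrable_measurable_fun intf; have /integrableP[_ fin] := intf.
apply/integrableP; split.
  by apply/measurable_EFinP; apply: measurableT_comp => //;
    exact: measurable_affine.
have mnf : measurable_fun setT (fun y => `|(EFin \o f) y|%E).
  by apply: measurableT_comp => //; exact/measurable_EFinP.
rewrite [ltLHS](_ : _ = \int[mscale (NngNum (ltW naV0)) leb]_y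
  `|(EFin \o f) y|)%E.
  by rewrite ge0_integral_mscale// lte_mul_pinfty// lee_fin ltW.
rewrite -[LHS](@ge0_integral_pushforward _ _ _ _ _
  ((fun x => a * x + b) : measurableTypeR R -> measurableTypeR R) mphi leb setT
  (fun y => `|(EFin \o f) y|%E))//.
by apply: eq_measure_integral => A mA _; exact: lebesgue_preimage_affine.
Qed.

Lemma Rintegral_affine : \int[leb]_x f (a * x + b) = `|a|^-1 * \int[leb]_x f x.
Proof.
have naV0 : 0 < `|a|^-1 by rewrite invr_gt0 normr_gt0.
rewrite -(@Rintegral_pushforward _ _ _ _ _ leb
  (mscale (NngNum (ltW naV0)) leb) (fun x => a * x + b))//.
- exact: Rintegral_mscale.
- exact: measurable_affine.
- by move=> A mA; exact/esym/lebesgue_preimage_affine.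
- exact: integrable_measurable_fun intf.
- exact: integrable_affine.
Qed.

End integral.

Lemma integrable_shift b f : leb.-integrable setT (EFin \o f) ->
  leb.-integrable setT (EFin \o (fun x => f (x + b))).
Proof.
move=> /(integrable_affine b (oner_neq0 R)).
by apply: eq_integrable => // x _ /=; rewrite mul1r.
Qed.

Lemma Rintegral_shift b f : leb.-integrable setT (EFin \o f) ->
  \int[leb]_x f (x + b) = \int[leb]_x f x.
Proof.
move=> /(Rintegral_affine b (oner_neq0 R)); rewrite normr1 invr1 mul1r => <-.
by apply: eq_Rintegral => x _; rewrite mul1r.
Qed.

Lemma integrable_oppr f : leb.-integrable setT (EFin \o f) ->
  leb.-integrable setT (EFin \o (fun x => f (- x))).
Proof.
have N1 : (-1 : R) != 0 by rewrite oppr_eq0 oner_eq0.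
move=> /(integrable_affine 0 N1).
by apply: eq_integrable => // x _ /=; rewrite addr0 mulN1r.
Qed.

Lemma Rintegral_oppr f : leb.-integrable setT (EFin \o f) ->
  \int[leb]_x f (- x) = \int[leb]_x f x.
Proof.
have N1 : (-1 : R) != 0 by rewrite oppr_eq0 oner_eq0.
move=> /(Rintegral_affine 0 N1); rewrite normrN1 invr1 mul1r => <-.
by apply: eq_Rintegral => x _; rewrite addr0 mulN1r.
Qed.

End affine_change_of_variables.

Section complex_numbers.
Variable R : realType.
Implicit Types (z w : R[i]) (s t th : R).

(* The real function [wave z] determines [z]: an identity between complex
   integrals or limits is stated by applying [wave ^~ th] to both sides, for
   all [th], so that only real integrals and limits occur. *)
Definition wave z th : R := Re z * cos th - Im z * sin th.

Lemma wave_Re z : wave z 0 = Re z.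
Proof. by rewrite /wave cos0 sin0 mulr1 mulr0 subr0. Qed.

Lemma wave_Im z : wave z (- (pi / 2)) = Im z.
Proof.
by rewrite /wave cosN sinN cos_pihalf sin_pihalf mulr0 mulrN1 opprK add0r.
Qed.

Lemma wave_inj z w : (forall th, wave z th = wave w th) -> z = w.
Proof.
move=> zw; move: (zw 0) (zw (- (pi / 2))); rewrite !wave_Re !wave_Im.
by case: z w {zw} => [a b] [c e] /= -> ->.
Qed.

Lemma waveC a th : wave a%:C%C th = a * cos th.
Proof. by rewrite /wave/= mul0r subr0. Qed.

Lemma waveD z w th : wave (z + w) th = wave z th + wave w th.
Proof. by case: z w => [a b] [c e]; rewrite /wave/=; ring. Qed.

Lemma waveM z w th :
  wave (z * w) th = Re w * wave z th + Im w * wave z (th + pi / 2).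
Proof.
by rewrite /wave cosDpihalf sinDpihalf; case: z w => [a b] [c e] /=; ring.
Qed.

Lemma waveZ a z th : wave (a%:C%C * z) th = a * wave z th.
Proof. by case: z => c e; rewrite /wave/=; ring. Qed.

Lemma wave_sum (I : Type) (r : seq I) (Q : pred I) (F : I -> R[i]) th :
  wave (\sum_(i <- r | Q i) F i) th = \sum_(i <- r | Q i) wave (F i) th.
Proof.
elim/big_rec2 : _ => [|i x z _ <-]; last by rewrite waveD.
by rewrite /wave/= !mul0r subrr.
Qed.

Lemma normr_wave_le z th : `|wave z th| <= Normc.normc z.
Proof.
case: z => a b; rewrite /wave/= -sqrtr_sqr; apply: ler_wsqrtr.
have := cos2Dsin2 th; move: (cos th) (sin th) => c e ce1.
rewrite -subr_ge0 [leRHS](_ : _ = (a * e + b * c) ^+ 2) ?sqr_ge0//.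
transitivity ((a ^+ 2 + b ^+ 2) * (c ^+ 2 + e ^+ 2) - (a * c - b * e) ^+ 2);
  last by ring.
by rewrite ce1 mulr1.
Qed.

Lemma normc_le_ReIm z : Normc.normc z <= `|Re z| + `|Im z|.
Proof.
case: z => a b /=; rewrite -[leRHS]ger0_norm ?addr_ge0// -sqrtr_sqr.
apply: ler_wsqrtr;
  rewrite -(real_normK (num_real a)) -(real_normK (num_real b)).
by rewrite sqrrD lerD2r lerDl mulrn_wge0// mulr_ge0.
Qed.

Lemma normc_le_wave z B : (forall th, `|wave z th| <= B) ->
  Normc.normc z <= 2 * B.
Proof.
move=> zB; apply: (le_trans (normc_le_ReIm z)); rewrite mulr_natl mulr2n.
by apply: lerD; rewrite -?wave_Re -?wave_Im.
Qed.

Lemma normcX z n : Normc.normc (z ^+ n) = Normc.normc z ^+ n.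
Proof.
elim: n => [|n IH]; first by rewrite !expr0 Normc.normc1.
by rewrite !exprS Normc.normcM IH.
Qed.

Lemma normc_ge0 z : 0 <= Normc.normc z.
Proof. by case: z => a b; exact: sqrtr_ge0. Qed.

Definition expC z : R[i] :=
  Complex (expR (Re z) * cos (Im z)) (expR (Re z) * sin (Im z)).

Lemma wave_expC z th : wave (expC z) th = expR (Re z) * cos (th + Im z).
Proof. by rewrite /wave/= cosD; ring. Qed.

Lemma expC0 : expC 0 = 1.
Proof. by rewrite /expC/= expR0 cos0 sin0 mulr0 mulr1. Qed.

Lemma expCD z w : expC (z + w) = expC z * expC w.
Proof.
apply: wave_inj => th; rewrite waveM !wave_expC.
case: z w => [a b] [c e] /=.
by rewrite expRD (addrAC th) cosDpihalf addrA [in LHS]cosD; ring.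
Qed.

Lemma normc_expC z : Normc.normc (expC z) = expR (Re z).
Proof.
rewrite /expC /= !exprMn -mulrDr cos2Dsin2 mulr1 sqrtr_sqr.
by rewrite ger0_norm ?expR_ge0.
Qed.

End complex_numbers.

Section complex_functions.
Variable R : realType.

Definition measurable_cfun d (T : measurableType d) (f : T -> R[i]) : Prop :=
  measurable_fun setT (fun x => Re (f x)) /\
  measurable_fun setT (fun x => Im (f x)).

Definition continuous_cfun (f : R -> R[i]) : Prop :=
  continuous (fun x => Re (f x)) /\ continuous (fun x => Im (f x)).

Lemma measurable_cos D : measurable_fun D (@cos R).
Proof.
by apply: measurable_funTS; apply: continuous_measurable_fun;
  exact: continuous_cos.
Qed.

Lemma measurable_sin D : measurable_fun D (@sin R).
Proof.
by apply: measurable_funTS; apply: continuous_measurable_fun;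
  exact: continuous_sin.
Qed.

Lemma continuous_cfun_measurable (f : R -> R[i]) :
  continuous_cfun f -> measurable_cfun f.
Proof. by move=> [? ?]; split; exact: continuous_measurable_fun. Qed.

Lemma continuous_cfunN (f : R -> R[i]) :
  continuous_cfun f -> continuous_cfun (fun x => - f x).
Proof.
move=> [cr ci]; split => x.
- rewrite (_ : (fun x => Re (- f x)) = (fun x => - Re (f x))).
    by apply: cvgN; exact: cr.
  by apply/funext => y; case: (f y).
- rewrite (_ : (fun x => Im (- f x)) = (fun x => - Im (f x))).
    by apply: cvgN; exact: ci.
  by apply/funext => y; case: (f y).
Qed.

Lemma continuous_cfunM (f g : R -> R[i]) : continuous_cfun f ->
  continuous_cfun g -> continuous_cfun (fun x => f x * g x).
Proof.
move=> [cfr cfi] [cgr cgi]; split => x.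
- rewrite (_ : (fun x => Re _) =
    (fun x => Re (f x) * Re (g x) - Im (f x) * Im (g x))).
    by apply: cvgB; apply: cvgM; [exact: cfr|exact: cgr|exact: cfi|exact: cgi].
  by apply/funext => y; case: (f y) (g y) => [? ?] [? ?].
- rewrite (_ : (fun x => Im _) =
    (fun x => Re (f x) * Im (g x) + Im (f x) * Re (g x))).
    by apply: cvgD; apply: cvgM; [exact: cfr|exact: cgi|exact: cfi|exact: cgr].
  by apply/funext => y; case: (f y) (g y) => [? ?] [? ?].
Qed.

Lemma continuous_wave (z : R[i]) : continuous (wave z).
Proof.
move=> th; apply: cvgB; apply: cvgMr;
  [exact: continuous_cos|exact: continuous_sin].
Qed.

Lemma continuous_cfun_wave (f : R -> R[i]) :
  (forall th, continuous (fun x => wave (f x) th)) -> continuous_cfun f.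
Proof.
move=> cf; split; first by have := cf 0; under eq_fun do rewrite wave_Re.
by have := cf (- (pi / 2)); under eq_fun do rewrite wave_Im.
Qed.

Context d (T : measurableType d).
Implicit Types f g : T -> R[i].

Lemma measurable_cfunM f g : measurable_cfun f -> measurable_cfun g ->
  measurable_cfun (fun x => f x * g x).
Proof.
move=> [mfr mfi] [mgr mgi]; split.
- rewrite (_ : (fun x => Re _) =
    (fun x => Re (f x) * Re (g x) - Im (f x) * Im (g x))).
    by apply: measurable_funB; exact: measurable_funM.
  by apply/funext => x; case: (f x) (g x) => [? ?] [? ?].
- rewrite (_ : (fun x => Im _) =
    (fun x => Re (f x) * Im (g x) + Im (f x) * Re (g x))).
    by apply: measurable_funD; exact: measurable_funM.
  by apply/funext => x; case: (f x) (g x) => [? ?] [? ?].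
Qed.

Lemma measurable_cfunX f n : measurable_cfun f ->
  measurable_cfun (fun x => f x ^+ n).
Proof.
move=> mf; elim: n => [|n IH]; first by split; exact: measurable_cst.
by under eq_fun do rewrite exprS; exact: measurable_cfunM.
Qed.

Lemma measurable_wave f (h : T -> R) : measurable_cfun f ->
  measurable_fun setT h -> measurable_fun setT (fun x => wave (f x) (h x)).
Proof.
move=> [mr mi] mh; apply: measurable_funB; apply: measurable_funM => //.
- by apply: measurableT_comp mh; exact: measurable_cos.
- by apply: measurableT_comp mh; exact: measurable_sin.
Qed.

End complex_functions.

Section derivatives.
Variable R : realType.
Implicit Types (f g F : R -> R) (x : R).

Lemma is_derive_continuous F f : (forall x, is_derive x 1 F (f x)) ->
  continuous F.
Proof.
by move=> dF x; apply/differentiable_continuous/derivable1_diffP;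
  have [] := dF x.
Qed.

Lemma is_derive_addf f g x (f' g' : R) : is_derive x 1 f f' ->
  is_derive x 1 g g' -> is_derive x 1 (fun y => f y + g y) (f' + g').
Proof. by move=> df dg; exact: is_deriveD. Qed.

Lemma is_derive_subf f g x (f' g' : R) : is_derive x 1 f f' ->
  is_derive x 1 g g' -> is_derive x 1 (fun y => f y - g y) (f' - g').
Proof. by move=> df dg; exact: is_deriveB. Qed.

Lemma is_derive_mulf f g x (f' g' : R) : is_derive x 1 f f' ->
  is_derive x 1 g g' -> is_derive x 1 (fun y => f y * g y)
    (f' * g x + f x * g').
Proof.
move=> df dg; have /is_derive_eq := is_deriveM df dg; apply.
by rewrite /GRing.scale/= addrC (mulrC f').
Qed.

Lemma is_derive_mull c f x (f' : R) : is_derive x 1 f f' ->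
  is_derive x 1 (fun y => c * f y) (c * f').
Proof. by move=> df; exact: is_deriveZ. Qed.

Lemma is_derive_affine a b x : is_derive x 1 (fun y => b + a * y) a.
Proof.
have := is_derive_addf (is_derive_cst b x 1)
  (is_derive_mull a (is_derive_id x 1)).
by move=> /is_derive_eq; apply; rewrite add0r mulr1.
Qed.

Lemma is_derive_cos_affine a b x :
  is_derive x 1 (fun y => cos (b + a * y)) (a * cos (b + a * x + pi / 2)).
Proof.
have := @is_derive1_comp _ cos (fun y => b + a * y) x _ _
  (is_derive_cos _) (is_derive_affine a b x).
by move=> /is_derive_eq; apply; rewrite cosDpihalf mulrC.
Qed.

Lemma is_derive_expR_linear a x :
  is_derive x 1 (fun y => expR (a * y)) (a * expR (a * x)).
Proof.
have := @is_derive1_comp _ expR (fun y => a * y) x _ _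
  (is_derive_expR _) (is_derive_mull a (is_derive_id x 1)).
by move=> /is_derive_eq; apply; rewrite mulr1 mulrC.
Qed.

Lemma is_derive_wave_expC (w z : R[i]) th x :
  is_derive x 1 (fun y => wave (expC (y%:C%C * z) * w) th)
    (wave (expC (x%:C%C * z) * (z * w)) th).
Proof.
have expCE y t : wave (expC (y%:C%C * z)) t =
  expR (Re z * y) * cos (t + Im z * y).
  by rewrite wave_expC; case: (z) => a b /=;
    rewrite !mul0r subr0 addr0 !(mulrC y).
have dexpC t : is_derive x 1 (fun y => wave (expC (y%:C%C * z)) t)
    (wave (expC (x%:C%C * z) * z) t).
  rewrite (funext (fun y => expCE y t)) waveM !expCE.
  have := is_derive_mulf (is_derive_expR_linear (Re z) x)
    (is_derive_cos_affine (Im z) t x).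
  by move=> /is_derive_eq; apply; rewrite (addrAC t (pi / 2)); ring.
rewrite mulrA waveM; under eq_fun do rewrite waveM.
by apply: is_derive_addf; exact: is_derive_mull.
Qed.

End derivatives.

Section line_integrals.
Variable R : realType.
Local Notation leb := (@lebesgue_measure R).
Implicit Types (f F : R -> R).

Lemma Rintegral_itv_derive F f (a b : R) :
  (forall x : R, is_derive x 1 F (f x)) -> continuous f -> a <= b ->
  \int[leb]_(x in `[a, b]) f x = F b - F a.
Proof.
move=> dF cf; rewrite le_eqVlt => /predU1P[<-|ab].
  by rewrite set_itv1 Rintegral_set1 subrr.
have cF := is_derive_continuous dF.
rewrite /Rintegral (@continuous_FTC2 _ f F)//.
- exact: continuous_subspaceT.
- split.
  + by move=> x _; have [] := dF x.
  + exact/cvg_at_right_filter/cF.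
  + exact/cvg_at_left_filter/cF.
- by move=> x _; rewrite derive1E; have [] := dF x.
Qed.

Lemma Rintegral_exhaustion (D : set R) (E_ : nat -> set R) f :
  measurable D -> (forall n, measurable (E_ n)) -> (forall n, E_ n `<=` D) ->
  (forall x, D x -> \forall n \near \oo, E_ n x) ->
  leb.-integrable D (EFin \o f) ->
  \int[leb]_(x in E_ n) f x @[n --> \oo] --> \int[leb]_(x in D) f x.
Proof.
move=> mD mE ED Ecover intf; have mf := integrable_measurable_fun intf.
under eq_cvg do rewrite -(setIidr (ED _)) Rintegral_mkcondr.
apply: (@Rintegral_dominated_cvg _ _ _ leb _ _ _ (fun x => `|f x|)) => //.
- move=> n; apply: (measurable_restrict _ _ _).1 => //.
    exact: mE.
  by apply: measurable_funS mf => // x [].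
- move=> x Dx; apply: cvg_near_cst; apply: filterS (Ecover x Dx) => n Enx.
  by rewrite patchE mem_set.
- exact: integrable_norm.
- by move=> n x _; rewrite patchE; case: ifPn => //; rewrite normr0.
Qed.

Lemma Rintegral_line_derive F f (l : R) :
  (forall x : R, is_derive x 1 F (f x)) -> continuous f ->
  leb.-integrable setT (EFin \o f) ->
  F n%:R - F (- n%:R) @[n --> \oo] --> l -> \int[leb]_x f x = l.
Proof.
move=> dF cf intf Fl.
have := @Rintegral_exhaustion setT (fun n => `[- n%:R, n%:R]%classic) f.
move=> /(_ measurableT _ _ _ intf) /cvg_unique; apply=> //.
  move=> x _; near=> n; rewrite /= in_itv/= -ler_norml.
  by near: n; exact: nbhs_infty_ger.
have nn n : - n%:R <= n%:R :> R by rewrite -subr_ge0 opprK addr_ge0.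
by rewrite /=; under eq_cvg do rewrite (Rintegral_itv_derive dF cf)//;
  exact: Fl.
Unshelve. all: by end_near. Qed.

Lemma Rintegral_halfline_derive F f (l : R) :
  (forall x : R, is_derive x 1 F (f x)) -> continuous f ->
  leb.-integrable `[0, +oo[ (EFin \o f) ->
  F n%:R @[n --> \oo] --> l -> \int[leb]_(x in `[0, +oo[) f x = l - F 0.
Proof.
move=> dF cf intf Fl.
have := @Rintegral_exhaustion `[0, +oo[ (fun n => `[0, n%:R]%classic) f.
move=> /(_ _ _ _ _ intf) /cvg_unique; apply=> //.
- by move=> n x /=; rewrite !in_itv/= andbT => /andP[].
- move=> x /=; rewrite in_itv/= andbT => x0; near=> n; rewrite in_itv/= x0/=.
  by near: n; exact: nbhs_infty_ger.
rewrite /=; under eq_cvg do rewrite (Rintegral_itv_derive dF cf)//.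
by apply: cvgB => //; exact: cvg_cst.
Unshelve. all: by end_near. Qed.

Lemma Rintegral_fold f : leb.-integrable setT (EFin \o f) ->
  \int[leb]_x f x = \int[leb]_(x in `[0, +oo[) (f x + f (- x)).
Proof.
move=> intf; have intNf := integrable_oppr intf.
have intSf (D : set R) : measurable D -> leb.-integrable D (EFin \o f).
  by move=> mD; exact: integrableS intf.
rewrite RintegralD//; last 2 first.
- exact: intSf.
- exact: integrableS intNf.
have -> : \int[leb]_(x in `[0, +oo[) f (- x) = \int[leb]_(x in `]-oo, 0]) f x.
  rewrite Rintegral_mkcond [RHS]Rintegral_mkcond -[RHS]Rintegral_oppr.
    apply: eq_Rintegral => x _; rewrite !patchE; congr (if _ then _ else _).
    by apply/idP/idP; rewrite !inE/= !in_itv/= ?andbT; lra.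
  by rewrite -restrict_EFin; apply/(integrable_mkcond _ _).1 => //;
    exact: intSf.
rewrite -Rintegral_itv_bndo_bndc; last exact: intSf.
rewrite addrC -Rintegral_setU//; rewrite -?itv_bndbnd_setU// ?set_itvNyy//.
by apply/disj_setPS => y [/=]; rewrite !in_itv/= andbT; lra.
Qed.

End line_integrals.

Section cauchy_weight.
Variable R : realType.
Local Notation leb := (@lebesgue_measure R).
Local Notation w := (fun x : R => (oneDsqr x)^-1).
Implicit Types (f F : R -> R) (C : R).

Lemma oneDsqrV_gt0 (x : R) : 0 < w x.
Proof. by rewrite invr_gt0. Qed.

Lemma oneDsqrV_shift_le (x y : R) : w (x + y) <= 2 * oneDsqr y * w x.
Proof.
rewrite -ler_pdivrMr ?oneDsqrV_gt0// invrK mulrC ler_pdivrMr//.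
rewrite /oneDsqr; have := sqr_ge0 (x + 2 * y); have := sqr_ge0 ((x + y) * y).
by have := sqr_ge0 (x + y); rewrite !expr2; nra.
Qed.

Lemma oneDsqrV_nat_cvg0 : w n%:R @[n --> \oo] --> (0 : R).
Proof.
apply: (@squeeze_cvgr _ _ _ _ (fun=> 0) (fun n : nat => n.+1%:R^-1)).
- apply: nearW => n; rewrite ltW ?oneDsqrV_gt0//= lef_pV2 ?posrE//.
  rewrite /oneDsqr -nat1r lerD2l.
  by case: n => [|n]; rewrite ?expr0n// expr2 ler_peMr// ler1n.
- exact: cvg_cst.
- exact: cvg_harmonic.
Qed.

Lemma integrable_oneDsqrV : leb.-integrable setT (EFin \o w).
Proof.
have mw : measurable_fun setT w.
  by apply: continuous_measurable_fun; exact: continuous_oneDsqrV.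
apply/integrableP; split; first exact/measurable_EFinP.
under eq_integral do rewrite /= gtr0_norm ?oneDsqrV_gt0//.
rewrite ge0_symfun_integralT//=; last 2 first.
- exact: continuous_oneDsqrV.
- by move=> x; rewrite /= /oneDsqr sqrrN.
rewrite (_ : [set x | 0 <= x] = `[0, +oo[%classic); last first.
  by apply/seteqP; split => x /=; rewrite in_itv/= andbT.
by rewrite integral0y_oneDsqr -EFinM ltry.
Qed.

Lemma Rintegral_oneDsqrV : \int[leb]_x w x = pi.
Proof.
rewrite Rintegral_fold; last exact: integrable_oneDsqrV.
under eq_Rintegral do rewrite /oneDsqr sqrrN -/(oneDsqr _) -mulr2n -mulr_natl.
rewrite RintegralZl//; last exact: integrableS integrable_oneDsqrV.
by rewrite /Rintegral integral0y_oneDsqr /= mulrC divfK.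
Qed.

Definition cauchy_dominated C f : Prop := forall x, `|f x| <= C * w x.

Section dominated.
Variables (f : R -> R) (C : R).
Hypotheses (mf : measurable_fun setT f) (fC : cauchy_dominated C f).

Lemma integrable_cauchy_dominated : leb.-integrable setT (EFin \o f).
Proof.
apply: (@integrable_dominated _ _ _ leb _ _ (fun x => C * w x)) => //.
by apply: integrableZl_EFin => //; exact: integrable_oneDsqrV.
Qed.

Lemma normr_Rintegral_cauchy : `|\int[leb]_x f x| <= C * pi.
Proof.
rewrite -Rintegral_oneDsqrV -RintegralZl//; last exact: integrable_oneDsqrV.
by apply: normr_Rintegral_le => //; apply: integrableZl_EFin => //;
  exact: integrable_oneDsqrV.
Qed.

End dominated.

Lemma cauchy_dominated_ge0 C f : cauchy_dominated C f -> 0 <= C.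
Proof.
move=> /(_ 0); rewrite /oneDsqr expr0n/= addr0 invr1 mulr1.
exact: le_trans.
Qed.

Lemma cauchy_dominated_le C f x : cauchy_dominated C f -> `|f x| <= C.
Proof.
move=> fC; rewrite (le_trans (fC x))// ler_piMr ?oneDsqrV_le1//.
exact: cauchy_dominated_ge0 fC.
Qed.

Lemma cauchy_dominatedW C D f : C <= D -> cauchy_dominated C f ->
  cauchy_dominated D f.
Proof.
by move=> CD fC x; rewrite (le_trans (fC x))// ler_wpM2r// ltW// oneDsqrV_gt0.
Qed.

Lemma cauchy_dominatedM C f (h : R -> R) : (forall x, `|h x| <= 1) ->
  cauchy_dominated C f -> cauchy_dominated C (fun x => h x * f x).
Proof. by move=> h1 fC x; rewrite normrM (le_trans _ (fC x))// ler_piMl. Qed.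

Lemma Rintegral_derive_cauchy_dominated C F f :
  (forall x : R, is_derive x 1 F (f x)) -> continuous f ->
  leb.-integrable setT (EFin \o f) -> cauchy_dominated C F ->
  \int[leb]_x f x = 0.
Proof.
move=> dF cf intf FC; have Cw0 : C * w n%:R @[n --> \oo] --> 0.
  by rewrite -[X in _ --> X](mulr0 C); apply: cvgMr; exact: oneDsqrV_nat_cvg0.
have vanish (x : nat -> R) : (forall n, oneDsqr (x n) = oneDsqr n%:R) ->
    F (x n) @[n --> \oo] --> 0.
  move=> xn; apply: (@norm_cvg0 _ R^o).
  apply: (@squeeze_cvgr _ _ _ _ (fun=> 0) (fun n => C * w n%:R)) Cw0.
    by apply: nearW => n; rewrite normr_ge0/= -xn FC.
  exact: cvg_cst.
apply: (Rintegral_line_derive dF cf intf); rewrite -[X in _ --> X](subrr 0).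
by apply: cvgB; apply: vanish => // n; rewrite /oneDsqr sqrrN.
Qed.

Lemma expR_cauchy_dominated (e : R) : 0 < e ->
  exists C, cauchy_dominated C (fun x => expR (- (e * `|x|))).
Proof.
move=> e0; exists (1 + 2 / e ^+ 2) => x.
have ex0 : 0 <= e * `|x| by rewrite mulr_ge0// ltW.
rewrite ger0_norm ?expR_ge0// expRN ler_pdivlMr// ler_pdivrMl ?expR_gt0//.
apply: (@le_trans _ _ ((1 + (e * `|x|) ^+ 2 / 2) * (1 + 2 / e ^+ 2))); last first.
  rewrite ler_wpM2r//; first by rewrite addr_ge0// divr_ge0// exprn_ge0// ltW.
  exact: (expR_ge1Dxn 1 ex0).
rewrite exprMn real_normK ?num_real// -subr_ge0.
rewrite [leRHS](_ : _ = 2 / e ^+ 2 + e ^+ 2 * x ^+ 2 / 2); last first.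
  by rewrite /oneDsqr; field; rewrite gt_eqF.
have e2 : 0 <= e ^+ 2 by exact: sqr_ge0.
by apply: addr_ge0; apply: divr_ge0 => //; apply: mulr_ge0; rewrite ?sqr_ge0.
Qed.

Lemma integrable_abel_weight (e : R) : 0 < e ->
  leb.-integrable setT (EFin \o (fun x => expR (- (e * `|x|)))).
Proof.
move=> e0; have [C eC] := expR_cauchy_dominated e0.
apply: integrable_cauchy_dominated eC; apply: measurableT_comp => //.
by apply: measurableT_comp => //; exact: measurable_funM.
Qed.

Lemma integrable_abel_cos (e z : R) : 0 < e -> leb.-integrable setT
  (EFin \o (fun x => expR (- (e * `|x|)) * cos (z * x))).
Proof.
move=> e0; under eq_fun do rewrite mulrC.
apply: (@integrableM_bounded _ _ _ leb _ _ _ 1) => //.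
- by apply: (measurableT_comp (@measurable_cos R setT)); exact: measurable_funM.
- by move=> x _; exact: cos_max.
- exact: integrable_abel_weight.
Qed.

Lemma wave_expC_cvg0 (z c : R[i]) th : Re z < 0 ->
  wave (expC (n%:R%:C%C * z) * c) th @[n --> \oo] --> 0.
Proof.
move=> z_lt0; have e0 : 0 < - Re z by rewrite oppr_gt0.
have [C eC] := expR_cauchy_dominated e0; apply: (@norm_cvg0 _ R^o).
apply: (@squeeze_cvgr _ _ _ _ (fun=> 0)
  (fun n : nat => C * Normc.normc c * w n%:R)).
- apply: nearW => n; rewrite normr_ge0/= (le_trans (normr_wave_le _ _))//.
  rewrite Normc.normcM normc_expC mulrAC ler_wpM2r ?normc_ge0//.
  rewrite (le_trans _ (eC n%:R))// ger0_norm ?expR_ge0// normr_nat mulNr opprK.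
  by case: (z) => a b /=; rewrite mul0r subr0 mulrC.
- exact: cvg_cst.
- rewrite -[X in _ --> X](mulr0 (C * Normc.normc c)).
  by apply: cvgMr; exact: oneDsqrV_nat_cvg0.
Qed.

Lemma Rintegral_abel_kernel (e z : R) : 0 < e ->
  \int[leb]_x (expR (- (e * `|x|)) * cos (z * x)) = 2 * e / (e ^+ 2 + z ^+ 2).
Proof.
move=> e0; have ez0 : e ^+ 2 + z ^+ 2 != 0.
  by rewrite gt_eqF// ltr_wpDr ?sqr_ge0// exprn_gt0.
pose ze : R[i] := Complex (- e) z.
pose f (x : R) := wave (expC (x%:C%C * ze) * (ze * ze^-1)) 0.
pose F (x : R) := wave (expC (x%:C%C * ze) * ze^-1) 0.
have ze0 : ze != 0 by rewrite eq_complex/= oppr_eq0 (gt_eqF e0).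
have dF (x : R) : is_derive x 1 F (f x) := is_derive_wave_expC _ _ _ _.
have fE x : 0 <= x -> f x = expR (- (e * `|x|)) * cos (z * x).
  move=> x0; rewrite /f mulfV// mulr1 wave_expC/= !mul0r subr0 addr0 add0r.
  by rewrite ger0_norm// mulrN (mulrC x e) (mulrC x z).
have cf : continuous f.
  apply: (@is_derive_continuous _ _
    (fun x => wave (expC (x%:C%C * ze) * (ze * (ze * ze^-1))) 0)) => x.
  exact: is_derive_wave_expC.
have int_abel := integrable_abel_cos z e0.
have intf : leb.-integrable `[0, +oo[ (EFin \o f).
  have /eq_integrable : leb.-integrable `[0, +oo[
    (EFin \o (fun x => expR (- (e * `|x|)) * cos (z * x))).
    exact: integrableS int_abel.
  by apply=> // x; rewrite inE/= in_itv/= andbT => x0; rewrite fE.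
have F_cvg0 : F n%:R @[n --> \oo] --> 0.
  by apply: wave_expC_cvg0; rewrite /= oppr_lt0.
rewrite Rintegral_fold//; transitivity (\int[leb]_(x in `[0, +oo[) (2 * f x)).
  apply: eq_Rintegral => x; rewrite inE/= in_itv/= andbT => x0.
  by rewrite normrN fE// mulrN cosN; ring.
rewrite RintegralZl// (Rintegral_halfline_derive dF cf intf F_cvg0).
by rewrite /F mul0r expC0 mul1r wave_Re/= sqrrN; field.
Qed.

End cauchy_weight.

Section schwartz_functions.
Variable R : realType.
Implicit Types (u : R -> R) (n : nat).

Lemma schwartz_is_derive u n (x : R) : schwartz u ->
  is_derive x 1 (derive1n n u) (derive1n n.+1 u x).
Proof.
by move=> [su _]; apply: DeriveDef; [exact: su|rewrite derive1nS derive1E].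
Qed.

Lemma schwartz_continuous u n : schwartz u -> continuous (derive1n n u).
Proof.
move=> su; apply: (@is_derive_continuous _ _ (derive1n n.+1 u)) => x.
exact: schwartz_is_derive.
Qed.

Lemma schwartz_cauchy_dominated u n : schwartz u ->
  exists C, cauchy_dominated C (derive1n n u).
Proof.
move=> [_ su]; have [C0 h0] := su 0 n; have [C2 h2] := su 2 n.
exists (C0 + C2) => x; rewrite ler_pdivlMr// /oneDsqr mulrDr mulr1.
apply: lerD; first by have := h0 x; rewrite expr0 mul1r.
by have := h2 x; rewrite normrM ger0_norm ?sqr_ge0// mulrC.
Qed.

Lemma schwartz_bounded u n : schwartz u -> exists B, forall x,
  `|derive1n n u x| <= B.
Proof.
by move=> [_ /(_ 0 n)[B uB]]; exists B => x; have := uB x; rewrite expr0 mul1r.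
Qed.

Lemma schwartz_C_infty u : schwartz u -> C_infty u.
Proof.
move=> su; split; first exact: (schwartz_continuous (n := 0) su).
have [C uC] := schwartz_cauchy_dominated 0%N su.
have C0 := cauchy_dominated_ge0 uC.
move=> e e0; exists (1 + C / e) => x xM.
apply: (le_lt_trans (uC x));
  rewrite ltr_pdivrMr// mulrC -ltr_pdivrMr// /oneDsqr.
have Ce : 0 <= C / e by rewrite divr_ge0// ltW.
have : `|x| <= `|x| ^+ 2 by rewrite expr2
  ler_peMr// ltW// (le_lt_trans _ xM)// lerDl.
by rewrite real_normK ?num_real//; lra.
Qed.

End schwartz_functions.

Section fourier_transform.
Variable R : realType.
Local Notation leb := (@lebesgue_measure R).
Local Notation w := (fun x : R => (oneDsqr x)^-1).
Local Notation fourier_cst := ((Num.sqrt (2 * pi) : R)^-1).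
Implicit Types (f u : R -> R) (C D p th x : R).

Lemma fourier_cst_gt0 : 0 < fourier_cst.
Proof. by rewrite invr_gt0 sqrtr_gt0 mulr_gt0// pi_gt0. Qed.

Lemma fourier_cst_sqr : fourier_cst * fourier_cst = (2 * pi)^-1.
Proof. by rewrite -invfM -expr2 sqr_sqrtr// mulr_ge0// pi_ge0. Qed.

Definition fourier u p : R[i] := Complex (Fc u p) (- Fs u p).

Lemma continuous_cos_affine a b : continuous (fun x : R => cos (a + b * x)).
Proof. exact: is_derive_continuous (is_derive_cos_affine b a). Qed.

Lemma measurable_cos_affine a b :
  measurable_fun setT (fun x : R => cos (a + b * x)).
Proof. by apply: continuous_measurable_fun; exact: continuous_cos_affine. Qed.

Lemma integrable_cosM a b u : leb.-integrable setT (EFin \o u) ->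
  leb.-integrable setT (EFin \o (fun x => cos (a + b * x) * u x)).
Proof.
apply: (@integrableM_bounded _ _ _ leb _ _ _ 1) => //.
- exact: measurable_cos_affine.
- by move=> x _; exact: cos_max.
Qed.

Lemma wave_fourier u p th : leb.-integrable setT (EFin \o u) ->
  wave (fourier u p) th = fourier_cst * \int[leb]_x (cos (th - p * x) * u x).
Proof.
move=> iu.
have icos : leb.-integrable setT (EFin \o (fun x => cos (p * x) * u x)).
  by have := integrable_cosM 0 p iu; under eq_fun do rewrite add0r.
have isin : leb.-integrable setT (EFin \o (fun x => sin (p * x) * u x)).
  have := integrable_cosM (- (pi / 2)) p iu.
  by under eq_fun do rewrite addrC cosBpihalf.
under eq_Rintegral do rewrite cosB mulrDl -!mulrA.
rewrite RintegralD//; [|exact: integrableZl_EFin..].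
by rewrite !RintegralZl// /wave /= /Fc /Fs; ring.
Qed.

Lemma normc_fourier_le u C p : measurable_fun setT u -> cauchy_dominated C u ->
  Normc.normc (fourier u p) <= 2 * (fourier_cst * (C * pi)).
Proof.
move=> mu uC; apply: normc_le_wave => th.
rewrite wave_fourier ?(integrable_cauchy_dominated mu uC)//.
rewrite normrM gtr0_norm ?fourier_cst_gt0// ler_wpM2l ?(ltW fourier_cst_gt0)//.
under eq_Rintegral do rewrite -mulNr.
apply: normr_Rintegral_cauchy;
  first by apply: measurable_funM => //; exact: measurable_cos_affine.
by apply: cauchy_dominatedM uC => x; exact: cos_max.
Qed.

Lemma fourier_derive f f' C p : (forall x, is_derive x 1 f (f' x)) ->
  continuous f' -> cauchy_dominated C f -> cauchy_dominated C f' ->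
  fourier f' p = Complex 0 p * fourier f p.
Proof.
move=> df cf' fC f'C; have cf := is_derive_continuous df.
have intf := integrable_cauchy_dominated (continuous_measurable_fun cf) fC.
have intf' := integrable_cauchy_dominated (continuous_measurable_fun cf') f'C.
apply: wave_inj => th; rewrite mulrC waveM /= mul0r add0r !wave_fourier//.
rewrite [RHS]mulrCA; congr (_ * _); apply/eqP; rewrite -subr_eq0 -mulNr.
under eq_Rintegral do rewrite -mulNr.
under [X in _ + _ * X]eq_Rintegral do rewrite -mulNr.
have int_cos a g : leb.-integrable setT (EFin \o g) ->
    leb.-integrable setT (EFin \o (fun x => cos (a + - p * x) * g x)).
  exact: integrable_cosM.
rewrite -RintegralZl ?int_cos// -RintegralD ?int_cos//; last first.
  by apply: integrableZl_EFin => //; exact: int_cos.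
apply/eqP; apply: (@Rintegral_derive_cauchy_dominated _ C
  (fun x => cos (th + - p * x) * f x)) => [x|x||].
- have /is_derive_eq := is_derive_mulf (is_derive_cos_affine (- p) th x) (df x).
  by apply; rewrite (addrAC th); ring.
- by apply: cvgD; last apply: cvgMr; apply: cvgM;
    [exact: continuous_cos_affine|exact: cf'|exact:
      continuous_cos_affine|exact: cf].
- by apply: integrableD_EFin; rewrite ?int_cos//; apply: integrableZl_EFin;
    rewrite ?int_cos.
- by apply: cauchy_dominatedM fC => x; exact: cos_max.
Qed.

Lemma fourier_derive1n u n p : schwartz u ->
  fourier (derive1n n u) p = Complex 0 p ^+ n * fourier u p.
Proof.
move=> su; elim: n => [|n IH]; first by rewrite derive1n0 expr0 mul1r.
have [C uC] := schwartz_cauchy_dominated n su.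
have [C' u'C] := schwartz_cauchy_dominated n.+1 su.
rewrite exprS -mulrA -IH; apply: (@fourier_derive _ _ (Num.max C C')).
- by move=> x; exact: schwartz_is_derive.
- exact: schwartz_continuous.
- by apply: cauchy_dominatedW uC; rewrite le_max lexx.
- by apply: cauchy_dominatedW u'C; rewrite le_max lexx orbT.
Qed.

Lemma fourier_decay u : schwartz u ->
  exists C, forall p, Normc.normc (fourier u p) <= C * w p ^+ 2.
Proof.
move=> su; have bounded n : exists B, forall p,
  Normc.normc (fourier (derive1n n u) p) <= B.
  have [C uC] := schwartz_cauchy_dominated n su.
  exists (2 * (fourier_cst * (C * pi))) => p.
  by apply: normc_fourier_le uC; apply: continuous_measurable_fun;
    exact: schwartz_continuous.
have [B0 b0] := bounded 0; have [B4 b4] := bounded 4.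
exists (2 * (B0 + B4)) => p; set N := Normc.normc _.
have N0 : 0 <= N by exact: normc_ge0.
have p4N : p ^+ 4 * N <= B4.
  apply: le_trans (b4 p); rewrite fourier_derive1n// Normc.normcM normcX /=.
  rewrite expr0n/= add0r sqrtr_sqr -/N (exprM p 2 2) (exprM `|p| 2 2).
  by rewrite real_normK ?num_real.
rewrite exprVn ler_pdivlMr ?exprn_gt0// /oneDsqr.
have := b0 p; rewrite derive1n0 -/N => N_B0.
have : (1 + p ^+ 2) ^+ 2 <= 2 * (1 + p ^+ 4).
  have := sqr_ge0 (1 - p ^+ 2); rewrite (exprM p 2 2) !expr2; lra.
move=> /(ler_wpM2l N0) /le_trans; apply; lra.
Qed.

Lemma fourier_cauchy u : schwartz u ->
  exists C, forall p, Normc.normc (fourier u p) <= C * w p.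
Proof.
move=> /fourier_decay[C uC]; exists C => p; apply: (le_trans (uC p)).
have C0 : 0 <= C.
  have := le_trans (normc_ge0 _) (uC 0).
  by rewrite pmulr_lge0// exprn_gt0// oneDsqrV_gt0.
by rewrite ler_wpM2l// expr2 ler_piMl ?oneDsqrV_le1// ltW// oneDsqrV_gt0.
Qed.

Lemma continuous_fourier u C : continuous u -> cauchy_dominated C u ->
  continuous_cfun (fourier u).
Proof.
move=> cu uC; have mu := continuous_measurable_fun cu.
have iu := integrable_cauchy_dominated mu uC.
apply: continuous_cfun_wave => th;
  under eq_fun do rewrite (wave_fourier _ _ iu).
move=> p; apply: cvgMr.
apply: (@continuous_Rintegral _ _ _ leb setT (fun p x => cos (th - p * x) * u x)
  (fun x => `|u x|)) => //.
- move=> q; under eq_fun do rewrite -mulNr.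
  by apply: measurable_funM => //; exact: measurable_cos_affine.
- move=> x _ q; apply: cvgMl; apply: (cvg_comp (fun q => th - q * x) cos).
    by apply: cvgB; [exact: cvg_cst|apply: cvgMl; exact: cvg_id].
  exact: continuous_cos.
- by move=> q x _; rewrite normrM ler_piMl// cos_max.
- exact: integrable_norm.
Qed.

End fourier_transform.

Section fourier_inversion.
Variable R : realType.
Local Notation leb := (@lebesgue_measure R).
Local Notation w := (fun x : R => (oneDsqr x)^-1).
Local Notation fourier_cst := ((Num.sqrt (2 * pi) : R)^-1).
Implicit Types (u : R -> R) (e x y p : R).

Definition fourier_inv (A : R -> R[i]) x : R :=
  fourier_cst * \int[leb]_p wave (A p) (p * x).

Definition poisson_kernel e y : R := 2 * e / (e ^+ 2 + y ^+ 2).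

Lemma integrable_poisson_kernelM e x u : 0 < e ->
  leb.-integrable setT (EFin \o u) ->
  leb.-integrable setT (EFin \o (fun y => poisson_kernel e (x - y) * u y)).
Proof.
move=> e0; have den_gt0 y : 0 < e ^+ 2 + (x - y) ^+ 2.
  by rewrite ltr_wpDr ?sqr_ge0 ?exprn_gt0.
apply: (@integrableM_bounded _ _ _ leb _ _ _ (2 / e)) => //.
  apply: continuous_measurable_fun => y; apply: cvgMr; apply: cvgV;
    first by rewrite gt_eqF.
  apply: cvgD; first exact: cvg_cst.
  apply: (cvg_comp (fun y => x - y) (fun z => z ^+ 2));
    last exact: exprn_continuous.
  by apply: cvgB; [exact: cvg_cst|exact: cvg_id].
move=> y _; rewrite ger0_norm; last by rewrite divr_ge0// ltW// mulr_gt0.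
rewrite /poisson_kernel ler_pdivrMr// mulrDr.
rewrite (_ : 2 / e * e ^+ 2 = 2 * e); last by field; rewrite gt_eqF.
by rewrite lerDl mulr_ge0 ?sqr_ge0// divr_ge0// ltW.
Qed.

Lemma Rintegral_poisson_kernel e x u : 0 < e ->
  leb.-integrable setT (EFin \o u) ->
  \int[leb]_y (poisson_kernel e (x - y) * u y) =
  \int[leb]_z (2 * u (e * z + x) * w z).
Proof.
move=> e0 iu; have iku := integrable_poisson_kernelM x e0 iu.
have en0 : e != 0 by rewrite gt_eqF.
have := Rintegral_affine x en0 iku; rewrite gtr0_norm//.
move=> /(congr1 ( *%R e)); rewrite mulVKf// => <-.
rewrite -RintegralZl//; last exact: (integrable_affine x en0 iku).
apply: eq_Rintegral => z _; rewrite /poisson_kernel /oneDsqr.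
have -> : e ^+ 2 + (x - (e * z + x)) ^+ 2 = e ^+ 2 * (1 + z ^+ 2) by ring.
by field; rewrite en0 gt_eqF// ltr_wpDr// sqr_ge0.
Qed.

Lemma poisson_kernel_approx_id u B x :
  continuous u -> (forall y, `|u y| <= B) ->
  \int[leb]_z (2 * u (n.+1%:R^-1 * z + x) * w z) @[n --> \oo] --> 2 * pi * u x.
Proof.
move=> cu uB; have mu := continuous_measurable_fun cu.
have mw := integrable_measurable_fun (@integrable_oneDsqrV R).
have -> : 2 * pi * u x = \int[leb]_z (2 * u x * w z).
  rewrite RintegralZl//; last exact: integrable_oneDsqrV.
  by rewrite Rintegral_oneDsqrV mulrAC.
apply: (@Rintegral_dominated_cvg _ _ _ leb _ _ _ (fun z => 2 * B * w z)) => //.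
- move=> n; apply: measurable_funM => //; apply: measurable_funM => //.
  apply: measurableT_comp => //.
  by apply: measurable_funD => //; exact: measurable_funM.
- move=> z _; apply: cvgMl; apply: cvgMr.
  have to_x : n.+1%:R^-1 * z + x @[n --> \oo] --> x.
    rewrite -[X in _ --> X]add0r; apply: cvgD; last exact: cvg_cst.
    by rewrite -(mul0r z); apply: cvgMl; exact: cvg_harmonic.
  by apply: (cvg_comp _ u to_x); exact: cu.
- by apply: integrableZl_EFin => //; exact: integrable_oneDsqrV.
- move=> n z _; rewrite !normrM gtr0_norm// (gtr0_norm (oneDsqrV_gt0 z)).
  by rewrite ler_wpM2r ?ler_wpM2l// ltW// oneDsqrV_gt0.
Qed.

Lemma abel_mean_fourier_inv e x u : 0 < e -> leb.-integrable setT (EFin \o u) ->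
  fourier_cst * \int[leb]_p (expR (- (e * `|p|)) * wave (fourier u p) (p * x)) =
  (2 * pi)^-1 * \int[leb]_y (poisson_kernel e (x - y) * u y).
Proof.
move=> e0 iu; have mu := integrable_measurable_fun iu.
have iE := integrable_abel_weight e0; have mE := integrable_measurable_fun iE.
pose F p y := expR (- (e * `|p|)) * cos (p * (x - y)) * u y.
have mF : measurable_fun setT (fun z : R * R => F z.1 z.2).
  apply: measurable_funM; last exact: measurableT_comp.
  apply: measurable_funM; first exact: (measurableT_comp mE).
  apply: (measurableT_comp (@measurable_cos R setT)).
  by apply: measurable_funM => //; exact: measurable_funB.
have F_le p y : `|F p y| <= expR (- (e * `|p|)) * `|u y|.
  by rewrite !normrM ler_wpM2r// ger0_norm ?expR_ge0//
    ler_piMr ?expR_ge0// cos_max.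
have iNu := integrable_norm iu.
transitivity (fourier_cst * (fourier_cst * \int[leb]_p \int[leb]_y F p y)).
  congr (_ * _); rewrite -RintegralZl//; last first.
    exact: (@integrable_Rintegral _ _ _ _ _ leb leb F _ _ mF iE iNu F_le).
  apply: eq_Rintegral => p _; rewrite wave_fourier// mulrCA; congr (_ * _).
  rewrite -RintegralZl//; first by apply: eq_Rintegral =>
    y _; rewrite /F mulrBr mulrA.
  by under eq_fun do rewrite -mulNr; exact: integrable_cosM.
rewrite mulrA fourier_cst_sqr (@Rintegral_fubini _ _ _ _ _ leb leb F _ _ mF iE
  iNu F_le); congr (_ * _).
apply: eq_Rintegral => y _;
  rewrite /poisson_kernel -Rintegral_abel_kernel// -RintegralZr//.
  by apply: eq_Rintegral => p _; rewrite /F (mulrC p).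
have := integrable_cosM 0 (x - y) iE.
by apply: eq_integrable => // p _ /=; rewrite add0r mulrC.
Qed.

Lemma fourier_inversion_cauchy_dominated u C D : continuous u ->
  cauchy_dominated C u -> (forall p, Normc.normc (fourier u p) <= D * w p) ->
  fourier_inv (fourier u) = u.
Proof.
move=> cu uC uD; apply/funext => x; have mu := continuous_measurable_fun cu.
have iu := integrable_cauchy_dominated mu uC.
have mwave : measurable_fun setT (fun p => wave (fourier u p) (p * x)).
  apply: measurable_wave; last exact: measurable_funM.
  exact/continuous_cfun_measurable/(continuous_fourier cu uC).
have to_u : (2 * pi)^-1 * \int[leb]_z (2 * u (n.+1%:R^-1 * z + x) * w z)
    @[n --> \oo] --> u x.
  rewrite -[X in _ --> X](mulKf (_ : 2 * pi != 0)) ?mulf_neq0 ?pnatr_eq0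
    ?gt_eqF ?pi_gt0//.
  apply: cvgMr; apply: poisson_kernel_approx_id => // y.
  exact: cauchy_dominated_le uC.
apply: (cvg_unique _ _ to_u) => //=.
under eq_cvg => n do rewrite -Rintegral_poisson_kernel ?invr_gt0//
  -abel_mean_fourier_inv ?invr_gt0//.
apply: cvgMr;
  apply: (@Rintegral_dominated_cvg _ _ _ leb _ _ _ (fun p => D * w p)) => //.
- move=> n; apply: measurable_funM => //.
  by apply: measurableT_comp => //; apply: measurableT_comp => //;
    exact: measurable_funM.
- move=> p _; rewrite -[X in _ --> X]mul1r; apply: cvgMl.
  rewrite -[X in _ --> X]expR0; apply: (cvg_comp _ expR);
    last exact: continuous_expR.
  rewrite -oppr0; apply: cvgN; rewrite -(mul0r `|p|); apply: cvgMl.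
  exact: cvg_harmonic.
- by apply: integrableZl_EFin => //; exact: integrable_oneDsqrV.
- move=> n p _; rewrite normrM ger0_norm ?expR_ge0//.
  rewrite (le_trans _ (uD p))// (le_trans _ (normr_wave_le _ (p * x)))//.
  by rewrite ler_piMl// expR_le1 oppr_le0 mulr_ge0.
Qed.

Lemma fourier_inversion u : schwartz u -> fourier_inv (fourier u) = u.
Proof.
move=> su; have [C uC] := schwartz_cauchy_dominated 0 su.
have [D uD] := fourier_cauchy su.
by apply: (fourier_inversion_cauchy_dominated _ uC uD);
  exact: (@schwartz_continuous _ _ 0 su).
Qed.

End fourier_inversion.

Section riemann_lebesgue.
Variable R : realType.
Local Notation leb := (@lebesgue_measure R).
Local Notation w := (fun x : R => (oneDsqr x)^-1).
Variables (g : R -> R) (C : R).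
Hypotheses (cg : continuous g) (gC : cauchy_dominated C g).

Let mg : measurable_fun setT g := continuous_measurable_fun cg.
Let ig : leb.-integrable setT (EFin \o g) := integrable_cauchy_dominated mg gC.

Let measurable_translate (a : R) : measurable_fun setT (fun p : R => g (p + a)).
Proof. by apply: measurableT_comp => //; exact: measurable_funD. Qed.

Lemma cauchy_dominated_increment (a : R) : `|a| <= 1 ->
  cauchy_dominated (5 * C) (fun p => g p - g (p + a)).
Proof.
move=> a1 p; have C0 := cauchy_dominated_ge0 gC.
have shift_le : w (p + a) <= 4 * w p.
  apply: (le_trans (oneDsqrV_shift_le _ _));
    rewrite ler_wpM2r ?(ltW (oneDsqrV_gt0 _))//.
  by rewrite /oneDsqr -(real_normK (num_real a)); have := normr_ge0 a; nra.
rewrite (le_trans (ler_normB _ _))//.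
by have := gC p; have := gC (p + a); have := ler_wpM2l C0 shift_le; lra.
Qed.

Lemma L1_shift_cvg0 : \int[leb]_p `|g p - g (p + a)| @[a --> 0] --> 0.
Proof.
pose om (a : R) := \int[leb]_p `|g p - g (p + a)|.
have om0 : om 0 = 0.
  by rewrite /om; under eq_Rintegral do rewrite addr0 subrr normr0;
    rewrite Rintegral_cst// mul0r.
have i5Cw : leb.-integrable setT (EFin \o (fun p => 5 * C * w p)).
  by apply: integrableZl_EFin => //; exact: integrable_oneDsqrV.
have in1 (a : R) : `](-1), 1[%classic a -> `|a| <= 1.
  by rewrite /= in_itv/= ler_norml => /andP[/ltW -> /ltW ->].
suff : {in `](-1), 1[%classic, continuous om}.
  by move=> /(_ 0); rewrite /continuous_at om0; apply;
    rewrite inE/= in_itv/= ltrN10 ltr01.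
apply: (@continuity_under_integral _ _ _ leb (fun a p => `|g p - g (p + a)|) _
  measurableT (-1) 1 _ _ (fun p => 5 * C * w p) i5Cw).
- move=> a /in1 a1; apply: integrable_norm.
  apply: integrable_cauchy_dominated (cauchy_dominated_increment a1).
  exact: measurable_funB.
- apply: aeW => p _ a _; apply: cvg_norm; apply: cvgB; first exact: cvg_cst.
  apply: (cvg_comp (fun a => p + a) g); last exact: cg.
  by apply: cvgD; [exact: cvg_cst|exact: cvg_id].
- by move=> a /in1 a1; apply: aeW => p _; rewrite normr_id;
    exact: cauchy_dominated_increment.
Qed.

(* Shifting the variable by [pi / x] changes the sign of [h (p * x)]. *)
Lemma riemann_lebesgue_shift (h : R -> R) (x : R) : continuous h ->
  alternating h pi -> (forall y, `|h y| <= 1) -> x != 0 ->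
  2 * `|\int[leb]_p (h (p * x) * g p)| <= \int[leb]_p `|g p - g (p + pi / x)|.
Proof.
move=> ch hpi h1 x0; have igs := integrable_shift (pi / x) ig.
have mh : measurable_fun setT (fun p : R => h (p * x)).
  apply: measurableT_comp; first exact: continuous_measurable_fun.
  exact: measurable_funM.
have ih (f : R -> R) : leb.-integrable setT (EFin \o f) ->
    leb.-integrable setT (EFin \o (fun p => h (p * x) * f p)).
  by apply: (@integrableM_bounded _ _ _ leb _ _ _ 1).
set I := \int[leb]_p _.
have negI : I = - \int[leb]_p (h (p * x) * g (p + pi / x)).
  rewrite /I -(Rintegral_shift (pi / x)) ?ih// -mulN1r -RintegralZl ?ih//.
  by apply: eq_Rintegral => p _; rewrite mulrDl divfK// hpi; ring.
have -> : 2 * `|I| = `|\int[leb]_p (h (p * x) * (g p - g (p + pi / x)))|.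
  rewrite -[2 in LHS]normr_nat -normrM; congr `|_|.
  under [RHS]eq_Rintegral do rewrite mulrBr.
  by rewrite RintegralB ?ih// -/I; move: negI; lra.
apply: normr_Rintegral_le => //.
- by apply: measurable_funM => //;
    exact: (measurable_funB mg (measurable_translate _)).
- by move=> p _; rewrite normrM ler_piMl.
- by apply: integrable_norm; exact: integrableB_EFin.
Qed.

Lemma riemann_lebesgue (h : R -> R) : continuous h -> alternating h pi ->
  (forall y, `|h y| <= 1) -> forall e : R, 0 < e -> exists M : R,
  forall x : R, M < `|x| -> `|\int[leb]_p (h (p * x) * g p)| < e.
Proof.
move=> ch hpi h1 e e0.
have /cvgrPdist_lt /(_ e e0) /nbhs_ballP[r/= r0 near0] := L1_shift_cvg0.
exists (pi / r) => x xM.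
have x0 : 0 < `|x| by rewrite (lt_trans _ xM)// divr_gt0// pi_gt0.
have /near0 : ball 0 r (pi / x).
  rewrite /ball/= sub0r normrN normrM normfV gtr0_norm ?pi_gt0//.
  by rewrite ltr_pdivrMr// mulrC -ltr_pdivrMr.
rewrite sub0r normrN ger0_norm; last exact: Rintegral_ge0.
apply: le_lt_trans; apply: le_trans (riemann_lebesgue_shift ch hpi h1 _).
  by rewrite ler_peMl// ler1n.
by rewrite -normr_gt0.
Qed.

End riemann_lebesgue.

Section inverse_fourier_transform.
Variable R : realType.
Local Notation leb := (@lebesgue_measure R).
Local Notation w := (fun x : R => (oneDsqr x)^-1).
Local Notation fourier_cst := ((Num.sqrt (2 * pi) : R)^-1).
Variables (A : R -> R[i]) (C : R).
Hypothesis cA : continuous_cfun A.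
Hypothesis AC : forall p, Normc.normc (A p) <= C * w p.

Let mA := continuous_cfun_measurable cA.

Let measurable_wave_linear (x : R) :
  measurable_fun setT (fun p => wave (A p) (p * x)).
Proof. by apply: measurable_wave => //; exact: measurable_funM. Qed.

Let wave_dominated (x : R) : cauchy_dominated C (fun p => wave (A p) (p * x)).
Proof. by move=> p; exact: le_trans (normr_wave_le _ _) (AC p). Qed.

Lemma normr_fourier_inv_le (x : R) :
  `|fourier_inv A x| <= fourier_cst * (C * pi).
Proof.
rewrite normrM (gtr0_norm (fourier_cst_gt0 R))
  (ler_wpM2l (ltW (fourier_cst_gt0 R)))//.
exact: normr_Rintegral_cauchy.
Qed.

Lemma continuous_fourier_inv : continuous (fourier_inv A).
Proof.
move=> x; apply: cvgMr.
apply: (@continuous_Rintegral _ _ _ leb setT (fun x p => wave (A p) (p * x))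
  (fun p => C * w p)) => //.
- move=> p _ y; apply: (cvg_comp (fun x => p * x) (wave (A p))).
    by apply: cvgMr; exact: cvg_id.
  exact: continuous_wave.
- by move=> y p _; exact: wave_dominated.
- by apply: integrableZl_EFin => //; exact: integrable_oneDsqrV.
Qed.

Lemma fourier_inv_C_infty : C_infty (fourier_inv A).
Proof.
split; first exact: continuous_fourier_inv.
move=> e e0; set c := fourier_cst; have c0 : 0 < c := fourier_cst_gt0 R.
have e2 : 0 < e / c / 2 by rewrite !divr_gt0.
have ReC : cauchy_dominated C (fun p => Re (A p)).
  by move=> p; rewrite -wave_Re; exact: le_trans (normr_wave_le _ _) (AC p).
have ImC : cauchy_dominated C (fun p => Im (A p)).
  by move=> p; rewrite -wave_Im; exact: le_trans (normr_wave_le _ _) (AC p).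
have [M1 ReM1] := riemann_lebesgue cA.1 ReC (@continuous_cos R) (@cosDpi R)
  (@cos_max R) e2.
have [M2 ImM2] := riemann_lebesgue cA.2 ImC (@continuous_sin R) (@sinDpi R)
  (@sin_max R) e2.
exists (Num.max M1 M2) => x; rewrite gt_max => /andP[/ReM1 Re_lt /ImM2 Im_lt].
rewrite normrM (gtr0_norm c0) -ltr_pdivlMl// mulrC.
have int_trig (h v : R -> R) : continuous h -> (forall y, `|h y| <= 1) ->
    measurable_fun setT v -> cauchy_dominated C v ->
    leb.-integrable setT (EFin \o (fun p => h (p * x) * v p)).
  move=> ch h1 mv vC.
  apply: integrable_cauchy_dominated (cauchy_dominatedM _ vC) => //.
  apply: measurable_funM => //; apply: measurableT_comp;
    last exact: measurable_funM.
  exact: continuous_measurable_fun.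
under eq_Rintegral do rewrite /wave (mulrC (Re _)) (mulrC (Im _)).
rewrite RintegralB//; last 2 first.
- by apply: int_trig mA.1 ReC; [exact: continuous_cos|exact: cos_max].
- by apply: int_trig mA.2 ImC; [exact: continuous_sin|exact: sin_max].
by apply: (le_lt_trans (ler_normB _ _)); rewrite (splitr (e / c)) ltrD.
Qed.

End inverse_fourier_transform.

Section positively_homogeneous.
Variables (R : realType) (delta : R).
Hypothesis delta_gt0 : 0 < delta.
Implicit Types (c x : R) (g : R -> R).

Definition pos_homogeneous g : Prop :=
  forall c x, 0 <= c -> g (c * x) = c `^ delta * g x.

Definition signed_powR x : R := Num.sg x * `|x| `^ delta.

Lemma pos_homogeneous_normr_powR : pos_homogeneous (fun x => `|x| `^ delta).
Proof. by move=> c x c0; rewrite normrM powRM// ger0_norm. Qed.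

Lemma pos_homogeneous_signed_powR : pos_homogeneous signed_powR.
Proof.
move=> c x; rewrite le_eqVlt => /predU1P[<-|c0].
  by rewrite mul0r /signed_powR sgr0 powR0 ?gt_eqF// !mul0r.
by rewrite /signed_powR sgrM gtr0_sg// mul1r
  pos_homogeneous_normr_powR ?ltW// mulrCA.
Qed.

Lemma signed_powRM x y : signed_powR (x * y) = signed_powR x * signed_powR y.
Proof. by rewrite /signed_powR sgrM normrM powRM//; ring. Qed.

Lemma pos_homogeneousZ k g : pos_homogeneous g ->
  pos_homogeneous (fun x => k * g x).
Proof. by move=> hg c x c0; rewrite hg// mulrCA. Qed.

Lemma pos_homogeneousM g p : pos_homogeneous g ->
  pos_homogeneous (fun x => g (p * x)).
Proof. by move=> hg c x c0 /=; rewrite -hg// mulrCA. Qed.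

Section theory.
Variable g : R -> R.
Hypothesis hg : pos_homogeneous g.

Lemma pos_homogeneous0 : g 0 = 0.
Proof. by rewrite -[X in g X](mul0r 0) hg// powR0 ?gt_eqF// mul0r. Qed.

Lemma pos_homogeneous_ge0 x : 0 <= x -> g x = g 1 * `|x| `^ delta.
Proof. by move=> x0; rewrite -{1}[x]mulr1 hg// ger0_norm// mulrC. Qed.

Lemma pos_homogeneous_le0 x : x <= 0 -> g x = g (-1) * `|x| `^ delta.
Proof.
by move=> x0; rewrite mulrC -hg// mulrN1 ler0_norm// opprK.
Qed.

Lemma normr_pos_homogeneous_le x :
  `|g x| <= (`|g 1| + `|g (-1)|) * `|x| `^ delta.
Proof.
have [x0|/ltW x0] := leP 0 x.
- rewrite pos_homogeneous_ge0// normrM (ger0_norm (powR_ge0 _ _)).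
  by rewrite ler_wpM2r ?powR_ge0// lerDl.
- rewrite pos_homogeneous_le0// normrM (ger0_norm (powR_ge0 _ _)).
  by rewrite ler_wpM2r ?powR_ge0// lerDr.
Qed.

End theory.

Lemma continuous_normr_powR : continuous (fun x : R => `|x| `^ delta).
Proof.
move=> x; rewrite /continuous_at; have [->|x0] := eqVneq x 0.
  rewrite normr0 powR0 ?gt_eqF//; apply/cvgrPdist_lt => e e0.
  apply/nbhs_ballP; exists (e `^ delta^-1) => [|y]; first exact: powR_gt0.
  rewrite /ball/= !sub0r !normrN (ger0_norm (powR_ge0 _ _)).
  move=> /(@gt0_ltr_powR _ delta delta_gt0); rewrite -powRrM mulVf ?gt_eqF//.
  by rewrite powRr1 ?ltW//; apply; rewrite nnegrE// powR_ge0.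
have powR_cont : {for `|x|, continuous (fun y : R => y `^ delta)}.
  apply/differentiable_continuous/derivable1_diffP/derivable_powR.
  by rewrite in_itv/= andbT normr_gt0.
apply: (cvg_comp (fun y : R => `|y|) (fun y => y `^ delta)) powR_cont.
by apply: cvg_norm; exact: cvg_id.
Qed.

Lemma continuous_pos_homogeneous g : pos_homogeneous g -> continuous g.
Proof.
move=> hg; have -> : g = (fun x => g 1 * `|(x + `|x|) / 2| `^ delta +
    g (-1) * `|(`|x| - x) / 2| `^ delta).
  apply/funext => x; have [x0|/ltW x0] := leP 0 x.
  - rewrite pos_homogeneous_ge0// ger0_norm// subrr mul0r normr0
      powR0 ?gt_eqF//.
    by rewrite mulr0 addr0 -mulr2n -[x *+ 2]mulr_natr
      mulfK ?pnatr_eq0// ger0_norm.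
  - rewrite pos_homogeneous_le0// ler0_norm// subrr mul0r normr0
      powR0 ?gt_eqF//.
    rewrite mulr0 add0r -mulr2n -[_ *+ 2]mulr_natr mulfK ?pnatr_eq0//.
    by rewrite normrN ler0_norm.
move=> x; apply: cvgD; apply: cvgMr.
  apply: (cvg_comp _ (fun x : R => `|x| `^ delta));
    last exact: continuous_normr_powR.
  by apply: cvgMl; apply: cvgD; [exact: cvg_id|by apply: cvg_norm;
    exact: cvg_id].
apply: (cvg_comp _ (fun x : R => `|x| `^ delta));
  last exact: continuous_normr_powR.
by apply: cvgMl; apply: cvgB; [by apply: cvg_norm; exact: cvg_id|exact: cvg_id].
Qed.

Lemma measurable_pos_homogeneous g : pos_homogeneous g -> measurable_fun setT g.
Proof.
by move=> hg; apply: continuous_measurable_fun;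
  exact: continuous_pos_homogeneous.
Qed.

Lemma signed_powR_ge0 x : 0 <= x -> signed_powR x = `|x| `^ delta.
Proof.
move=> x0; rewrite (pos_homogeneous_ge0 pos_homogeneous_signed_powR)//.
by rewrite /signed_powR sgr1 normr1 powR1 !mul1r.
Qed.

Lemma signed_powR_le0 x : x <= 0 -> signed_powR x = - `|x| `^ delta.
Proof.
move=> x0; rewrite (pos_homogeneous_le0 pos_homogeneous_signed_powR)//.
by rewrite /signed_powR sgrN sgr1 normrN1 powR1 mulr1 mulN1r.
Qed.

Lemma normr_powR_le_oneDsqr x : delta <= 2 -> `|x| `^ delta <= oneDsqr x.
Proof.
move=> delta_le2; have [x1|x1] := leP `|x| 1.
  rewrite (@le_trans _ _ (1 `^ delta))//; last by rewrite powR1 lerDl sqr_ge0.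
  by apply: ge0_ler_powR; rewrite ?nnegrE// ltW.
rewrite (le_trans (ler_powR (ltW x1) delta_le2))//.
by rewrite powR_mulrn// real_normK ?num_real// lerDr.
Qed.

End positively_homogeneous.

Section stable_symbol.
Variables (R : realType) (delta rho : R).
Hypotheses (delta_gt0 : 0 < delta) (delta_le2 : delta <= 2).
Local Notation w := (fun x : R => (oneDsqr x)^-1).
Implicit Types (u : R -> R) (p x : R).

Definition psi p : R[i] := Complex (psiRe delta p) (psiIm delta rho p).

Lemma psiImE p :
  psiIm delta rho p = - (rho * tan (pi * delta / 2)) * signed_powR delta p.
Proof. by rewrite /psiIm /signed_powR; ring. Qed.

Lemma pos_homogeneous_psiRe : pos_homogeneous delta (psiRe delta).
Proof. exact: pos_homogeneous_normr_powR. Qed.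

Lemma pos_homogeneous_psiIm : pos_homogeneous delta (psiIm delta rho).
Proof.
rewrite (funext psiImE); apply: pos_homogeneousZ.
exact: pos_homogeneous_signed_powR.
Qed.

Lemma psi_homogeneous c p : 0 <= c -> psi (c * p) = (c `^ delta)%:C%C * psi p.
Proof.
move=> c0; rewrite /psi pos_homogeneous_psiRe// pos_homogeneous_psiIm//.
by apply/eqP; rewrite eq_complex/= !mul0r subr0 addr0 !eqxx.
Qed.

Lemma continuous_psi : continuous_cfun psi.
Proof.
split; apply: (continuous_pos_homogeneous delta_gt0).
- exact: pos_homogeneous_psiRe.
- exact: pos_homogeneous_psiIm.
Qed.

Lemma normc_psi_le : exists K, forall p, Normc.normc (psi p) <= K * oneDsqr p.
Proof.
have re_le p := normr_pos_homogeneous_le pos_homogeneous_psiRe p.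
have im_le p := normr_pos_homogeneous_le pos_homogeneous_psiIm p.
exists (`|psiRe delta 1| + `|psiRe delta (-1)| +
  (`|psiIm delta rho 1| + `|psiIm delta rho (-1)|)) => p.
apply: (le_trans (normc_le_ReIm _));
  apply: (le_trans (lerD (re_le p) (im_le p))).
rewrite -mulrDl; apply: ler_wpM2l; first by rewrite !addr_ge0.
exact: normr_powR_le_oneDsqr.
Qed.

Lemma continuous_psi_fourier u : schwartz u ->
  continuous_cfun (fun p => - psi p * fourier u p).
Proof.
move=> su; have [C uC] := schwartz_cauchy_dominated 0 su.
apply: continuous_cfunM;
  first by apply: continuous_cfunN; exact: continuous_psi.
exact: (continuous_fourier (@schwartz_continuous _ _ 0 su) uC).
Qed.

Lemma psi_fourier_cauchy u : schwartz u ->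
  exists C, forall p, Normc.normc (- psi p * fourier u p) <= C * w p.
Proof.
move=> /fourier_decay[D uD]; have [K psiK] := normc_psi_le; exists (K * D) => p.
rewrite Normc.normcM normcN.
rewrite (le_trans (ler_pM (normc_ge0 _) (normc_ge0 _) (psiK p) (uD p)))//.
by rewrite le_eqVlt; apply/orP; left; apply/eqP; field.
Qed.

Lemma LopE u : Lop delta rho u = fourier_inv (fun p => - psi p * fourier u p).
Proof.
apply/funext => x; rewrite /Lop /fourier_inv; congr (_ * _).
by apply: eq_Rintegral => p _; rewrite /wave /=; ring.
Qed.

Lemma Lop_C_infty u : schwartz u -> C_infty (Lop delta rho u).
Proof.
move=> su; have [C psiC] := psi_fourier_cauchy su; rewrite LopE.
exact: fourier_inv_C_infty (continuous_psi_fourier su) psiC.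
Qed.

Lemma Lop_bounded u : schwartz u -> exists B, forall x,
  `|Lop delta rho u x| <= B.
Proof.
move=> su; have [C psiC] := psi_fourier_cauchy su.
exists ((Num.sqrt (2 * pi))^-1 * (C * pi)) => x; rewrite LopE.
exact: normr_fourier_inv_le (continuous_psi_fourier su) psiC _.
Qed.

End stable_symbol.

Section expectation.
Context (R : realType) d (T : measurableType d) (P : probability T R).
Implicit Types (f : T -> R) (B c : R).

Lemma integrable_bounded f B : measurable_fun setT f ->
  (forall t, `|f t| <= B) -> P.-integrable setT (EFin \o f).
Proof.
move=> mf fB; apply: (@integrable_dominated _ _ _ P _ _ (cst B)) => //.
exact: finite_measure_integrable_cst.
Qed.

Lemma Rintegral_probability_cst c : \int[P]_t c = c.
Proof. by rewrite Rintegral_cst// (congr1 fine (probability_setT P)) mulr1. Qed.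

Lemma normr_expect_le f B : measurable_fun setT f -> (forall t, `|f t| <= B) ->
  `|\int[P]_t f t| <= B.
Proof.
move=> mf fB; rewrite -[leRHS]Rintegral_probability_cst;
  apply: normr_Rintegral_le => //.
exact: finite_measure_integrable_cst.
Qed.

End expectation.

Section characteristic_function.
Context (R : realType) d (T : measurableType d) (P : probability T R).
Variable X : T -> R.
Hypothesis mX : measurable_fun setT X.
Local Notation leb := (@lebesgue_measure R).
Local Notation w := (fun x : R => (oneDsqr x)^-1).
Implicit Types (p th : R) (z : R[i]).

Definition charf p : R[i] :=
  Complex (\int[P]_t cos (p * X t)) (\int[P]_t sin (p * X t)).

Lemma wave_charfM p z th :
  wave (charf p * z) th = \int[P]_t wave z (th + p * X t).
Proof.
have mpX : measurable_fun setT (fun t => p * X t) by exact: measurable_funM.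
have icos : P.-integrable setT (EFin \o (fun t => cos (p * X t))).
  apply: (@integrable_bounded _ _ _ P _ 1) => [|t]; last exact: cos_max.
  exact: (measurableT_comp (@measurable_cos R setT)).
have isin : P.-integrable setT (EFin \o (fun t => sin (p * X t))).
  apply: (@integrable_bounded _ _ _ P _ 1) => [|t]; last exact: sin_max.
  exact: (measurableT_comp (@measurable_sin R setT)).
rewrite mulrC waveM /= mulrC [X in _ + X]mulrC -!RintegralZl// -RintegralD//.
- by apply: eq_Rintegral => t _; rewrite /wave cosDpihalf sinDpihalf cosD sinD;
    ring.
- exact: integrableZl_EFin.
- exact: integrableZl_EFin.
Qed.

Lemma wave_charf p th : wave (charf p) th = \int[P]_t cos (th + p * X t).
Proof.
rewrite -[charf p]mulr1 wave_charfM; apply: eq_Rintegral => t _.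
by rewrite /wave /= mul1r mul0r subr0.
Qed.

Lemma normr_wave_charfM_le p z th : `|wave (charf p * z) th| <= Normc.normc z.
Proof.
rewrite wave_charfM; apply: normr_expect_le => [|t]; last exact: normr_wave_le.
apply: measurableT_comp;
  first exact: continuous_measurable_fun (@continuous_wave _ z).
by apply: measurable_funD => //; exact: measurable_funM.
Qed.

Lemma continuous_charf : continuous_cfun charf.
Proof.
apply: continuous_cfun_wave => th; under eq_fun do rewrite wave_charf.
apply: (@continuous_Rintegral _ _ _ P setT (fun p t => cos (th + p * X t))
  (cst 1)) => //.
- move=> p; apply: (measurableT_comp (@measurable_cos R setT)).
  by apply: measurable_funD => //; exact: measurable_funM.
- move=> t _ p; apply: (cvg_comp (fun p => th + p * X t) cos).
    by apply: cvgD; [exact: cvg_cst|apply: cvgMl; exact: cvg_id].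
  exact: continuous_cos.
- by move=> p t _; exact: cos_max.
- exact: finite_measure_integrable_cst.
Qed.

Lemma expect_fourier_inv (A : R -> R[i]) C x : measurable_cfun A ->
  (forall p, Normc.normc (A p) <= C * w p) ->
  \int[P]_t fourier_inv A (x + X t) = fourier_inv (fun p => charf p * A p) x.
Proof.
move=> mA AC; pose F t p := wave (A p) (p * (x + X t)).
have mF : measurable_fun setT (fun z : T * R => F z.1 z.2).
  apply: measurable_wave.
    by case: mA => mRe mIm; split;
      [exact: (measurableT_comp mRe)|exact: (measurableT_comp mIm)].
  apply: measurable_funM => //; apply: measurable_funD => //.
  exact: measurableT_comp.
have F_le t p : `|F t p| <= cst 1 t * (C * w p).
  by rewrite mul1r; exact: le_trans (normr_wave_le _ _) (AC p).
have iw : leb.-integrable setT (EFin \o (fun p => C * w p)).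
  by apply: integrableZl_EFin => //; exact: integrable_oneDsqrV.
have i1 : P.-integrable setT (EFin \o cst 1).
  by exact: finite_measure_integrable_cst.
rewrite RintegralZl//;
  last exact: (@integrable_Rintegral _ _ _ _ _ P leb F _ _ mF i1 iw F_le).
rewrite (@Rintegral_fubini _ _ _ _ _ P leb F _ _ mF i1 iw F_le); congr (_ * _).
apply: eq_Rintegral => p _; rewrite wave_charfM.
by apply: eq_Rintegral => t _; rewrite /F mulrDr.
Qed.

End characteristic_function.

Section expected_shift.
Context (R : realType) d (T : measurableType d) (P : probability T R).
Implicit Types (u v : R -> R) (X : T -> R) (x B : R).

Definition expected_shift X v x := \int[P]_t v (x + X t).

Lemma measurable_shift X v x : measurable_fun setT X -> measurable_fun setT v ->
  measurable_fun setT (fun t => v (x + X t)).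
Proof.
by move=> mX mv; apply: measurableT_comp => //; exact: measurable_funD.
Qed.

Section bounded_variable.
Variables (X : T -> R) (n : nat).
Hypotheses (mX : measurable_fun setT X) (Xn : forall t, `|X t| <= n%:R).
Local Notation leb := (@lebesgue_measure R).
Local Notation w := (fun x : R => (oneDsqr x)^-1).

Lemma is_derive_expected_shift v v' B :
  (forall x : R, is_derive x 1 v (v' x)) ->
  measurable_fun setT v' -> (forall x, `|v x| <= B) ->
    (forall x, `|v' x| <= B) ->
  forall x : R, is_derive x 1 (expected_shift X v) (expected_shift X v' x).
Proof.
move=> dv mv' vB v'B x; pose f x t := v (x + X t).
have mv := continuous_measurable_fun (is_derive_continuous dv).
have df (y : R) (t : T) : is_derive y 1 (f ^~ t) (v' (y + X t)).
  have dshift : is_derive y 1 (fun x => x + X t) (1 + 0).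
    by exact: is_derive_addf.
  have := @is_derive1_comp _ v _ y _ _ (dv (y + X t)) dshift.
  by move=> /is_derive_eq; apply; rewrite addr0 mulr1.
have dfE y t : partial1of2 f y t = v' (y + X t).
  by rewrite partial1of2E; have [] := df y t.
have xI : `](x - 1), (x + 1)[%classic x by rewrite /= in_itv/=; lra.
have intf y : `](x - 1), (x + 1)[%classic y -> P.-integrable setT (EFin \o f y).
  move=> _; apply: (@integrable_bounded _ _ _ P _ B) => [|t]; last exact: vB.
  exact: measurable_shift.
have derf y t : `](x - 1), (x + 1)[%classic y -> setT t ->
  derivable (f ^~ t) y 1.
  by move=> _ _; have [] := df y t.
have B0 : 0 <= B by exact: le_trans (vB 0).
have intB : P.-integrable setT (EFin \o cst B).
  by exact: finite_measure_integrable_cst.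
have dfB y t : `](x - 1), (x + 1)[%classic y -> setT t ->
  `|partial1of2 f y t| <= cst B t.
  by move=> _ _; rewrite dfE.
apply: DeriveDef.
  exact: (derivable_under_integral measurableT xI intf derf
    (fun=> B0) intB dfB).
rewrite -derive1E (differentiation_under_integral measurableT xI intf derf
  (fun=> B0) intB dfB).
by apply: eq_Rintegral => t _; rewrite dfE.
Qed.

Lemma is_derive_expected_shift_derive1n u j x : schwartz u ->
  is_derive x 1 (expected_shift X (derive1n j u))
    (expected_shift X (derive1n j.+1 u) x).
Proof.
move=> su; have [B uB] := schwartz_bounded j su;
  have [B' u'B] := schwartz_bounded j.+1 su.
apply: (@is_derive_expected_shift _ _ (Num.max B B')).
- by move=> y; exact: schwartz_is_derive.
- by apply: continuous_measurable_fun; exact: schwartz_continuous.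
- by move=> y; rewrite le_max uB.
- by move=> y; rewrite le_max u'B orbT.
Qed.

Lemma derive1n_expected_shift u j : schwartz u ->
  derive1n j (expected_shift X u) = expected_shift X (derive1n j u).
Proof.
move=> su; elim: j => [|j IH]; first by rewrite !derive1n0.
rewrite derive1nS IH; apply/funext => x; rewrite derive1E.
by have [] := is_derive_expected_shift_derive1n j x su.
Qed.

Lemma expr_sum_le (a b : R) m : 0 <= a -> 0 <= b ->
  (a + b) ^+ m <= 2 ^+ m * (a ^+ m + b ^+ m).
Proof.
move=> a0 b0; wlog ab : a b a0 b0 / a <= b.
  by move=> wlog_ab; have [/wlog_ab|/ltW/wlog_ab] := leP a b;
    last rewrite addrC (addrC (a ^+ m)); apply.
rewrite (@le_trans _ _ ((2 * b) ^+ m))//.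
  by rewrite lerXn2r ?nnegrE ?addr_ge0 ?mulr_ge0// mulr_natl mulr2n lerD2r.
by rewrite exprMn ler_wpM2l ?exprn_ge0// lerDr exprn_ge0.
Qed.

Lemma schwartz_expected_shift u : schwartz u -> schwartz (expected_shift X u).
Proof.
move=> su; split=> [j x|m j]; rewrite derive1n_expected_shift//.
  by have [] := is_derive_expected_shift_derive1n j x su.
have [B uB] := schwartz_bounded j su; have [C uC] := su.2 m j.
have mu : measurable_fun setT (derive1n j u).
  by apply: continuous_measurable_fun; exact: schwartz_continuous.
exists (2 ^+ m * (C + n%:R ^+ m * B)) => x.
have mux := measurable_shift x mX mu.
rewrite -RintegralZl//; last by apply: (@integrable_bounded _ _ _ P _ B).
apply: normr_expect_le => [|t]; first exact: measurable_funM.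
have xm : `|x| ^+ m <= 2 ^+ m * (`|x + X t| ^+ m + n%:R ^+ m).
  apply: le_trans (expr_sum_le m (normr_ge0 _) (ler0n _ n)).
  rewrite lerXn2r ?nnegrE ?addr_ge0//; have := ler_normB (x + X t) (X t).
  by rewrite addrK => /le_trans; apply; rewrite lerD2l.
rewrite normrM normrX (le_trans (ler_wpM2r (normr_ge0 _) xm))// -mulrA.
rewrite ler_wpM2l ?exprn_ge0// mulrDl lerD// ?ler_wpM2l ?exprn_ge0//.
by have := uC (x + X t); rewrite normrM normrX.
Qed.

Lemma fourier_expected_shift u p : schwartz u ->
  fourier (expected_shift X u) p = charf P X p * fourier u p.
Proof.
move=> su; have [C uC] := schwartz_cauchy_dominated 0 su.
have mu := continuous_measurable_fun (@schwartz_continuous _ _ 0 su).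
have iu := integrable_cauchy_dominated mu uC.
have C0 := cauchy_dominated_ge0 uC.
have [D vD] := schwartz_cauchy_dominated 0 (schwartz_expected_shift su).
have mv := continuous_measurable_fun
  (@schwartz_continuous _ _ 0 (schwartz_expected_shift su)).
apply: wave_inj => th;
  rewrite (wave_fourier _ _ (integrable_cauchy_dominated mv vD)).
pose F t x := cos (th - p * x) * u (x + X t).
have mcos : measurable_fun setT (fun x => cos (th - p * x)).
  by under eq_fun do rewrite -mulNr; exact: measurable_cos_affine.
have mF : measurable_fun setT (fun z : T * R => F z.1 z.2).
  apply: measurable_funM; first exact: (measurableT_comp mcos).
  apply: measurableT_comp => //; apply: measurable_funD => //.
  exact: measurableT_comp.
have F_le t x : `|F t x| <= cst 1 t * (2 * oneDsqr n%:R * C * w x).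
  rewrite mul1r normrM (le_trans (ler_piMl _ (cos_max _)))//
    (le_trans (uC _))//.
  rewrite mulrAC [leRHS]mulrC ler_wpM2l// (le_trans (oneDsqrV_shift_le _ _))//.
  rewrite ler_wpM2r ?(ltW (oneDsqrV_gt0 _))// ler_wpM2l// lerD2l.
  by rewrite -(real_normK (num_real (X t))) lerXn2r ?nnegrE.
have iw : leb.-integrable setT (EFin \o (fun x => 2 * oneDsqr n%:R * C * w x)).
  by apply: integrableZl_EFin => //; exact: integrable_oneDsqrV.
have i1 : P.-integrable setT (EFin \o cst 1).
  by exact: finite_measure_integrable_cst.
transitivity ((Num.sqrt (2 * pi))^-1 * \int[leb]_x \int[P]_t F t x).
  congr (_ * _); apply: eq_Rintegral => x _; rewrite RintegralZl//.
  apply: (@integrable_bounded _ _ _ P _ C); first exact: measurable_shift.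
  by move=> t; exact: cauchy_dominated_le uC.
rewrite -(@Rintegral_fubini _ _ _ _ _ P leb F _ _ mF i1 iw F_le) wave_charfM//.
rewrite -RintegralZl//;
  last exact: (@integrable_Rintegral _ _ _ _ _ P leb F _ _ mF i1 iw F_le).
apply: eq_Rintegral => t _; rewrite wave_fourier//; congr (_ * _).
rewrite -[RHS](Rintegral_shift (X t)).
  by apply: eq_Rintegral => x _; rewrite /F mulrDr opprD addrACA subrr addr0.
have := integrable_cosM (th + p * X t) (- p) iu.
by under eq_fun do rewrite mulNr.
Qed.

End bounded_variable.

Definition clip (n : nat) x : R := Num.max (- n%:R) (Num.min n%:R x).

Lemma normr_clip_le n x : `|clip n x| <= n%:R.
Proof.
by rewrite ler_norml /clip le_max lexx/= ge_max ge_min lexx andbT -subr_ge0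
  opprK addr_ge0.
Qed.

Lemma clip_id n x : `|x| <= n%:R -> clip n x = x.
Proof.
by rewrite ler_norml /clip => /andP[nx xn]; rewrite (min_r xn) (max_r nx).
Qed.

Section unbounded_variable.
Variable X : T -> R.
Hypothesis mX : measurable_fun setT X.

Lemma measurable_clip n : measurable_fun setT (clip n \o X).
Proof. by apply: measurable_maxr => //; exact: measurable_minr. Qed.

Definition tail n t : R := (n%:R < `|X t|)%R%:R.

Lemma measurable_tail n : measurable_fun setT (tail n).
Proof.
rewrite (_ : tail n = \1_(X @^-1` (~` `[- n%:R, n%:R]))).
  apply: measurable_indic; rewrite -[_ @^-1` _]setTI; apply: mX => //.
  exact: measurableC.
apply/funext => t; rewrite indicE /tail preimage_setC in_setC ltNge ler_norml.
by congr (~~ _)%:R; apply/idP/idP; rewrite inE/= in_itv.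
Qed.

Lemma tail_itv n t : 0 <= tail n t <= 1.
Proof. by rewrite ler0n lern1 leq_b1. Qed.

Lemma integrable_tail n : P.-integrable setT (EFin \o tail n).
Proof.
apply: (@integrable_bounded _ _ _ P _ 1) => [|t]; first exact: measurable_tail.
by rewrite ger0_norm; have /andP[] := tail_itv n t.
Qed.

Lemma expect_tail_cvg0 : \int[P]_t tail n t @[n --> \oo] --> 0.
Proof.
rewrite -[X in _ --> X](Rintegral_probability_cst P).
apply: (@Rintegral_dominated_cvg _ _ _ P _ _ _ (cst 1)) => //.
- exact: measurable_tail.
- move=> t _; apply: cvg_near_cst; near=> n.
  rewrite /tail ltNge (_ : (_ <= _) = true)//; near: n; exact: nbhs_infty_ger.
- exact: finite_measure_integrable_cst.
- by move=> n t _; rewrite ger0_norm; have /andP[] := tail_itv n t.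
Unshelve. all: by end_near. Qed.

Lemma unif_cvg_expected_shift_clip v B : measurable_fun setT v ->
  (forall x, `|v x| <= B) ->
  unif_cvg (fun n => expected_shift (clip n \o X) v) (expected_shift X v).
Proof.
move=> mv vB e e0.
have /cvgrPdist_lt /(_ e e0) : 2 * B * \int[P]_t tail n t @[n --> \oo] --> 0.
  by rewrite -[X in _ --> X](mulr0 (2 * B)); apply: cvgMr;
    exact: expect_tail_cvg0.
move=> [N _ tail_lt]; exists N => n /tail_lt /=; rewrite sub0r normrN => nN x.
apply: le_lt_trans nN; apply: le_trans (ler_norm _).
have msX := measurable_shift x mX mv.
have msc := measurable_shift x (measurable_clip n) mv.
rewrite /expected_shift -RintegralB//;
  [|exact: (@integrable_bounded _ _ _ P _ B)..].
rewrite -RintegralZl//; last exact: integrable_tail.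
apply: normr_Rintegral_le => //; first exact: measurable_funB.
- move=> t _ /=; rewrite /tail; case: ltP => [_|/clip_id ->].
    by rewrite mulr1 mulr_natl mulr2n (le_trans (ler_normB _ _))// lerD.
  by rewrite subrr normr0 mulr0.
- by apply: integrableZl_EFin => //; exact: integrable_tail.
Qed.

Lemma C_infty_expected_shift v B : C_infty v -> (forall x, `|v x| <= B) ->
  C_infty (expected_shift X v).
Proof.
move=> [cv v0] vB; have mv := continuous_measurable_fun cv; split.
  apply: (@continuous_Rintegral _ _ _ P setT (fun x t => v (x + X t))
    (cst B)) => //.
  - by move=> x; exact: measurable_shift.
  - move=> t _ x; apply: (cvg_comp (fun x => x + X t) v); last exact: cv.
    by apply: cvgD; [exact: cvg_id|exact: cvg_cst].
  - exact: finite_measure_integrable_cst.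
move=> e e0; have e2 : 0 < e / 2 by rewrite divr_gt0.
have /cvgrPdist_lt /(_ _ e2) : B * \int[P]_t tail n t @[n --> \oo] --> 0.
  by rewrite -[X in _ --> X](mulr0 B); apply: cvgMr; exact: expect_tail_cvg0.
move=> [N _ /(_ N (leqnn N))]; rewrite /= sub0r normrN =>
  /(le_lt_trans (ler_norm _)) tailN.
have [M vM] := v0 _ e2; exists (M + N%:R) => x Mx.
apply: (@le_lt_trans _ _ (\int[P]_t (e / 2 + B * tail N t))); last first.
  rewrite RintegralD//; last 2 first.
  - exact: finite_measure_integrable_cst.
  - by apply: integrableZl_EFin => //; exact: integrable_tail.
  rewrite Rintegral_probability_cst RintegralZl//; last exact: integrable_tail.
  by rewrite [ltRHS](splitr e) ltrD2l.
apply: normr_Rintegral_le => //; first exact: measurable_shift.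
- move=> t _; rewrite /tail; case: ltP => [_|XN].
    by rewrite mulr1 (le_trans (vB _))// lerDr ltW.
  rewrite mulr0 addr0 ltW// vM//; have := ler_normB (x + X t) (X t).
  by rewrite addrK; lra.
- apply: integrableD_EFin => //; first exact: finite_measure_integrable_cst.
  by apply: integrableZl_EFin => //; exact: integrable_tail.
Qed.

End unbounded_variable.

Lemma expected_shift_fourierE X u : measurable_fun setT X -> schwartz u ->
  expected_shift X u = fourier_inv (fun p => charf P X p * fourier u p).
Proof.
move=> mX su; have [C uC] := schwartz_cauchy_dominated 0 su.
have [D uD] := fourier_cauchy su; apply/funext => x.
rewrite -(expect_fourier_inv P mX _ _ uD) ?fourier_inversion//.
exact/continuous_cfun_measurable/(continuous_fourier
  (@schwartz_continuous _ _ 0 su) uC).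
Qed.

Lemma expected_shift_LopE delta rho X u : 0 < delta -> delta <= 2 ->
  measurable_fun setT X -> schwartz u -> expected_shift X (Lop delta rho u) =
  fourier_inv (fun p => charf P X p * (- psi delta rho p * fourier u p)).
Proof.
move=> delta_gt0 delta_le2 mX su.
have [C psiC] := psi_fourier_cauchy rho delta_gt0 delta_le2 su.
have mpsi := continuous_cfun_measurable
  (continuous_psi_fourier rho delta_gt0 su).
by apply/funext => x; rewrite -(expect_fourier_inv P mX _ mpsi psiC) -LopE.
Qed.

Lemma Lop_expected_shift delta rho X n u : 0 < delta -> delta <= 2 ->
  measurable_fun setT X -> (forall t, `|X t| <= n%:R) -> schwartz u ->
  Lop delta rho (expected_shift X u) = expected_shift X (Lop delta rho u).
Proof.
move=> delta_gt0 delta_le2 mX Xn su; rewrite expected_shift_LopE// LopE.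
apply/funext => x; congr (fourier_inv _ x); apply/funext => p.
by rewrite (fourier_expected_shift mX Xn)// mulrCA.
Qed.

Lemma Lbar_expected_shift delta rho X u : 0 < delta -> delta <= 2 ->
  measurable_fun setT X -> schwartz u ->
  Lbar delta rho (expected_shift X u) (expected_shift X (Lop delta rho u)).
Proof.
move=> delta_gt0 delta_le2 mX su; have [B uB] := schwartz_bounded 0 su.
have [cu _] := schwartz_C_infty su.
have [cL _] := Lop_C_infty rho delta_gt0 delta_le2 su.
have [D LD] := Lop_bounded rho delta_gt0 delta_le2 su.
split; first exact: C_infty_expected_shift (schwartz_C_infty su) uB.
split; first exact: C_infty_expected_shift
  (Lop_C_infty rho delta_gt0 delta_le2 su) LD.
have mclip n := measurable_clip mX n.
exists (fun n => expected_shift (clip n \o X) u); split=> [n|].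
  exact: (schwartz_expected_shift (mclip n)
    (fun t => normr_clip_le n (X t)) su).
split; first by apply: (unif_cvg_expected_shift_clip mX _ uB);
  exact: continuous_measurable_fun.
rewrite (funext (fun n => Lop_expected_shift rho delta_gt0 delta_le2 (mclip n)
  (fun t => normr_clip_le n (X t)) su)).
by apply: (unif_cvg_expected_shift_clip mX _ LD);
  exact: continuous_measurable_fun.
Qed.

End expected_shift.

Definition entire_coefs (R : realType) (c : nat -> R) : Prop :=
  forall r : R, 0 <= r -> exists S, forall N, \sum_(n < N) `|c n| * r ^+ n <= S.

Section homogeneous_kernel.
Variable R : realType.
Local Notation leb := (@lebesgue_measure R).
Variables (k : R -> R -> R) (beta : R).
Hypothesis beta_gt0 : 0 < beta.
Hypothesis hom : homogeneous k beta.
Hypothesis intk : leb.-integrable `]0, 1[ (EFin \o k 1).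
Implicit Types (s t : R).

Lemma powR_mulr_nat s a n : s `^ (a * n%:R) = (s `^ a) ^+ n.
Proof. by rewrite powRrM powR_mulrn ?powR_ge0. Qed.

Lemma exprn_powR_le s t n : 0 <= s -> s <= t -> (s `^ beta) ^+ n <=
  (t `^ beta) ^+ n.
Proof.
move=> s0 st.
rewrite lerXn2r ?nnegrE ?powR_ge0// ge0_ler_powR ?nnegrE ?(ltW beta_gt0)//.
exact: le_trans st.
Qed.

Definition volterra_kernel t s : R := if 0 < s < t then k t s else 0.

Lemma volterra_kernel_patch t : volterra_kernel t = k t \_ `]0, t[.
Proof.
apply/funext => s; rewrite /volterra_kernel patchE.
by congr (if _ then _ else _); apply/idP/idP; rewrite inE/= in_itv.
Qed.

Lemma volterra_kernel_mkcond t (f : R -> R) s :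
  ((fun s => k t s * f s) \_ `]0, t[) s = volterra_kernel t s * f s.
Proof.
by rewrite volterra_kernel_patch !patchE; case: ifPn => //; rewrite mul0r.
Qed.

Lemma volterra_kernelE t s : 0 < t ->
  volterra_kernel t s = t `^ (beta - 1) * volterra_kernel 1 (t^-1 * s).
Proof.
move=> t0; rewrite /volterra_kernel pmulr_rgt0 ?invr_gt0// (mulrC t^-1).
rewrite ltr_pdivrMr// mul1r; case: ifPn => [/andP[s0 st]|_];
  last by rewrite mulr0.
have st1 : 0 < s / t < 1 by rewrite divr_gt0// ltr_pdivrMr// mul1r.
by rewrite -(hom t0 st1) mulrCA mulfV ?mulr1// gt_eqF.
Qed.

Lemma integrable_volterra_kernel1 :
  leb.-integrable setT (EFin \o volterra_kernel 1).
Proof. by rewrite volterra_kernel_patch -restrict_EFin -integrable_mkcond. Qed.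

Lemma Rintegral_dilation (g : R -> R) t a : 0 < t ->
  leb.-integrable setT (EFin \o g) ->
  \int[leb]_s (t `^ (a - 1) * g (t^-1 * s)) = t `^ a * \int[leb]_s g s.
Proof.
move=> t0 ig; have tV0 : t^-1 != 0 by rewrite invr_eq0 gt_eqF.
rewrite RintegralZl//; last first.
  by have := integrable_affine 0 tV0 ig; under eq_fun do rewrite addr0.
have := Rintegral_affine 0 tV0 ig; under eq_Rintegral do rewrite addr0.
move=> ->; rewrite gtr0_norm ?invr_gt0// invrK mulrA -{2}[t]powRr1 ?ltW//.
by rewrite -powRD ?subrK// (gt_eqF t0) implybT.
Qed.

Lemma integrable_volterra_kernel t : 0 < t ->
  leb.-integrable setT (EFin \o volterra_kernel t).
Proof.
move=> t0; have tV0 : t^-1 != 0 by rewrite invr_eq0 gt_eqF.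
rewrite (funext (fun s => volterra_kernelE s t0));
  apply: integrableZl_EFin => //.
have := integrable_affine 0 tV0 integrable_volterra_kernel1.
by under eq_fun do rewrite addr0.
Qed.

Lemma Rintegral_normr_volterra_kernel t : 0 < t ->
  \int[leb]_s `|volterra_kernel t s| =
    t `^ beta * \int[leb]_s `|volterra_kernel 1 s|.
Proof.
move=> t0; rewrite -Rintegral_dilation//; last first.
  by apply: integrable_norm => //; exact: integrable_volterra_kernel1.
by apply: eq_Rintegral => s _;
  rewrite volterra_kernelE// normrM ger0_norm ?powR_ge0.
Qed.

Lemma normr_volterra_kernel_exprn_le t s n :
  `|volterra_kernel t s * (s `^ beta) ^+ n| <=
    (t `^ beta) ^+ n * `|volterra_kernel t s|.
Proof.
rewrite normrM mulrC /volterra_kernel;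
  case: ifPn => [/andP[s0 s_lt_t]|_]; last first.
  by rewrite normr0 !mulr0.
by rewrite ler_wpM2r// ger0_norm ?exprn_ge0 ?powR_ge0// exprn_powR_le// ltW.
Qed.

Lemma integrable_volterra_kernel_exprn t n : 0 < t ->
  leb.-integrable setT
    (EFin \o (fun s => volterra_kernel t s * (s `^ beta) ^+ n)).
Proof.
move=> t0; have ik := integrable_volterra_kernel t0.
apply: (@integrable_dominated _ _ _ leb _ _
  (fun s => (t `^ beta) ^+ n * `|volterra_kernel t s|)) => //.
- apply: measurable_funM; first exact: integrable_measurable_fun ik.
  by apply: measurable_funX; exact: measurable_powR.
- by move=> s _; exact: normr_volterra_kernel_exprn_le.
- by apply: integrableZl_EFin => //; exact: integrable_norm.
Qed.

Lemma chat_volterra_kernel t n : 0 < t ->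
  chat k beta n * \int[leb]_s (volterra_kernel t s * (s `^ beta) ^+ n) =
  chat k beta n.+1 * (t `^ beta) ^+ n.+1.
Proof.
move=> t0; have ik1 := integrable_volterra_kernel_exprn n ltr01.
have -> : chat k beta n.+1 =
    chat k beta n * \int[leb]_s (volterra_kernel 1 s * (s `^ beta) ^+ n).
  congr (_ * _); rewrite Rintegral_mkcond; apply: eq_Rintegral => s _.
  by rewrite -(volterra_kernel_mkcond 1 (fun s => (s `^ beta) ^+ n)) !patchE
    powR_mulr_nat.
rewrite -mulrA; congr (_ * _);
  rewrite mulrC -powR_mulr_nat -Rintegral_dilation//.
apply: eq_Rintegral => s _; rewrite volterra_kernelE//.
have -> : t `^ (beta * n.+1%:R - 1) = t `^ (beta - 1) * (t `^ beta) ^+ n.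
  rewrite -powR_mulr_nat -powRD; last by rewrite (gt_eqF t0) implybT.
  by congr (_ `^ _); rewrite -natr1; ring.
rewrite -!mulrA; congr (_ * _); rewrite /volterra_kernel.
case: ifPn => [/andP[s0 s1]|_]; last by rewrite !mul0r mulr0.
by rewrite mulrCA -exprMn -powRM ?ltW// mulrA mulfV ?gt_eqF// mul1r.
Qed.

Section power_series.
Variables (t K m : R) (e : nat -> R) (f : R -> R).
Hypotheses (t_gt0 : 0 < t) (m_ge0 : 0 <= m)
  (eK : forall n, `|e n| <= K * m ^+ n).
Hypothesis chat_entire : entire_coefs (chat k beta).
Hypothesis f_series : forall s, 0 < s ->
  \sum_(n < N) chat k beta n * (s `^ beta) ^+ n * e n @[N --> \oo] --> f s.

Let partial N s := \sum_(n < N) chat k beta n * (s `^ beta) ^+ n * e n.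

Let Rintegral_volterra_kernel_partial N :
  \int[leb]_s (volterra_kernel t s * partial N s) =
  \sum_(n < N) chat k beta n.+1 * (t `^ beta) ^+ n.+1 * e n.
Proof.
pose term (n : 'I_N) s := chat k beta n * e n *
  (volterra_kernel t s * (s `^ beta) ^+ n).
have iterm n : leb.-integrable setT (EFin \o term n).
  by apply: integrableZl_EFin => //; exact: integrable_volterra_kernel_exprn.
transitivity (\int[leb]_s \sum_(n < N) term n s).
  apply: eq_Rintegral => s _; rewrite mulr_sumr.
  by apply: eq_bigr => n _; rewrite /term; ring.
rewrite Rintegral_sum//; apply: eq_bigr => n _.
rewrite RintegralZl//; last exact: integrable_volterra_kernel_exprn.
by rewrite mulrAC chat_volterra_kernel.
Qed.

Let normr_volterra_kernel_partial_le : exists S, forall N s,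
  `|volterra_kernel t s * partial N s| <= S * `|volterra_kernel t s|.
Proof.
have K0 : 0 <= K by have := eK 0; rewrite expr0 mulr1; exact: le_trans.
have [S chatS] := chat_entire (mulr_ge0 (powR_ge0 t beta) m_ge0).
exists (K * S) => N s; rewrite normrM mulrC /volterra_kernel.
case: ifPn => [/andP[s0 s_lt_t]|_]; last by rewrite normr0 !mulr0.
rewrite ler_wpM2r// (le_trans (ler_norm_sum _ _ _))//.
rewrite (le_trans _ (ler_wpM2l K0 (chatS N)))// mulr_sumr ler_sum// => n _.
rewrite !normrM mulrCA -mulrA ler_wpM2l//
  (ger0_norm (exprn_ge0 _ (powR_ge0 _ _))).
rewrite exprMn mulrCA ler_pM ?exprn_ge0 ?powR_ge0//.
by apply: exprn_powR_le => //; exact: ltW.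
Qed.

(* Integrating the series of [f] against the kernel shifts its coefficients. *)
Lemma cvg_chat_shift :
  \sum_(n < N) chat k beta n.+1 * (t `^ beta) ^+ n.+1 * e n @[N --> \oo] -->
  \int[leb]_s (volterra_kernel t s * f s).
Proof.
have ik := integrable_volterra_kernel t_gt0.
have mk := integrable_measurable_fun ik.
have [S partialS] := normr_volterra_kernel_partial_le.
under eq_cvg do rewrite -Rintegral_volterra_kernel_partial.
apply: (@Rintegral_dominated_cvg _ _ _ leb _ _ _
  (fun s => S * `|volterra_kernel t s|)) => //.
- move=> N; apply: measurable_funM => //; apply: measurable_sum => n.
  apply: measurable_funM => //; apply: measurable_funM => //.
  by apply: measurable_funX; exact: measurable_powR.
- move=> s _; rewrite /volterra_kernel; case: ifPn => [/andP[s0 _]|_].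
    by apply: cvgMr; exact: f_series.
  by rewrite mul0r; under eq_fun do rewrite mul0r; exact: cvg_cst.
- by apply: integrableZl_EFin => //; exact: integrable_norm.
Qed.

End power_series.

End homogeneous_kernel.

Section integral_equation.
Context (R : realType) d (T : measurableType d) (P : probability T R).
Variables (X : R -> T -> R) (k : R -> R -> R) (beta delta rho : R).
Local Notation leb := (@lebesgue_measure R).
Local Notation w := (fun x : R => (oneDsqr x)^-1).
Hypotheses (beta_gt0 : 0 < beta) (delta_gt0 : 0 < delta)
  (delta_le2 : delta <= 2).
Hypothesis hom : homogeneous k beta.
Hypothesis intk : leb.-integrable `]0, 1[ (EFin \o k 1).
Hypothesis chat_entire : entire_coefs (chat k beta).
Hypothesis mX : forall s, 0 < s -> measurable_fun setT (X s).
Hypothesis charf_series : forall s p th : R, 0 < s ->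
  \sum_(n < N) chat k beta n * (s `^ beta) ^+ n *
    wave ((- psi delta rho p) ^+ n) th
    @[N --> \oo] --> wave (charf P (X s) p) th.
Implicit Types (s t p th x : R) (z : R[i]).

Local Notation chi s := (charf P (X s)).
Local Notation zeta p := (- psi delta rho p).

Lemma cvg_charf_seriesM s p th z : 0 < s ->
  \sum_(n < N) chat k beta n * (s `^ beta) ^+ n * wave (zeta p ^+ n * z) th
    @[N --> \oo] --> wave (chi s p * z) th.
Proof.
move=> s0; rewrite waveM.
rewrite (_ : (fun N => _) = (fun N =>
  Re z * \sum_(n < N) chat k beta n * (s `^ beta) ^+ n * wave (zeta p ^+ n) th +
  Im z * \sum_(n < N) chat k beta n * (s `^ beta) ^+ n * wave (zeta p ^+ n)
    (th + pi / 2))).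
  by apply: cvgD; apply: cvgMr; exact: charf_series.
apply/funext => N; rewrite !mulr_sumr -big_split; apply: eq_bigr => n _ /=.
by rewrite waveM; ring.
Qed.

Lemma Rintegral_volterra_charf t p th z : 0 < t ->
  \int[leb]_s (volterra_kernel k t s * wave (chi s p * (zeta p * z)) th) =
  wave (chi t p * z) th - wave z th.
Proof.
move=> t0; pose e n := wave (zeta p ^+ n * (zeta p * z)) th.
have e_le n : `|e n| <= Normc.normc (zeta p * z) * Normc.normc (zeta p) ^+ n.
  by rewrite (le_trans (normr_wave_le _ _))// Normc.normcM normcX mulrC.
have e_series s : 0 < s -> \sum_(n < N) chat k beta n * (s `^ beta) ^+ n * e n
    @[N --> \oo] --> wave (chi s p * (zeta p * z)) th.
  by move=> s0; exact: cvg_charf_seriesM.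
have := cvg_chat_shift beta_gt0 hom intk t0 (normc_ge0 _) e_le
  chat_entire e_series.
move=> /cvg_unique; apply=> //=.
rewrite (_ : (fun N => _) = (fun N => \sum_(n < N.+1) chat k beta n *
    (t `^ beta) ^+ n * wave (zeta p ^+ n * z) th - wave z th)).
  apply: cvgB; last exact: cvg_cst.
  rewrite (cvg_shiftS (fun N => \sum_(n < N) chat k beta n *
    (t `^ beta) ^+ n * wave (zeta p ^+ n * z) th)).
  exact: cvg_charf_seriesM.
apply/funext => N; rewrite big_ord_recl /= !expr0 !mul1r addrC addKr.
by apply: eq_bigr => n _; rewrite /bump /= add1n /e mulrA -exprSr.
Qed.

Section schwartz_datum.
Variable u0 : R -> R.
Hypothesis su : schwartz u0.

Let G s := expected_shift P (X s) (Lop delta rho u0).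
Let A p := zeta p * fourier u0 p.
Let F x t s p := volterra_kernel k t s * wave (chi s p * A p) (p * x).

Let mA : measurable_cfun A :=
  continuous_cfun_measurable (continuous_psi_fourier rho delta_gt0 su).

Let measurable_F x t :
  0 < t -> measurable_fun setT (fun z : R * R => F x t z.1 z.2).
Proof.
move=> t0.
have mk := integrable_measurable_fun (integrable_volterra_kernel hom intk t0).
apply: (@measurable_fun_cvg _ _ _ _
  (fun N (z : R * R) => volterra_kernel k t z.1 *
  \sum_(n < N) chat k beta n * (z.1 `^ beta) ^+ n *
    wave (zeta z.2 ^+ n * A z.2) (z.2 * x))).
  move=> N; apply: measurable_funM; first exact: (measurableT_comp mk).
  apply: measurable_sum => n; apply: measurable_funM.
    apply: measurable_funM => //; apply: measurable_funX.
    exact: (measurableT_comp (measurable_powR _)).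
  apply: (measurableT_comp (_ : measurable_fun setT
    (fun p => wave (zeta p ^+ n * A p) (p * x)))) => //.
  apply: measurable_wave; last exact: measurable_funM.
  apply: measurable_cfunM => //; apply: measurable_cfunX.
  by apply: continuous_cfun_measurable; apply: continuous_cfunN;
    exact: continuous_psi.
move=> [s p] _ /=; rewrite /F /volterra_kernel; case: ifPn => [/andP[s0 _]|_].
  by apply: cvgMr; exact: cvg_charf_seriesM.
by under eq_fun do rewrite mul0r; rewrite mul0r; exact: cvg_cst.
Qed.

Let F_dominated : exists C, forall x t s p,
  `|F x t s p| <= `|volterra_kernel k t s| * (C * w p).
Proof.
have [C AC] := psi_fourier_cauchy rho delta_gt0 delta_le2 su.
exists C => x t s p.
rewrite normrM /volterra_kernel; case: ifPn => [/andP[s0 _]|_];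
  last by rewrite normr0 !mul0r.
by rewrite ler_wpM2l// (le_trans (normr_wave_charfM_le _ (mX s0) _ _ _) (AC p)).
Qed.

Let kernel_expected_Lop x t s :
  volterra_kernel k t s * G s x = (Num.sqrt (2 * pi))^-1 *
    \int[leb]_p F x t s p.
Proof.
have [s0|s0] := ltP 0 s; last first.
  rewrite /F /volterra_kernel ltNge s0 mul0r;
    under eq_Rintegral do rewrite mul0r.
  by rewrite Rintegral_cst// mul0r mulr0.
have [C AC] := psi_fourier_cauchy rho delta_gt0 delta_le2 su.
rewrite /G expected_shift_LopE//; last exact: mX.
rewrite mulrCA RintegralZl//; apply: (@integrable_cauchy_dominated _ _ C).
  apply: measurable_wave; last exact: measurable_funM.
  by apply: measurable_cfunM mA;
    exact/continuous_cfun_measurable/continuous_charf/mX.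
by move=> p; rewrite (le_trans (normr_wave_charfM_le _ (mX s0) _ _ _) (AC p)).
Qed.

Let integrable_wave_charf_fourier t x : 0 < t ->
  leb.-integrable setT
    (EFin \o (fun p => wave (chi t p * fourier u0 p) (p * x))).
Proof.
move=> t0; have [C uC] := fourier_cauchy su;
  have [D uD] := schwartz_cauchy_dominated 0 su.
apply: (@integrable_cauchy_dominated _ _ C).
  apply: measurable_wave; last exact: measurable_funM.
  apply: measurable_cfunM;
    first exact/continuous_cfun_measurable/continuous_charf/mX.
  exact/continuous_cfun_measurable/(continuous_fourier
    (@schwartz_continuous _ _ 0 su) uD).
by move=> p; rewrite (le_trans (normr_wave_charfM_le _ (mX t0) _ _ _) (uC p)).
Qed.

Let integrable_wave_fourier x :
  leb.-integrable setT (EFin \o (fun p => wave (fourier u0 p) (p * x))).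
Proof.
have [C uC] := fourier_cauchy su; have [D uD] := schwartz_cauchy_dominated 0 su.
apply: (@integrable_cauchy_dominated _ _ C).
  apply: measurable_wave; last exact: measurable_funM.
  exact/continuous_cfun_measurable/(continuous_fourier
    (@schwartz_continuous _ _ 0 su) uD).
by move=> p; exact: le_trans (normr_wave_le _ _) (uC p).
Qed.

Lemma integrable_kernel_expected_Lop t x : 0 < t ->
  leb.-integrable setT (EFin \o (fun s => volterra_kernel k t s * G s x)).
Proof.
move=> t0; have [C FC] := F_dominated.
have iNk := integrable_norm (integrable_volterra_kernel hom intk t0).
have iw : leb.-integrable setT (EFin \o (fun p => C * w p)).
  by apply: integrableZl_EFin => //; exact: integrable_oneDsqrV.
under eq_fun do rewrite kernel_expected_Lop; apply: integrableZl_EFin => //.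
exact: (@integrable_Rintegral _ _ _ _ _ leb leb (F x t) _ _ (measurable_F x t0)
  iNk iw (FC x t)).
Qed.

Lemma expected_shift_integral_equation t x : 0 < t ->
  \int[leb]_s (volterra_kernel k t s * G s x) =
    expected_shift P (X t) u0 x - u0 x.
Proof.
move=> t0; have [C FC] := F_dominated.
have iNk := integrable_norm (integrable_volterra_kernel hom intk t0).
have iw : leb.-integrable setT (EFin \o (fun p => C * w p)).
  by apply: integrableZl_EFin => //; exact: integrable_oneDsqrV.
rewrite expected_shift_fourierE//; last exact: mX.
rewrite -[X in _ = _ - X x](fourier_inversion su) /fourier_inv -mulrBr
  -RintegralB//; last first.
  exact: integrable_wave_charf_fourier.
under eq_Rintegral do rewrite kernel_expected_Lop.
rewrite RintegralZl//; last first.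
  exact: (@integrable_Rintegral _ _ _ _ _ leb leb (F x t) _ _
    (measurable_F x t0) iNk iw (FC x t)).
rewrite (@Rintegral_fubini _ _ _ _ _ leb leb (F x t) _ _ (measurable_F x t0) iNk
  iw (FC x t)).
by congr (_ * _); apply: eq_Rintegral => p _; rewrite -Rintegral_volterra_charf.
Qed.

Lemma normr_expected_shift_increment_le x : exists K, forall t, 0 < t ->
  `|expected_shift P (X t) u0 x - u0 x| <= K * t `^ beta.
Proof.
have [B LB] := Lop_bounded rho delta_gt0 delta_le2 su.
have mL := continuous_measurable_fun (Lop_C_infty rho delta_gt0 delta_le2 su).1.
exists (B * \int[leb]_s `|volterra_kernel k 1 s|) => t t0.
have iNk := integrable_norm (integrable_volterra_kernel hom intk t0).
rewrite -expected_shift_integral_equation// mulrAC -mulrA.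
rewrite -(Rintegral_normr_volterra_kernel hom intk t0) -RintegralZl//.
apply: normr_Rintegral_le => //.
- exact: (integrable_measurable_fun (integrable_kernel_expected_Lop x t0)).
- move=> s _; rewrite normrM mulrC /volterra_kernel;
    case: ifPn => [/andP[s0 _]|_].
    rewrite ler_wpM2r//; apply: normr_expect_le => //.
    by apply: measurable_shift => //; exact: mX.
  by rewrite normr0 !mulr0.
- exact: integrableZl_EFin.
Qed.

Lemma expected_shift_solves : solves (Lbar delta rho) k u0
  (fun t x => expect P (fun a : T => u0 (x + X t a))).
Proof.
exists G; split;
  first by move=> s s0; apply: Lbar_expected_shift => //; exact: mX.
split=> [t x t0|x].
  have -> : (fun s => (k t s * G s x)%:E) =
    EFin \o (fun s => k t s * G s x) by [].
  split.
    rewrite integrable_mkcond// restrict_EFin.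
    rewrite (funext (volterra_kernel_mkcond k t (G ^~ x))).
    exact: integrable_kernel_expected_Lop.
  rewrite Rintegral_mkcond (funext (volterra_kernel_mkcond k t (G ^~ x))).
  by rewrite expected_shift_integral_equation// addrC subrK.
have [K incrK] := normr_expected_shift_increment_le x.
apply/subr_cvg0; apply: (@norm_cvg0 _ R^o).
apply: (@squeeze_cvgr _ _ _ _ (fun=> 0) (fun t => K * t `^ beta)).
- near=> t; rewrite normr_ge0/=; apply: incrK.
  by near: t; exact: nbhs_right_gt.
- exact: cvg_cst.
- by rewrite -[X in _ --> X](mulr0 K); apply: cvgMr; exact: powR_cvg0.
Unshelve. all: by end_near. Qed.

End schwartz_datum.

End integral_equation.

Section joint_law.
Context (R : realType) d (T : measurableType d) (P : probability T R).
Implicit Types (X Y : T -> R) (B C : set R) (G : set (R * R)).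

Definition indep_pair X Y : Prop := forall B C, measurable B -> measurable C ->
  P (X @^-1` B `&` Y @^-1` C) = (P (X @^-1` B) * P (Y @^-1` C))%E.

Variables (X Y : T -> R).
Hypotheses (mX : measurable_fun setT X) (mY : measurable_fun setT Y).

Let mXY : measurable_fun setT (fun t => (X t, Y t)).
Proof. exact: measurable_fun_pair. Qed.

Let mXY2 : measurable_fun setT (fun z : T * T => (X z.1, Y z.2)).
Proof. by apply: measurable_fun_pair; exact: measurableT_comp. Qed.

Let measurable_preimage (Z : T -> R) B :
  measurable_fun setT Z -> measurable B ->
  measurable (Z @^-1` B).
Proof. by move=> mZ mB; rewrite -[_ @^-1` _]setTI; exact: mZ. Qed.

Lemma joint_law_unique (Q : {measure set T -> \bar R}) G :
  (forall B C, measurable B -> measurable C ->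
    Q (X @^-1` B `&` Y @^-1` C) = (P (X @^-1` B) * P (Y @^-1` C))%E) ->
  measurable G -> Q ((fun t => (X t, Y t)) @^-1` G) =
    (P \x P)%E ((fun z => (X z.1, Y z.2)) @^-1` G).
Proof.
move=> QE mG.
pose X' : {mfun T >-> R} := HB.pack X (isMeasurableFun.Build _ _ _ _ X mX).
pose Y' : {mfun T >-> R} := HB.pack Y (isMeasurableFun.Build _ _ _ _ Y mY).
pose law : {measure set (R * R) -> \bar R} :=
  pushforward Q (fun t => (X t, Y t)).
pose law2 : {measure set (R * R) -> \bar R} :=
  pushforward (P \x P)%E (fun z => (X z.1, Y z.2)).
transitivity ((distribution P X' \x distribution P Y')%E G); last first.
  rewrite -[RHS]/(law2 mXY2 G); apply: product_measure_unique => // B C mB mC.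
  rewrite -[LHS]/((P \x P)%E ((X @^-1` B) `*` (Y @^-1` C))) product_measure1E//.
  - exact: measurable_preimage.
  - exact: measurable_preimage.
rewrite -[LHS]/(law mXY G).
by apply/esym; apply: product_measure_unique => // B C mB mC; exact: QE.
Qed.

Lemma Rintegral_indep_pair (F : R * R -> R) K : indep_pair X Y ->
  measurable_fun setT F -> (forall z, `|F z| <= K) ->
  \int[P]_t F (X t, Y t) = \int[P]_s \int[P]_t F (X s, Y t).
Proof.
move=> indXY mF FK.
pose XY : {mfun T >-> (R * R)%type} := HB.pack (fun t => (X t, Y t))
  (isMeasurableFun.Build _ _ _ _ (fun t => (X t, Y t)) mXY).
have mFXY : measurable_fun setT (fun t => F (X t, Y t)).
  by exact: measurableT_comp.
have mFXY2 : measurable_fun setT (fun z : T * T => F (X z.1, Y z.2)).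
  exact: (measurableT_comp mF mXY2).
have F_le s t : `|F (X s, Y t)| <= cst K s * cst 1 t by rewrite mulr1.
have iK : P.-integrable setT (EFin \o cst K).
  by exact: finite_measure_integrable_cst.
have i1 : P.-integrable setT (EFin \o cst 1).
  by exact: finite_measure_integrable_cst.
rewrite (@Rintegral_prod _ _ _ _ _ P P (fun s t => F (X s, Y t)) _ _
  mFXY2 iK i1 F_le).
transitivity (\int[distribution P XY]_z F z).
  apply/esym; apply: Rintegral_pushforward mXY _ mF _ => //.
  exact: (integrable_bounded P mFXY (fun t => FK (X t, Y t))).
apply: (Rintegral_pushforward mXY2) => //.
- by move=> G mG; exact: joint_law_unique.
- exact: (@integrable_dominated_prod _ _ _ _ _ P P (fun s t => F (X s, Y t)) _ _
    mFXY2 iK i1 F_le).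
Qed.

Lemma charfD p : indep_pair X Y ->
  charf P (fun t => X t + Y t) p = charf P X p * charf P Y p.
Proof.
move=> indXY; have mD : measurable_fun setT (fun t => X t + Y t).
  by exact: measurable_funD.
apply: wave_inj => th; rewrite wave_charf// wave_charfM//.
rewrite (@Rintegral_indep_pair (fun z => cos (th + p * (z.1 + z.2))) 1)//.
- apply: eq_Rintegral => s _; rewrite wave_charf//.
  by apply: eq_Rintegral => t _; rewrite mulrDr addrA.
- apply: (measurableT_comp (@measurable_cos R setT));
    apply: measurable_funD => //.
  by apply: measurable_funM => //; exact: measurable_funD.
- by move=> z; exact: cos_max.
Qed.

Lemma indep_pair_event (E : set T) G : measurable E -> indep_pair X Y ->
  (forall B C, measurable B -> measurable C ->
    P (X @^-1` B `&` Y @^-1` C `&` E) =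
    (P (X @^-1` B) * P (Y @^-1` C) * P E)%E) ->
  measurable G -> let XY t := (X t, Y t) in
  P (XY @^-1` G `&` E) = (P (XY @^-1` G) * P E)%E.
Proof.
move=> mE indXY indXYE mG XY; have mXYG : measurable (XY @^-1` G).
  by rewrite -[_ @^-1` _]setTI; exact: mXY.
have PEfin : P E \is a fin_num by exact: fin_num_measure.
have [PE0|PEn0] := eqVneq (P E) 0%E.
  rewrite PE0 mule0; apply/eqP; rewrite eq_le measure_ge0 andbT -PE0.
  by apply: le_measure => //; rewrite ?inE//; exact: measurableI.
have fPEn0 : fine (P E) != 0 by rewrite fine_eq0.
have rPE0 : 0 <= (fine (P E))^-1 by rewrite invr_ge0 fine_ge0.
pose Q : {measure set T -> \bar R} := mscale (NngNum rPE0) (mrestr P mE).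
have QE A : Q A = ((fine (P E))^-1%:E * P (A `&` E))%E by [].
have PE_cancel a : ((fine (P E))^-1%:E * (a * P E) = a)%E.
  by rewrite muleCA -[X in (_ * (_ * X))%E]fineK// -EFinM mulVf// mule1.
rewrite (joint_law_unique indXY mG) -(@joint_law_unique Q)//.
  by rewrite QE -muleA PE_cancel.
by move=> B C mB mC; rewrite QE indXYE.
Qed.

End joint_law.
Section mutual_independence.
Context (R : realType) d (T : measurableType d) (P : probability T R).
Variables (n : nat) (X : 'I_n -> T -> R).
Hypotheses (mX : forall i, measurable_fun setT (X i))
  (indX : mutually_indep P X).
Implicit Types (A : set R) (B : 'I_n -> set R) (i : 'I_n) (j : nat).

Lemma mutually_indep_comp (f : 'I_n -> R -> R) :
  (forall i, measurable_fun setT (f i)) ->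
    mutually_indep P (fun i => f i \o X i).
Proof.
move=> mf B mB; rewrite -(indX (B := fun i => f i @^-1` B i))// => i.
by rewrite -[_ @^-1` _]setTI; exact: mf.
Qed.

Let box B := \bigcap_(i in [set: 'I_n]) (X i @^-1` B i).

Let measurable_box B : (forall i, measurable (B i)) -> measurable (box B).
Proof.
move=> mB; apply: fin_bigcap_measurable => //= i _.
by rewrite -[_ @^-1` _]setTI; exact: mX.
Qed.

Let boxT : box (fun=> setT) = setT. Proof. by apply/seteqP; split. Qed.

Let update B i A i' := if i' == i then A else B i'.

Let measurable_update B i A : (forall i, measurable (B i)) -> measurable A ->
  forall i', measurable (update B i A i').
Proof. by move=> mB mA i'; rewrite /update; case: ifP. Qed.

Let box_update B i A : B i = setT -> box (update B i A) = X i @^-1` A `&` box B.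
Proof.
move=> Bi; apply/seteqP; split => [t XtB|t [XtA XtB] i' _]; rewrite /update.
  split; first by have := XtB i I; rewrite /update eqxx.
  move=> i' _; have := XtB i' I; rewrite /update; case: eqP => [->|//].
  by rewrite Bi.
by case: eqP => [->//|_]; exact: XtB.
Qed.

Let probability_box_update B i A : (forall i, measurable (B i)) ->
  measurable A ->
  B i = setT -> P (box (update B i A)) = (P (X i @^-1` A) * P (box B))%E.
Proof.
move=> mB mA Bi; rewrite !indX//; last exact: measurable_update.
rewrite (bigD1 i)//= [in RHS](bigD1 i)//= /update eqxx Bi preimage_setT.
rewrite probability_setT mul1e; congr (_ * _)%E.
by apply: eq_bigr => i' /negbTE ->.
Qed.

Let prefix_sum j t := \sum_(i < n | (i < j)%N) X i t.

Let measurable_prefix_sum j : measurable_fun setT (prefix_sum j).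
Proof.
rewrite (_ : prefix_sum j = fun t =>
  \sum_(i < n) (if (i < j)%N then X i t else 0)).
  by apply: measurable_sum => i; case: (i < j)%N.
by apply/funext => t; rewrite /prefix_sum big_mkcond.
Qed.

Let prefix_sumS (i : 'I_n) t : prefix_sum i.+1 t = prefix_sum i t + X i t.
Proof.
rewrite /prefix_sum (bigD1 i)//= addrC; congr (_ + _); apply: eq_bigl => i'.
by rewrite ltnS [in RHS]ltn_neqAle andbC.
Qed.

Let indep_prefix_sum_event j A B : (j <= n)%N -> measurable A ->
  (forall i, measurable (B i)) -> (forall i, (i < j)%N -> B i = setT) ->
  P (prefix_sum j @^-1` A `&` box B) = (P (prefix_sum j @^-1` A) * P (box B))%E.
Proof.
elim: j A B => [|j IH] A B jn mA mB BT.
  rewrite (_ : prefix_sum 0 = cst 0);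
    last by apply/funext => t; rewrite /prefix_sum big_pred0.
  rewrite preimage_cst; case: ifPn => _;
    first by rewrite setTI probability_setT mul1e.
  by rewrite set0I measure0 mul0e.
pose i := Ordinal jn.
have IH_update B' C D : measurable C -> measurable D ->
  (forall i, measurable (B' i)) ->
    (forall i, (i < j.+1)%N -> B' i = setT) ->
    P (prefix_sum j @^-1` C `&` (X i @^-1` D `&` box B')) =
    (P (prefix_sum j @^-1` C) * (P (X i @^-1` D) * P (box B')))%E.
  move=> mC mD mB' B'T; have B'i : B' i = setT by exact: B'T.
  rewrite -box_update// -probability_box_update// IH// ?(ltnW jn)//.
    exact: measurable_update.
  move=> i' i'j; rewrite /update; case: eqP => [i'i|_];
    last by apply: B'T; rewrite ltnW.
  by move: i'j; rewrite i'i ltnn.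
have indSX : indep_pair P (prefix_sum j) (X i).
  move=> C D mC mD; have := IH_update (fun=> setT) C D mC mD (fun=> measurableT)
    (fun _ _ => erefl).
  by rewrite boxT setIT probability_setT mule1.
rewrite (_ : prefix_sum j.+1 @^-1` A =
  (fun t => (prefix_sum j t, X i t)) @^-1` ((fun z => z.1 + z.2) @^-1` A));
    last first.
  by apply/seteqP; split => t /=; rewrite (prefix_sumS i).
apply: indep_pair_event => //.
- exact: measurable_box.
- by move=> C D mC mD; rewrite -setIA IH_update// muleA.
- by rewrite -[_ @^-1` _]setTI; apply: measurable_funD.
Qed.

Let indep_pair_prefix_sum i : indep_pair P (prefix_sum i) (X i).
Proof.
move=> A C mA mC; pose B := update (fun=> setT) i C.
have boxB : box B = X i @^-1` C by rewrite box_update// boxT setIT.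
rewrite -boxB indep_prefix_sum_event// ?(ltnW (ltn_ord i))//.
  exact: measurable_update.
by move=> i' i'i; rewrite /B /update; case: eqP => // i'E;
  rewrite i'E ltnn in i'i.
Qed.

Lemma charf_sum p : charf P (fun t => \sum_i X i t) p = \prod_i charf P (X i) p.
Proof.
have charf_prefix j : (j <= n)%N ->
    charf P (prefix_sum j) p = \prod_(i < n | (i < j)%N) charf P (X i) p.
  elim: j => [|j IH] jn.
    rewrite (_ : prefix_sum 0 = cst 0);
      last by apply/funext => t; rewrite /prefix_sum big_pred0.
    rewrite big_pred0//; apply: wave_inj => th; rewrite wave_charf//.
    under eq_Rintegral do rewrite mulr0 addr0.
    by rewrite Rintegral_probability_cst /wave mul1r mul0r subr0.
  pose i := Ordinal jn.
  rewrite (_ : prefix_sum j.+1 = fun t => prefix_sum i t + X i t).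
    rewrite charfD//.
    rewrite IH 1?ltnW// [RHS](bigD1 i)//= mulrC; congr (_ * _);
      apply: eq_bigl => i'.
    by rewrite ltnS [in LHS]ltn_neqAle andbC.
  by apply/funext => t; exact: (prefix_sumS i).
have := charf_prefix n (leqnn n).
rewrite (_ : prefix_sum n = fun t => \sum_i X i t); last first.
  by apply/funext => t; apply: eq_bigl => i; rewrite ltn_ord.
by move=> ->; apply: eq_bigl => i; rewrite ltn_ord.
Qed.

End mutual_independence.

Section pos_homogeneous_integrals.
Variables (R : realType) (delta : R).
Hypothesis delta_gt0 : 0 < delta.
Implicit Types (g : R -> R) (eta : R).

Let pos_homogeneous_close_unit g s eta :
  pos_homogeneous delta g -> `|s| = 1 -> 0 < eta ->
  exists2 C, 0 <= C & forall x, `|g x - g s| <= eta + C * `|x - s| `^ delta.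
Proof.
move=> hg s1 eta0; pose K := `|g 1| + `|g (-1)|.
have gK x : `|g x| <= K * `|x| `^ delta := normr_pos_homogeneous_le hg x.
have K0 : 0 <= K by rewrite addr_ge0.
have cg : g x @[x --> s] --> g s.
  by exact: (continuous_pos_homogeneous delta_gt0 hg).
have /cvgrPdist_le/(_ _ eta0)/nbhs_ballP[r/= r0 near_s] := cg.
have q0 : 0 < 1 + r^-1 by rewrite addr_gt0// invr_gt0.
exists (2 * K * (1 + r^-1) `^ delta) => [|x];
  first by rewrite !mulr_ge0// powR_ge0.
have far_le : 0 <= 2 * K * (1 + r^-1) `^ delta * `|x - s| `^ delta.
  by rewrite !mulr_ge0// powR_ge0.
have [xs_lt|xs_ge] := ltP `|x - s| r.
  by rewrite distrC (le_trans (near_s x _)) ?lerDl//; rewrite /ball/= distrC.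
have r1 : 1 <= r^-1 * `|x - s| by rewrite ler_pdivlMl// mulr1.
have powR_le_far y : `|y| <= (1 + r^-1) * `|x - s| ->
    `|g y| <= K * ((1 + r^-1) `^ delta * `|x - s| `^ delta).
  move=> y_le; rewrite (le_trans (gK y))// ler_wpM2l// -powRM// ?(ltW q0)//.
  by rewrite ge0_ler_powR ?nnegrE ?(ltW delta_gt0)// mulr_ge0// ltW.
have gx := powR_le_far x; have gs := powR_le_far s.
rewrite (le_trans (ler_normB _ _))// ler_wpDl ?(ltW eta0)//.
rewrite -!mulrA mulr_natl mulr2n lerD//.
  by apply: gx; rewrite mulrDl mul1r -[X in `|X|](subrK s)
    (le_trans (ler_normD _ _))// s1 lerD2l.
by apply: gs; rewrite s1 mulrDl (le_trans r1)// lerDr mul1r.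
Qed.

Lemma pos_homogeneous_close g eta : pos_homogeneous delta g -> 0 < eta ->
  exists2 C, 0 <= C &
    forall a b, `|g a - g b| <= eta * `|b| `^ delta + C * `|a - b| `^ delta.
Proof.
move=> hg eta0.
have [C1 C1_ge0 close1] := pos_homogeneous_close_unit hg (normr1 R) eta0.
have [C2 C2_ge0 close2] := pos_homogeneous_close_unit hg (normrN1 R) eta0.
pose K := `|g 1| + `|g (-1)|; have K0 : 0 <= K by rewrite addr_ge0.
exists (K + C1 + C2) => [|a b]; first by rewrite !addr_ge0.
have [->|b0] := eqVneq b 0.
  rewrite (pos_homogeneous0 delta_gt0 hg) !subr0 normr0
    powR0 ?gt_eqF// mulr0 add0r.
  rewrite (le_trans (normr_pos_homogeneous_le hg a))// ler_wpM2r ?powR_ge0//.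
  by rewrite -addrA lerDl addr_ge0.
have nb0 : 0 < `|b| by rewrite normr_gt0.
pose x := `|b|^-1 * a; pose s := `|b|^-1 * b.
have close_s : `|g x - g s| <= eta + (K + C1 + C2) * `|x - s| `^ delta.
  have [bp|bn] := ltP 0 b.
    have -> : s = 1 by rewrite /s gtr0_norm// mulVf ?gt_eqF.
    rewrite (le_trans (close1 x))// lerD2l ler_wpM2r ?powR_ge0//.
    by rewrite addrAC lerDr addr_ge0.
  have -> : s = -1 by rewrite /s ler0_norm// invrN mulNr mulVf.
  rewrite (le_trans (close2 x))// lerD2l ler_wpM2r ?powR_ge0//.
  by rewrite lerDr addr_ge0.
have gE y : g y = `|b| `^ delta * g (`|b|^-1 * y).
  by rewrite -hg// mulVKf// gt_eqF.
have abE : `|a - b| = `|b| * `|x - s|.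
  by rewrite -[X in X * _]normr_id -normrM mulrBr !mulVKf// gt_eqF.
rewrite gE (gE b) -mulrBr normrM (ger0_norm (powR_ge0 _ _)) abE powRM// mulrCA.
by rewrite (mulrC eta) -mulrDr ler_wpM2l// powR_ge0.
Qed.

Context d (T : measurableType d) (mu : {measure set T -> \bar R}).
Implicit Types f : T -> R.

Local Notation power_integrable f :=
  (mu.-integrable setT (EFin \o (fun x => `|f x| `^ delta))).

Lemma measurable_normr_powR f : measurable_fun setT f ->
  measurable_fun setT (fun x => `|f x| `^ delta).
Proof.
move=> mf; have /(measurable_pos_homogeneous delta_gt0) mpow :=
  @pos_homogeneous_normr_powR R delta.
exact: (measurableT_comp mpow mf).
Qed.

Lemma integrable_pos_homogeneous g f :
  pos_homogeneous delta g -> measurable_fun setT f ->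
  power_integrable f -> mu.-integrable setT (EFin \o (g \o f)).
Proof.
move=> hg mf intf.
apply: (@integrable_dominated _ _ _ mu _ _
  (fun x => (`|g 1| + `|g (-1)|) * `|f x| `^ delta)) => //.
- by apply: measurableT_comp mf;
    exact: (measurable_pos_homogeneous delta_gt0 hg).
- by move=> x _; exact: normr_pos_homogeneous_le.
- exact: integrableZl_EFin.
Qed.

Lemma fin_num_power_integrable f : measurable_fun setT f ->
  (\int[mu]_x (`|f x| `^ delta)%:E)%E \is a fin_num -> power_integrable f.
Proof.
move=> mf fin; apply/integrableP; split.
  by apply/measurable_EFinP; exact: measurable_normr_powR.
under eq_integral do rewrite /= ger0_norm ?powR_ge0//.
by rewrite -ge0_fin_numE//; apply: integral_ge0 => x _;
  rewrite lee_fin powR_ge0.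
Qed.

Lemma power_integrableD f f' : measurable_fun setT f ->
  measurable_fun setT f' ->
  power_integrable f -> power_integrable (fun x => f x - f' x) ->
    power_integrable f'.
Proof.
move=> mf mf' intf intff'.
have [C C0 close] := pos_homogeneous_close
  (@pos_homogeneous_normr_powR R delta) ltr01.
apply: (@integrable_dominated _ _ _ mu _ _
  (fun x => 2 * `|f x| `^ delta + C * `|f x - f' x| `^ delta)) => //.
- exact: measurable_normr_powR.
- move=> x _; rewrite ger0_norm ?powR_ge0//; have := close (f' x) (f x).
  by rewrite (distrC (f' x)) => /(le_trans (ler_norm _)); lra.
- by apply: integrableD_EFin => //; exact: integrableZl_EFin.
Qed.

Lemma cvg_Rintegral_pos_homogeneous g (f_ : nat -> T -> R) f :
  pos_homogeneous delta g -> (forall n, measurable_fun setT (f_ n)) ->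
  measurable_fun setT f -> (forall n, power_integrable (f_ n)) ->
    power_integrable f ->
  (\int[mu]_x (`|f_ n x - f x| `^ delta)%:E)%E @[n --> \oo] --> 0%E ->
  \int[mu]_x g (f_ n x) @[n --> \oo] --> \int[mu]_x g (f x).
Proof.
move=> hg mf_ mf intf_ intf f_f; apply/cvgrPdist_le => e e0.
set I := \int[mu]_x `|f x| `^ delta.
have I0 : 0 <= I by apply: Rintegral_ge0 => x _; exact: powR_ge0.
pose eta := e / 2 / (I + 1).
have eta0 : 0 < eta by rewrite !divr_gt0// ltr_wpDl.
have [C C0 close] := pos_homogeneous_close hg eta0.
have etaI : eta * I <= e / 2.
  by rewrite mulrAC ler_pdivrMr ?ltr_wpDl// ler_wpM2l ?lerDl// divr_ge0// ltW.
have C1 : 0 < C + 1 by rewrite ltr_wpDl.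
have e2C : 0 < e / 2 / (C + 1) by rewrite !divr_gt0.
move/fine_cvgP : f_f => [f_fin] /cvgrPdist_le /(_ _ e2C).
apply: filterS2 f_fin => n f_fin /=; rewrite sub0r normrN => f_n.
have intD : power_integrable (fun x => f_ n x - f x).
  by apply: fin_num_power_integrable => //; exact: measurable_funB.
rewrite distrC -RintegralB//; [|exact: integrable_pos_homogeneous..].
apply: (@le_trans _ _
  (\int[mu]_x (eta * `|f x| `^ delta + C * `|f_ n x - f x| `^ delta))).
  apply: normr_Rintegral_le => //.
  - have mg := measurable_pos_homogeneous delta_gt0 hg.
    by apply: measurable_funB; exact: measurableT_comp mg _.
  - by apply: integrableD_EFin => //; exact: integrableZl_EFin.
rewrite RintegralD//; [|exact: integrableZl_EFin..].
rewrite !RintegralZl// [leRHS](splitr e)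
  lerD// (@le_trans _ _ ((C + 1) * (e / 2 / (C + 1))))//.
  by rewrite ler_pM//;
    [exact: Rintegral_ge0|rewrite lerDl|exact: le_trans (ler_norm _) f_n].
by rewrite mulrC divfK// gt_eqF.
Qed.

End pos_homogeneous_integrals.

Section disjoint_simple_functions.
Variable R : realType.
Local Notation leb := (@lebesgue_measure R).
Implicit Types (s : seq (R * set R)) (A B : set R) (g : R -> R) (x : R).

Definition disjoint_supports s :=
  pairwise (fun c c' : R * set R => `[< c.2 `&` c'.2 = set0 >]) s.

(* Adding [a * \1_A] to a disjoint sum splits each support along [A]. *)
Fixpoint refine_simple (a : R) A s : seq (R * set R) :=
  if s is c :: s' then
    (c.1 + a, c.2 `&` A) :: (c.1, c.2 `\` A) :: refine_simple a (A `\` c.2) s'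
  else [:: (a, A)].

Fixpoint disjointify s : seq (R * set R) :=
  if s is c :: s' then refine_simple c.1 c.2 (disjointify s') else [::].

Lemma lebesgue_measure_finS A B : measurable A -> measurable B -> A `<=` B ->
  (leb B < +oo)%E -> (leb A < +oo)%E.
Proof.
by move=> mA mB AB; apply: le_lt_trans; apply: le_measure => //; rewrite inE.
Qed.

Lemma simple_adm_cons c s : simple_adm (c :: s) <->
  (measurable c.2 /\ (leb c.2 < +oo)%E) /\ simple_adm s.
Proof.
split=> [adm|[cadm sadm] c']; last by rewrite inE =>
  /predU1P[->//|]; exact: sadm.
by split=> [|c' c's]; apply: adm; rewrite inE ?eqxx// c's orbT.
Qed.

Lemma simple_adm_refine a A s : measurable A -> (leb A < +oo)%E ->
  simple_adm s -> simple_adm (refine_simple a A s).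
Proof.
elim: s a A => [|c s IH] a A mA finA /=;
  first by move=> _; apply/simple_adm_cons; split.
move=> /simple_adm_cons[[mc finc] sadm].
apply/simple_adm_cons; split => /=.
  split; first exact: measurableI.
  by apply: lebesgue_measure_finS finc => //; exact: measurableI.
apply/simple_adm_cons; split => /=.
  split; first exact: measurableD.
  by apply: lebesgue_measure_finS finc => //; exact: measurableD.
apply: IH => //; first exact: measurableD.
by apply: lebesgue_measure_finS finA => //; exact: measurableD.
Qed.

Lemma simple_adm_disjointify s : simple_adm s -> simple_adm (disjointify s).
Proof.
elim: s => [//|c s IH] /simple_adm_cons[[mc finc] sadm] /=.
by apply: simple_adm_refine => //; exact: IH.
Qed.

Lemma sf_eval_cons c s x : sf_eval (c :: s) x = c.1 * \1_(c.2) x + sf_eval s x.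
Proof. by rewrite /sf_eval big_cons. Qed.

Lemma sf_eval_refine a A s x :
  sf_eval (refine_simple a A s) x = a * \1_A x + sf_eval s x.
Proof.
elim: s a A => [|c s IH] a A /=; first by rewrite sf_eval_cons.
rewrite !sf_eval_cons/= IH !setDE !indicE !in_setI !classical_sets.in_setC.
by case: (x \in A); case: (x \in c.2) => /=; ring.
Qed.

Lemma sf_eval_disjointify s : sf_eval (disjointify s) = sf_eval s.
Proof.
apply/funext => x; elim: s => [//|c s IH] /=.
by rewrite sf_eval_refine IH sf_eval_cons.
Qed.

Let all_disjoint_refine B a A s : B `&` A = set0 ->
  all (fun c : R * set R => `[< B `&` c.2 = set0 >]) s ->
  all (fun c : R * set R => `[< B `&` c.2 = set0 >]) (refine_simple a A s).
Proof.
elim: s a A => [|c s IH] a A BA /=;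
  first by move=> _; rewrite andbT; exact/asboolP.
move=> /andP[/asboolP Bc Bs]; apply/and3P; split.
- by apply/asboolP; rewrite setIA Bc set0I.
- by apply/asboolP; rewrite setDE setIA Bc set0I.
- by apply: IH => //; rewrite setDE setIA BA set0I.
Qed.

Lemma disjoint_supports_refine a A s :
  disjoint_supports s -> disjoint_supports (refine_simple a A s).
Proof.
rewrite /disjoint_supports; elim: s a A => [//|c s IH] a A.
rewrite pairwise_cons => /andP[cs ss] /=; rewrite IH// andbT.
have disjointS B :
  B `<=` c.2 -> all (fun c : R * set R => `[< B `&` c.2 = set0 >]) s.
  move=> Bc; apply: sub_all cs => c' /asboolP cc'; apply/asboolP.
  by apply/seteqP; split => // x [/Bc cx c'x]; rewrite -cc'.
rewrite -andbA; apply/and3P; split.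
- by apply/asboolP/seteqP; split => // x [[_ +]] [].
- apply: all_disjoint_refine; last by apply: disjointS; exact: subIsetl.
  by apply/seteqP; split => // x [[cx _]] [].
- apply: all_disjoint_refine; last by apply: disjointS; exact: subDsetl.
  by apply/seteqP; split => // x [[_ nA]] [].
Qed.

Lemma disjoint_supports_disjointify s : disjoint_supports (disjointify s).
Proof. by elim: s => [//|c s IH] /=; exact: disjoint_supports_refine. Qed.

Lemma comp_sf_eval g s x : g 0 = 0 -> disjoint_supports s ->
  g (sf_eval s x) = \sum_(c <- s) g c.1 * \1_(c.2) x.
Proof.
move=> g0; rewrite /disjoint_supports; elim: s => [|c s IH].
  by rewrite /sf_eval !big_nil.
rewrite pairwise_cons => /andP[/allP cs ss];
  rewrite sf_eval_cons big_cons -IH// indicE.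
case: (boolP (x \in c.2)) => xc; last by rewrite !mulr0 !add0r.
have -> : sf_eval s x = 0.
  rewrite /sf_eval big1_seq// => c' /andP[_ /cs /asboolP cc'];
    rewrite indicE memNset ?mulr0//.
  by move=> c'x; have : (c.2 `&` c'.2) x by [split => //; exact/set_mem];
    rewrite cc'.
by rewrite !mulr1 g0 !addr0.
Qed.

Lemma integrable_lebesgue_indic A : measurable A -> (leb A < +oo)%E ->
  leb.-integrable setT (EFin \o (\1_A : R -> R)).
Proof.
move=> mA finA; apply/integrableP; split.
  by apply/measurable_EFinP; exact: measurable_indic.
under eq_integral do rewrite /= ger0_norm//.
by rewrite integral_indic// setIT.
Qed.

Section integral.
Variables (g : R -> R) (s : seq (R * set R)).
Hypotheses (g0 : g 0 = 0) (sadm : simple_adm s) (sdisj : disjoint_supports s).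

Let level (i : 'I_(size s)) := tnth (in_tuple s) i.

Let integrable_level i :
  leb.-integrable setT (EFin \o (fun x => g (level i).1 * \1_((level i).2) x)).
Proof.
have [mA finA] := sadm (mem_tnth i (in_tuple s)).
by apply: integrableZl_EFin => //; exact: integrable_lebesgue_indic.
Qed.

Let comp_sf_evalE :
  (fun x => g (sf_eval s x)) =
    (fun x => \sum_i g (level i).1 * \1_((level i).2) x).
Proof. by apply/funext => x; rewrite comp_sf_eval// big_tnth. Qed.

Lemma integrable_comp_sf_eval :
  leb.-integrable setT (EFin \o (fun x => g (sf_eval s x))).
Proof. by rewrite comp_sf_evalE; apply: integrable_sum_EFin. Qed.

Lemma Rintegral_comp_sf_eval :
  \int[leb]_x g (sf_eval s x) = \sum_(c <- s) fine (leb c.2) * g c.1.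
Proof.
rewrite comp_sf_evalE Rintegral_sum// [RHS]big_tnth; apply: eq_bigr => i _.
have [mA finA] := sadm (mem_tnth i (in_tuple s)).
rewrite RintegralZl//; last exact: integrable_lebesgue_indic.
by rewrite mulrC /Rintegral integral_indic// setIT.
Qed.

End integral.

Lemma measurable_sf_eval s : simple_adm s -> measurable_fun setT (sf_eval s).
Proof.
elim: s => [_|c s IH /simple_adm_cons[[mc _] /IH ms]].
  by rewrite (_ : sf_eval [::] = cst 0)//; apply/funext => x;
    rewrite /sf_eval big_nil.
rewrite (funext (sf_eval_cons c s)); apply: measurable_funD => //.
by apply: measurable_funM => //; exact: measurable_indic.
Qed.

End disjoint_simple_functions.

Section characteristic_function_limits.
Context (R : realType) d (T : measurableType d) (P : probability T R).
Implicit Types (X Y : T -> R) (p th c : R).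

Lemma charfZ c X p : charf P (fun t => c * X t) p = charf P X (p * c).
Proof.
by rewrite /charf; congr Complex; apply: eq_Rintegral => t _; rewrite mulrA.
Qed.

Lemma ae_eq_charf X Y p : measurable_fun setT X -> measurable_fun setT Y ->
  {ae P, forall t, X t = Y t} -> charf P X p = charf P Y p.
Proof.
move=> mX mY XY; apply: wave_inj => th;
  rewrite !wave_charf// /Rintegral; congr fine.
have mcos (Z : T -> R) : measurable_fun setT Z ->
    measurable_fun setT (fun t => (cos (th + p * Z t))%:E).
  move=> mZ; apply/measurable_EFinP;
    apply: (measurableT_comp (@measurable_cos R setT)).
  by apply: measurable_funD => //; exact: measurable_funM.
apply: ae_eq_integral => //; [exact: mcos|exact: mcos|].
by apply: filterS XY => t -> _.
Qed.

Lemma lipschitz_derive (f f' : R -> R) K :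
  (forall x : R, is_derive x 1 f (f' x)) ->
  (forall x, `|f' x| <= K) -> forall x y, `|f x - f y| <= K * `|x - y|.
Proof.
move=> df f'K; have lt x y : x < y -> `|f x - f y| <= K * `|x - y|.
  move=> xy; have [|z _ f_xy] := @MVT _ f f' x y xy (fun z _ => df z).
    by apply: continuous_subspaceT; exact: is_derive_continuous df.
  by rewrite distrC f_xy normrM (distrC x) ler_wpM2r.
move=> x y; have [xy|xy|->] := ltgtP x y; first exact: lt.
  by rewrite distrC (distrC x); exact: lt.
by rewrite !subrr normr0 mulr0.
Qed.

Lemma expect_cvg_in_probability (h : R -> R) K (X_ : nat -> T -> R) X :
  (forall x, `|h x| <= 1) -> (forall x y, `|h x - h y| <= K * `|x - y|) ->
  measurable_fun setT h -> (forall n, measurable_fun setT (X_ n)) ->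
    measurable_fun setT X ->
  (forall e : R, 0 < e -> (fun n => P [set t | e < `|X_ n t - X t|]) @ \oo -->
    0%E) ->
  \int[P]_t h (X_ n t) @[n --> \oo] --> \int[P]_t h (X t).
Proof.
move=> h1 hK mh mX_ mX cvgP; have mhX Y : measurable_fun setT Y ->
  measurable_fun setT (fun t => h (Y t)) by exact: measurableT_comp.
have K0 : 0 <= K by have := hK 1 0; rewrite subr0 normr1 mulr1; exact: le_trans.
have K1 : 0 < K + 1 by rewrite ltr_wpDl.
apply/cvgrPdist_le => e e0; pose r := e / 2 / (K + 1).
have r0 : 0 < r by rewrite !divr_gt0.
have Kr0 : 0 <= K * r by exact: mulr_ge0 K0 (ltW r0).
have e4 : 0 < e / 4 by rewrite divr_gt0.
have /fine_cvgP[_ /cvgrPdist_le /(_ _ e4)] := cvgP r r0.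
apply: filterS => n; rewrite sub0r normrN;
  set A := [set t | r < `|X_ n t - X t|] => PA.
have mA : measurable A.
  have -> : A = setT `&` (fun t => `|X_ n t - X t|) @^-1` `]r, +oo[.
    by apply/seteqP; split => t /=; rewrite in_itv/= andbT; [|case].
  by apply: measurableT_comp => //; exact: measurable_funB.
have iA : P.-integrable setT (EFin \o (\1_A : T -> R)).
  apply: (@integrable_bounded _ _ _ P _ 1) => [|t];
    first exact: measurable_indic.
  by rewrite indicE normr_nat lern1 leq_b1.
have ir : P.-integrable setT (EFin \o cst (K * r)).
  by exact: finite_measure_integrable_cst.
have ihX Y : measurable_fun setT Y ->
  P.-integrable setT (EFin \o (fun t => h (Y t))).
  by move=> /mhX mhY; exact: (@integrable_bounded _ _ _ P _ 1).
rewrite -RintegralB ?ihX//.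
apply: (@le_trans _ _ (\int[P]_t (K * r + 2 * \1_A t))).
  apply: normr_Rintegral_le => //; first by apply: measurable_funB; exact: mhX.
  - move=> t _; rewrite indicE; case: (boolP (t \in A)) => tA.
      rewrite mulr1 (ler_wpDl Kr0)// (le_trans (ler_normB _ _))//.
      by rewrite [leRHS]mulr2n lerD.
    rewrite mulr0 addr0 (le_trans (hK _ _))// ler_wpM2l// distrC leNgt.
    by apply: contra tA => rX; rewrite inE.
  - by apply: integrableD_EFin => //; exact: integrableZl_EFin.
rewrite RintegralD//; last exact: integrableZl_EFin.
rewrite Rintegral_probability_cst RintegralZl//
  [X in 2 * X](_ : _ = fine (P A)); last first.
  by rewrite /Rintegral integral_indic// setIT.
have Kr : K * r <= e / 2.
  by rewrite /r mulrCA ler_piMr ?divr_ge0 ?ltW// ltr_pdivrMr// mul1r ltrDl.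
by have /= := le_trans (ler_norm _) PA; lra.
Qed.

Lemma cvg_charf_in_probability (X_ : nat -> T -> R) X p th :
  (forall n, measurable_fun setT (X_ n)) -> measurable_fun setT X ->
  (forall e : R, 0 < e -> (fun n => P [set t | e < `|X_ n t - X t|]) @ \oo -->
    0%E) ->
  wave (charf P (X_ n) p) th @[n --> \oo] --> wave (charf P X p) th.
Proof.
move=> mX_ mX cvgP; rewrite wave_charf//; under eq_cvg do rewrite wave_charf//.
apply: (@expect_cvg_in_probability (fun y => cos (th + p * y)) `|p|) => //.
- by move=> y; exact: cos_max.
- apply: (lipschitz_derive (fun y => is_derive_cos_affine p th y)) => y.
  by rewrite normrM ler_piMr// cos_max.
- exact: measurable_cos_affine.
Qed.

End characteristic_function_limits.

Section stable_random_measures.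
Context (R : realType) d (T : measurableType d) (P : probability T R).
Variables (delta rho : R) (M : set R -> T -> R).
Local Notation leb := (@lebesgue_measure R).
Hypothesis delta_gt0 : 0 < delta.
Hypothesis stableM : stable_random_measure P delta rho M.
Implicit Types (A B : set R) (s : seq (R * set R)) (p : R).

Let mM A : measurable A -> (leb A < +oo)%E -> measurable_fun setT (M A).
Proof. by case: stableM => mM _; exact: mM. Qed.

Lemma random_measure0 : {ae P, forall t, M set0 t = 0}.
Proof.
have [_ [addM _]] := stableM.
have tF : trivIset setT (fun _ : nat => set0 : set R).
  by apply/trivIsetP => i j _ _ _; rewrite set0I.
have := addM _ (fun=> measurable0) tF.
rewrite bigcup0// measure0 => /(_ (ltry _)); apply: filterS => t.
under eq_fun do rewrite sumr_const card_ord; set m := M set0 t => m_cvg.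
have : m *+ N.+1 - m *+ N @[N --> \oo] --> m - m.
  by apply: cvgB => //; rewrite (cvg_shiftS (fun N => m *+ N)).
under eq_fun do rewrite mulrS addrK; rewrite subrr => m_cvg0.
by move/(cvg_lim (@Rhausdorff R)) : m_cvg0; rewrite (lim_cst (@Rhausdorff R)).
Qed.

Lemma random_measureU A B : measurable A -> measurable B ->
  (leb A < +oo)%E -> (leb B < +oo)%E -> A `&` B = set0 ->
  {ae P, forall t, M (A `|` B) t = M A t + M B t}.
Proof.
move=> mA mB finA finB AB0; have [_ [addM _]] := stableM.
have mF n : measurable (bigcup2 A B n) by case: n => [|[|n]];
  rewrite /bigcup2/=.
have tF : trivIset setT (bigcup2 A B).
  apply/trivIsetP => -[|[|i]] [|[|j]] _ _ //= _;
    rewrite /bigcup2 ?set0I ?setI0//.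
  by rewrite setIC.
have := addM _ mF tF; rewrite bigcup2E => /(_ _)/wrap[].
  apply: (@le_lt_trans _ _ (leb A + leb B)%E); first exact: measureU2.
  exact: lte_add_pinfty.
move=> sumM; apply: filterS2 sumM random_measure0 => t sumM M0.
apply/esym/(cvg_unique _ _ sumM) => //.
apply: cvg_near_cst; exists 2%N => // -[|[|N]]//= _.
by rewrite !big_ord_recl /= big1 ?addr0.
Qed.

Lemma random_measureUID A B : measurable A -> measurable B -> (leb A < +oo)%E ->
  {ae P, forall t, M A t = M (A `&` B) t + M (A `\` B) t}.
Proof.
move=> mA mB finA; rewrite -[in X in {ae P, forall t, M X t = _}](setUIDK A B).
have mI := measurableI _ _ mA mB; have mD := measurableD mA mB.
apply: random_measureU => //.
- by apply: lebesgue_measure_finS finA => //; exact: subIsetl.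
- by apply: lebesgue_measure_finS finA => //; exact: subDsetl.
- by apply/seteqP; split => // x [[_ ?]] [].
Qed.

Lemma sf_int_cons c s t : sf_int M (c :: s) t = c.1 * M c.2 t + sf_int M s t.
Proof. by rewrite /sf_int big_cons. Qed.

Lemma measurable_sf_int s : simple_adm s -> measurable_fun setT (sf_int M s).
Proof.
elim: s => [_|c s IH /simple_adm_cons[[mc finc] /IH ms]].
  by rewrite (_ : sf_int M [::] = cst 0)//; apply/funext => t;
    rewrite /sf_int big_nil.
rewrite (funext (sf_int_cons c s)); apply: measurable_funD => //.
by apply: measurable_funM => //; exact: mM.
Qed.

Lemma sf_int_refine a A s : measurable A -> (leb A < +oo)%E -> simple_adm s ->
  {ae P, forall t, sf_int M (refine_simple a A s) t = a * M A t + sf_int M s t}.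
Proof.
elim: s a A => [|c s IH] a A mA finA.
  by move=> _; apply: aeW => t; rewrite /= sf_int_cons.
move=> /simple_adm_cons[[mc finc] sadm] /=.
have finD : (leb (A `\` c.2) < +oo)%E.
  by apply: lebesgue_measure_finS finA => //; exact: measurableD.
have := IH a _ (measurableD mA mc) finD sadm.
apply: filterS3 (random_measureUID mc mA finc) (random_measureUID mA mc finA) =>
  t Mc MA.
by rewrite !sf_int_cons /= Mc MA (setIC A) => ->; ring.
Qed.

Lemma sf_int_disjointify s : simple_adm s ->
  {ae P, forall t, sf_int M (disjointify s) t = sf_int M s t}.
Proof.
elim: s => [_|c s IH]; first exact: aeW.
move=> /simple_adm_cons[[mc finc] sadm] /=.
apply: filterS2 (sf_int_refine c.1 mc finc (simple_adm_disjointify sadm))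
  (IH sadm) => t -> ->.
by rewrite sf_int_cons.
Qed.

Lemma charf_random_measure A p : measurable A -> (leb A < +oo)%E ->
  charf P (M A) p = expC (- ((fine (leb A))%:C%C * psi delta rho p)).
Proof.
move=> mA finA; have [_ [_ [_ charM]]] := stableM.
have [cosM sinM] := charM A mA finA p.
rewrite /charf -[\int[P]_t cos _]/(expect P _)
  -[\int[P]_t sin _]/(expect P _) cosM sinM.
by rewrite /expC /psi /= !mul0r subr0 addr0 cosN sinN !mulrN.
Qed.

Definition stable_exponent (f : R -> R) p : R[i] :=
  Complex (\int[leb]_x psiRe delta (p * f x))
    (\int[leb]_x psiIm delta rho (p * f x)).

Let pos_homogeneous_psiReM p :
  pos_homogeneous delta (fun x => psiRe delta (p * x)).
Proof. exact/pos_homogeneousM/pos_homogeneous_psiRe. Qed.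

Let pos_homogeneous_psiImM p :
  pos_homogeneous delta (fun x => psiIm delta rho (p * x)).
Proof. exact/pos_homogeneousM/pos_homogeneous_psiIm. Qed.

Lemma stable_exponent_sf_eval s p : simple_adm s -> disjoint_supports s ->
  stable_exponent (sf_eval s) p =
  \sum_(c <- s) (fine (leb c.2))%:C%C * psi delta rho (p * c.1).
Proof.
move=> sadm sdisj; apply: wave_inj => th; rewrite wave_sum.
under eq_bigr do rewrite waveZ.
rewrite /stable_exponent (Rintegral_comp_sf_eval
  (pos_homogeneous0 delta_gt0 (pos_homogeneous_psiReM p)))//.
rewrite (Rintegral_comp_sf_eval (pos_homogeneous0 delta_gt0
  (pos_homogeneous_psiImM p)))//.
rewrite /wave /= !mulr_suml -sumrB; apply: eq_bigr => c _; ring.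
Qed.

Lemma charf_sf_int_disjoint s p : simple_adm s -> disjoint_supports s ->
  charf P (sf_int M s) p = expC (- stable_exponent (sf_eval s) p).
Proof.
move=> sadm sdisj; have [_ [_ [indM _]]] := stableM.
pose c (i : 'I_(size s)) := tnth (in_tuple s) i.
have cadm i : measurable (c i).2 /\ (leb (c i).2 < +oo)%E by apply: sadm;
  exact: mem_tnth.
have tc : trivIset setT (fun i => (c i).2).
  apply/trivIsetP => i j _ _ ij; have x0 : R * set R := (0, set0).
  have disj (i' j' : 'I_(size s)) : (i' < j')%N -> (c i').2 `&` (c j').2 = set0.
    move=> ltij; have /(pairwiseP x0) sdisj' := sdisj.
    have /asboolP := sdisj' i' j' (ltn_ord i') (ltn_ord j') ltij.
    by rewrite /c !(tnth_nth x0).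
  have [ltij|ltji|/ord_inj eqij] := ltngtP i j;
    [exact: disj|by rewrite setIC; exact: disj|].
  by rewrite eqij eqxx in ij.
have mMc i : measurable_fun setT (M (c i).2).
  by have [mA finA] := cadm i; exact: mM.
have indMc := mutually_indep_comp (indM _ _ cadm tc)
  (f := fun i x => (c i).1 * x)
  (fun i => measurable_funM (measurable_cst _) (@measurable_id _ _ setT)).
have -> : sf_int M s = fun t => \sum_i ((fun x => (c i).1 * x) \o M (c i).2) t.
  by apply/funext => t; rewrite /sf_int big_tnth.
rewrite charf_sum//; last by move=> i; exact: measurable_funM.
rewrite stable_exponent_sf_eval// [X in expC (- X)]big_tnth -sumrN.
have expC_sum : {morph @expC R : z w / z + w >-> z * w} by exact: expCD.
rewrite (big_morph _ expC_sum (expC0 R)); apply: eq_bigr => i _.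
by have [mA finA] := cadm i; rewrite charfZ charf_random_measure.
Qed.

Lemma charf_sf_int s p : simple_adm s ->
  charf P (sf_int M s) p = expC (- stable_exponent (sf_eval s) p).
Proof.
move=> sadm; have sadm' := simple_adm_disjointify sadm.
rewrite -sf_eval_disjointify -charf_sf_int_disjoint//;
  last exact: disjoint_supports_disjointify.
apply: ae_eq_charf; [exact: measurable_sf_int|exact: measurable_sf_int|].
by apply: filterS (sf_int_disjointify sadm) => t ->.
Qed.

Section stochastic_integral.
Variables (f : R -> R) (Z : T -> R).
Hypotheses (mf : measurable_fun setT f) (intZ : stoch_int P M delta f Z).

Let power_integrable_sf_eval s : simple_adm s ->
  leb.-integrable setT (EFin \o (fun x => `|sf_eval s x| `^ delta)).
Proof.
move=> sadm; rewrite -sf_eval_disjointify.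
apply: (@integrable_comp_sf_eval _ (fun x => `|x| `^ delta)).
- by rewrite normr0 powR0// gt_eqF.
- exact: simple_adm_disjointify.
- exact: disjoint_supports_disjointify.
Qed.

Lemma power_integrable_stoch_int :
  leb.-integrable setT (EFin \o (fun x => `|f x| `^ delta)).
Proof.
have [_ [s [sadm [/fine_cvgP[[n _ fin_s] _] _]]]] := intZ.
have ms := measurable_sf_eval (sadm n).
apply: (@power_integrableD _ _ delta_gt0 _ _ leb _ _ ms mf);
  first exact: power_integrable_sf_eval.
apply: fin_num_power_integrable => //; first exact: measurable_funB.
exact: fin_s n (leqnn n).
Qed.

Lemma charf_stoch_int p : charf P Z p = expC (- stable_exponent f p).
Proof.
have [mZ [s [sadm [Lcvg Pcvg]]]] := intZ.
have cvg_hom g : pos_homogeneous delta g ->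
    \int[leb]_x g (sf_eval (s n) x) @[n --> \oo] --> \int[leb]_x g (f x).
  move=> hg.
  apply: (@cvg_Rintegral_pos_homogeneous _ _ delta_gt0 _ _ leb _ _ _ hg)
    => //.
  - by move=> n; exact: measurable_sf_eval.
  - by move=> n; exact: power_integrable_sf_eval.
  - exact: power_integrable_stoch_int.
apply: wave_inj => th.
have mint n : measurable_fun setT (sf_int M (s n)) by exact: measurable_sf_int.
have Zcvg : wave (charf P (sf_int M (s n)) p) th @[n --> \oo] -->
  wave (charf P Z p) th.
  exact: cvg_charf_in_probability.
apply: (cvg_unique _ Zcvg) => //=.
under eq_cvg do rewrite charf_sf_int// wave_expC; rewrite wave_expC.
apply: cvgM.
  apply: (cvg_comp _ expR); last exact: continuous_expR.
  by apply: cvgN; exact: (cvg_hom _ (pos_homogeneous_psiReM p)).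
apply: (cvg_comp _ cos); last exact: continuous_cos.
apply: cvgD; first exact: cvg_cst.
by apply: cvgN; exact: (cvg_hom _ (pos_homogeneous_psiImM p)).
Qed.

End stochastic_integral.

End stable_random_measures.

Section power_integral.
Variable R : realType.
Local Notation leb := (@lebesgue_measure R).
Implicit Types (b c x : R).

Lemma Rintegral_powR_itv b c : b != 0 -> 0 < c < 1 ->
  \int[leb]_(y in `[c, 1]) y `^ (b - 1) = (1 - c `^ b) / b.
Proof.
move=> b0 /andP[c0 c1].
have dF x : 0 < x -> is_derive x 1 (fun y : R => b^-1 * y `^ b) (x `^ (b - 1)).
  move=> x0; have := is_derive_mull b^-1 (is_derive1_powR b x0).
  by rewrite mulrA mulVf// mul1r.
have powR_cont r x : 0 < x -> {for x, continuous (fun y : R => y `^ r)}.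
  move=> x0; have [dx _] := is_derive1_powR r x0.
  by apply: differentiable_continuous; exact/derivable1_diffP.
have cF x : 0 < x -> {for x, continuous (fun y : R => b^-1 * y `^ b)}.
  by move=> x0; apply: cvgMr; exact: powR_cont.
rewrite /Rintegral (@continuous_FTC2 _ _ (fun y => b^-1 * y `^ b))//=.
- by rewrite powR1; field.
- apply: continuous_in_subspaceT => x; rewrite inE/= in_itv/= => /andP[cx _].
  by apply: powR_cont; exact: lt_le_trans cx.
- split.
  + move=> x; rewrite in_itv/= => /andP[cx _].
    by have [] := dF x (lt_trans c0 cx).
  + by apply: cvg_at_right_filter; exact: cF.
  + by apply: cvg_at_left_filter; exact: cF.
- move=> x; rewrite in_itv/= => /andP[cx _]; rewrite derive1E.
  exact: (@derive_val _ _ _ _ _ _ _ (dF x (lt_trans c0 cx))).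
Qed.

Lemma Rintegral_powR_unit b : 0 < b ->
  leb.-integrable `]0, 1] (EFin \o (fun y => y `^ (b - 1))) ->
  \int[leb]_(y in `]0, 1]) y `^ (b - 1) = b^-1.
Proof.
move=> b0 intb; pose c n : R := n.+2%:R^-1.
have c0 n : 0 < c n by rewrite invr_gt0.
have c1 n : c n < 1 by rewrite /c invf_lt1 ?ltr1n ?ltr0n.
have c_cvg0 : c n @[n --> \oo] --> 0.
  by rewrite (cvg_shiftS (fun n : nat => n.+1%:R^-1 : R)); exact: cvg_harmonic.
have cb_cvg0 : c n `^ b @[n --> \oo] --> 0.
  have : `|c n| `^ b @[n --> \oo] --> `|0 : R| `^ b.
    by apply: (cvg_comp c (fun x : R => `|x| `^ b) c_cvg0);
      exact: continuous_normr_powR.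
  by rewrite normr0 powR0 ?gt_eqF//; under eq_fun do rewrite gtr0_norm//.
have int_cvg : (1 - c n `^ b) / b @[n --> \oo] --> b^-1.
  rewrite -[X in _ --> X]mul1r; apply: cvgMl; rewrite -[X in _ --> X]subr0.
  by apply: cvgB cb_cvg0; exact: cvg_cst.
have := @Rintegral_exhaustion R `]0, 1] (fun n => `[c n, 1]%classic)
  (fun y => y `^ (b - 1)).
move=> /(_ _ _ _ _ intb) /cvg_unique; apply=> //.
- by move=> n x /=; rewrite !in_itv/= => /andP[cx ->];
    rewrite andbT (lt_le_trans _ cx).
- move=> x /=; rewrite in_itv/= => /andP[x0 x1].
  have /cvgrPdist_lt /(_ _ x0) := c_cvg0; apply: filterS => n.
  by rewrite sub0r normrN gtr0_norm// in_itv/= x1 andbT => /ltW.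
- by rewrite /=; under eq_cvg do rewrite Rintegral_powR_itv ?gt_eqF ?c0 ?c1//.
Qed.

End power_integral.

Section lfsm_kernel.
Variables (R : realType) (delta H : R).
Local Notation leb := (@lebesgue_measure R).
Local Notation a := (H - delta^-1).
Local Notation f := (lfsm_kernel delta H).
Hypotheses (delta_gt0 : 0 < delta) (H_gt0 : 0 < H).
Implicit Types (t x r c : R).

Lemma measurable_pospow r : measurable_fun setT (fun x : R => pospow x r).
Proof.
apply: measurable_fun_ifT; [|exact: measurable_powR|exact: measurable_cst].
exact: measurable_fun_ltr.
Qed.

Lemma measurable_lfsm_kernel t : measurable_fun setT (f t).
Proof.
apply: measurable_funB; last exact: (measurableT_comp (measurable_pospow _)).
by apply: (measurableT_comp (measurable_pospow _)); exact: measurable_funB.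
Qed.

Lemma pospowM r c x : 0 < c -> pospow (c * x) r = c `^ r * pospow x r.
Proof.
move=> c0; rewrite /pospow pmulr_rgt0//; case: ifPn => x0;
  last by rewrite mulr0.
by rewrite powRM ?ltW.
Qed.

Lemma lfsm_kernel_scale t x : 0 < t -> f t x = t `^ a * f 1 (t^-1 * x).
Proof.
move=> t0; rewrite /lfsm_kernel mulrBr -!pospowM//.
by rewrite mulrBr mulr1 mulrN mulVKf ?gt_eqF.
Qed.

Lemma lfsm_kernel0 x : f 0 x = 0.
Proof. by rewrite /lfsm_kernel sub0r subrr. Qed.

Section pos_homogeneous_function.
Variable g : R -> R.
Hypothesis hg : pos_homogeneous delta g.
Hypothesis intg : leb.-integrable setT (EFin \o (g \o f 1)).

Lemma Rintegral_lfsm_kernel t : 0 < t ->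
  \int[leb]_x g (f t x) = t `^ (delta * H) * \int[leb]_x g (f 1 x).
Proof.
move=> t0; rewrite -(Rintegral_dilation _ t0 intg); apply: eq_Rintegral => x _.
rewrite lfsm_kernel_scale// hg ?powR_ge0// -powRrM; congr (_ `^ _ * _).
by field; rewrite gt_eqF.
Qed.

Lemma lfsm_kernel1N x : 0 < x -> f 1 (- x) = (1 + x) `^ a - x `^ a.
Proof. by move=> x0; rewrite /lfsm_kernel /pospow !opprK addr_gt0// x0. Qed.

Let unit_powR y := (fun y => g 1 * y `^ (delta * H - 1)) \_ `]0, 1] y.

Let lfsm_kernel1_unit_powR :
  (fun x => g (f 1 x)) \_ `[0, +oo[ = (fun x => unit_powR (-1 * x + 1)).
Proof.
apply/funext => x; rewrite /unit_powR !patchE !mem_setE !in_itv/= andbT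
  mulN1r addrC.
rewrite subr_gt0 lerBlDr lerDl; have [x0|x0] := leP 0 x; last by rewrite andbF.
rewrite andbT /lfsm_kernel /pospow oppr_gt0 (ltNge x 0) x0/= subr0 subr_gt0.
case: ifPn => x1; last by rewrite (pos_homogeneous0 delta_gt0 hg).
rewrite (pos_homogeneous_ge0 hg) ?powR_ge0// ger0_norm ?powR_ge0// -powRrM.
by congr (_ * _ `^ _); field; rewrite gt_eqF.
Qed.

(* On [[0, 1]] the kernel is [(1 - x) `^ a]: hence the explicit term. *)
Lemma Rintegral_lfsm_kernel1 : \int[leb]_x g (f 1 x) =
  \int[leb]_(x in `]0, +oo[) g ((1 + x) `^ a - x `^ a) + g 1 / (delta * H).
Proof.
have intgN := integrable_oppr intg; have dH : 0 < delta * H by exact: mulr_gt0.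
have intgS (h : R -> R) (D : set R) : measurable D ->
    leb.-integrable setT (EFin \o h) -> leb.-integrable D (EFin \o h).
  by move=> mD; exact: integrableS.
rewrite Rintegral_fold// RintegralD//; [|exact: intgS..].
rewrite addrC; congr (_ + _).
  rewrite -Rintegral_itv_obnd_cbnd; last exact: intgS.
  by apply: eq_Rintegral => x; rewrite inE/= in_itv/= andbT =>
    /lfsm_kernel1N ->.
have n1 : (-1 : R) != 0 by rewrite oppr_eq0 oner_eq0.
have int_unit' :
  leb.-integrable setT (EFin \o (fun x => unit_powR (-1 * x + 1))).
  rewrite -lfsm_kernel1_unit_powR -restrict_EFin.
  by apply/(integrable_mkcond _ _).1 => //; exact: intgS.
have int_unit : leb.-integrable setT (EFin \o unit_powR).
  have := integrable_affine 1 n1 int_unit'.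
  by congr (integrable _ _ (_ \o _)); apply/funext => x; congr unit_powR; ring.
rewrite Rintegral_mkcond lfsm_kernel1_unit_powR
  Rintegral_affine// normrN1 invr1 mul1r.
rewrite /unit_powR -Rintegral_mkcond.
have [g10|g10] := eqVneq (g 1) 0.
  under eq_Rintegral do rewrite g10 mul0r.
  by rewrite /Rintegral integral0 g10 mul0r.
have int_powR : leb.-integrable `]0, 1]
  (EFin \o (fun y => y `^ (delta * H - 1))).
  have : leb.-integrable `]0, 1]
    (EFin \o (fun y => (g 1)^-1 * (g 1 * y `^ (delta * H - 1)))).
    apply: integrableZl_EFin => //; apply/(integrable_mkcond _ _).2 => //.
    by rewrite restrict_EFin.
  by apply: eq_integrable => // y _ /=; rewrite mulKf.
by rewrite RintegralZl// Rintegral_powR_unit.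
Qed.

End pos_homogeneous_function.

End lfsm_kernel.

Section degenerate_variable.
Context (R : realType) d (T : measurableType d) (P : probability T R).
Implicit Types (z : R) (X : T -> R).

Lemma cos_div_nat_eq1 z : (forall n : nat, cos (n.+1%:R^-1 * z) = 1) -> z = 0.
Proof.
move=> cos1; apply/eqP; apply: contraT; rewrite -normr_gt0 => z0.
pose n := Num.truncn (`|z| / pi).
have zn : `|z| / pi < n.+1%:R by exact: truncnS_gt.
have y0 : 0 < n.+1%:R^-1 * `|z| by rewrite mulr_gt0// invr_gt0 ltr0n.
have ypi : n.+1%:R^-1 * `|z| <= pi.
  by rewrite mulrC ler_pdivrMr ?ltr0n// mulrC -ler_pdivrMr ?pi_gt0// ltW.
have : cos (n.+1%:R^-1 * `|z|) = cos 0.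
  rewrite cos0 -[RHS](cos1 n); have [|] := ger0P z => // _.
  by rewrite mulrN cosN.
move=> /cos_inj; rewrite !in_itv/= lexx pi_ge0 (ltW y0) ypi =>
  /(_ isT isT) y_eq0.
by rewrite y_eq0 ltxx in y0.
Qed.

Lemma ae_eq0_charf X : measurable_fun setT X -> (forall p, charf P X p = 1) ->
  {ae P, forall t, X t = 0}.
Proof.
move=> mX charf1; pose g (n : nat) t : R := 1 - cos (n.+1%:R^-1 * X t).
have mcos n : measurable_fun setT (fun t => cos (n.+1%:R^-1 * X t)).
  by apply: (measurableT_comp (@measurable_cos R setT)); exact: measurable_funM.
have mg n : measurable_fun setT (g n) by exact: measurable_funB.
have g0 n t : 0 <= g n t by rewrite subr_ge0 (le_trans (ler_norm _))// cos_max.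
have g2 n t : `|g n t| <= 2.
  by rewrite (le_trans (ler_normB _ _))// normr1 [leRHS]mulr2n lerD2l cos_max.
have Eg0 n : \int[P]_t g n t = 0.
  rewrite RintegralB//; last 2 first.
  - exact: finite_measure_integrable_cst.
  - by apply: (@integrable_bounded _ _ _ P _ 1) => // t; exact: cos_max.
  have [cosE _] := charf1 n.+1%:R^-1.
  by rewrite Rintegral_probability_cst cosE subrr.
have g_ae0 n : {ae P, forall t, g n t = 0}.
  have : ae_eq P setT (EFin \o g n) (cst 0%E).
    apply/ae_eq_integral_abs => //; first exact/measurable_EFinP.
    under eq_integral do rewrite /= ger0_norm//.
    rewrite -[LHS]fineK; first by rewrite -/(Rintegral P setT (g n)) Eg0.
    by rewrite integrable_fin_num//; exact: (@integrable_bounded _ _ _ P _ 2).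
  by apply: filterS => t /(_ I)[].
have := ae_foralln g_ae0; apply: filterS => t gt0.
by apply: cos_div_nat_eq1 => n; apply/esym/eqP; rewrite -subr_eq0;
  apply/eqP; exact: gt0.
Qed.

End degenerate_variable.

Section linear_fractional_stable_motion.
Context (R : realType) d (T : measurableType d) (P : probability T R).
Variables (delta rho H : R) (M : set R -> T -> R) (Y : R -> T -> R).
Local Notation leb := (@lebesgue_measure R).
Local Notation f := (lfsm_kernel delta H).
Local Notation K := (KdH delta H).
Hypotheses (delta_gt0 : 0 < delta) (H_gt0 : 0 < H).
Hypothesis stableM : stable_random_measure P delta rho M.
Hypothesis lfsmY : is_lfsm P M delta H Y.
Implicit Types (t p : R).

Lemma power_integrable_lfsm_kernel :
  leb.-integrable setT (EFin \o (fun x => `|f 1 x| `^ delta)).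
Proof.
have mf := @measurable_lfsm_kernel R delta H 1.
exact: (power_integrable_stoch_int delta_gt0 mf (lfsmY ler01)).
Qed.

Let integrable_lfsm_kernel g : pos_homogeneous delta g ->
  leb.-integrable setT (EFin \o (g \o f 1)).
Proof.
move=> hg; apply: (@integrable_pos_homogeneous _ _ delta_gt0 _ _ leb) => //.
  exact: measurable_lfsm_kernel.
exact: power_integrable_lfsm_kernel.
Qed.

Let KdH_base_gt0 : 0 < \int[leb]_(x in `]0, +oo[)
  `|(1 + x) `^ (H - delta^-1) - x `^ (H - delta^-1)| `^ delta + (delta * H)^-1.
Proof.
apply: ltr_wpDl; last by rewrite invr_gt0 mulr_gt0.
by apply: Rintegral_ge0 => x _; exact: powR_ge0.
Qed.

Lemma KdH_gt0 : 0 < K. Proof. by apply: powR_gt0; exact: KdH_base_gt0. Qed.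

Lemma KdH_powRE : K `^ delta = \int[leb]_x `|f 1 x| `^ delta.
Proof.
rewrite (Rintegral_lfsm_kernel1 delta_gt0 H_gt0
  (@pos_homogeneous_normr_powR R delta)).
  rewrite normr1 powR1 mul1r /KdH -powRrM mulVf ?gt_eqF// powRr1//.
  exact/ltW/KdH_base_gt0.
exact/integrable_lfsm_kernel/pos_homogeneous_normr_powR.
Qed.

Definition lfsm_skewness : R :=
  (\int[leb]_x signed_powR delta (f 1 x)) / K `^ delta.

Lemma stable_exponent_lfsm_kernel t p :
  0 < t -> stable_exponent delta rho (f t) p =
  (t `^ (delta * H) * K `^ delta)%:C%C * psi delta (rho * lfsm_skewness) p.
Proof.
move=> t0; have K0 : K `^ delta != 0 by rewrite gt_eqF// powR_gt0// KdH_gt0.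
have hRe := @pos_homogeneous_normr_powR R delta.
have hIm := pos_homogeneous_signed_powR delta_gt0.
have ReE : \int[leb]_x psiRe delta (p * f t x) =
    t `^ (delta * H) * K `^ delta * psiRe delta p.
  rewrite (@Rintegral_lfsm_kernel _ _ _ delta_gt0
    (fun x => psiRe delta (p * x)))//; last 2 first.
  - exact/pos_homogeneousM/pos_homogeneous_psiRe.
  - exact/integrable_lfsm_kernel/pos_homogeneousM/pos_homogeneous_psiRe.
  under eq_Rintegral do rewrite /psiRe normrM powRM//.
  rewrite RintegralZl//; last exact: integrable_lfsm_kernel hRe.
  by rewrite -KdH_powRE mulrAC mulrA.
have ImE : \int[leb]_x psiIm delta rho (p * f t x) =
    t `^ (delta * H) * K `^ delta * psiIm delta (rho * lfsm_skewness) p.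
  rewrite (@Rintegral_lfsm_kernel _ _ _ delta_gt0
    (fun x => psiIm delta rho (p * x)))//; last 2 first.
  - exact/pos_homogeneousM/pos_homogeneous_psiIm.
  - exact/integrable_lfsm_kernel/pos_homogeneousM/pos_homogeneous_psiIm.
  under eq_Rintegral do rewrite psiImE signed_powRM mulrA.
  rewrite RintegralZl//; last exact: integrable_lfsm_kernel hIm.
  by rewrite psiImE /lfsm_skewness; field.
rewrite /stable_exponent ReE ImE; apply/eqP.
by rewrite eq_complex/= !mul0r subr0 addr0 !eqxx.
Qed.

Lemma lfsm_skewness_eq1 : delta^-1 <= H -> lfsm_skewness = 1.
Proof.
move=> deltaH.
have Kdelta : K `^ delta != 0 by rewrite gt_eqF// powR_gt0// KdH_gt0.
rewrite /lfsm_skewness [X in X / _](_ : _ = K `^ delta) ?divff// KdH_powRE.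
apply: eq_Rintegral => x _; apply: signed_powR_ge0 => //.
rewrite /lfsm_kernel /pospow subr_ge0 subr_gt0 oppr_gt0.
case: (ltP x 0) => x0; last by case: ifPn => // _; exact: powR_ge0.
by rewrite (lt_trans x0)// ge0_ler_powR ?nnegrE ?subr_ge0 ?oppr_ge0
  ?(ltW x0) ?lerDr//;
  rewrite (le_trans (ltW x0)).
Qed.

Lemma lfsm_skewness_le : H <= delta^-1 ->
  let I := \int[leb]_(x in `]0, +oo[)
    (x `^ (H - delta^-1) - (1 + x) `^ (H - delta^-1)) `^ delta in
  lfsm_skewness = ((delta * H)^-1 - I) / ((delta * H)^-1 + I).
Proof.
move=> Hdelta I; have hIm := pos_homogeneous_signed_powR delta_gt0.
have hRe := @pos_homogeneous_normr_powR R delta.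
have powR_le x : 0 < x -> (1 + x) `^ (H - delta^-1) <= x `^ (H - delta^-1).
  move=> x0; rewrite /powR !gt_eqF ?addr_gt0// ler_expR ler_wnM2l ?subr_le0//.
  by rewrite ler_ln ?posrE ?addr_gt0// lerDr.
have normE x : 0 < x -> `|(1 + x) `^ (H - delta^-1) - x `^ (H - delta^-1)| =
    x `^ (H - delta^-1) - (1 + x) `^ (H - delta^-1).
  by move=> x0; rewrite ler0_norm ?subr_le0 ?powR_le// opprB.
rewrite /lfsm_skewness KdH_powRE.
rewrite (Rintegral_lfsm_kernel1 delta_gt0 H_gt0 hRe
  (integrable_lfsm_kernel hRe)).
rewrite (Rintegral_lfsm_kernel1 delta_gt0 H_gt0 hIm
  (integrable_lfsm_kernel hIm)).
rewrite normr1 powR1 (signed_powR_ge0 delta_gt0 ler01) normr1 powR1 mul1r.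
have -> : \int[leb]_(x in `]0, +oo[)
    `|(1 + x) `^ (H - delta^-1) - x `^ (H - delta^-1)| `^ delta = I.
  by apply: eq_Rintegral => x; rewrite inE/= in_itv/= andbT => /normE ->.
have -> : \int[leb]_(x in `]0, +oo[)
    signed_powR delta ((1 + x) `^ (H - delta^-1) - x `^ (H - delta^-1)) = - I.
  have intI : leb.-integrable `]0, +oo[ (EFin \o (fun x =>
      (x `^ (H - delta^-1) - (1 + x) `^ (H - delta^-1)) `^ delta)).
    have intN : leb.-integrable `]0, +oo[
      (EFin \o (fun x => `|f 1 (- x)| `^ delta)).
      by apply: integrableS (integrable_oppr power_integrable_lfsm_kernel).
    apply: eq_integrable intN => // x; rewrite inE/= in_itv/= andbT => x0.
    by rewrite lfsm_kernel1N// normE.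
  transitivity (\int[leb]_(x in `]0, +oo[)
      (-1 * (x `^ (H - delta^-1) - (1 + x) `^ (H - delta^-1)) `^ delta)).
    apply: eq_Rintegral => x; rewrite inE/= in_itv/= andbT => x0.
    by rewrite signed_powR_le0 ?subr_le0 ?powR_le// normE// mulN1r.
  by rewrite RintegralZl// mulN1r.
by rewrite addrC (addrC I).
Qed.

Lemma measurable_lfsm t : 0 <= t -> measurable_fun setT (Y t).
Proof.
move=> t0; have [mKY _] := lfsmY t0.
rewrite (_ : Y t = (fun w => K^-1 * (K * Y t w))); first exact: measurable_funM.
by apply/funext => w; rewrite mulKf// gt_eqF// KdH_gt0.
Qed.

Lemma charf_lfsm t p : 0 < t -> charf P (Y t) p =
  expC (- ((t `^ (delta * H))%:C%C * psi delta (rho * lfsm_skewness) p)).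
Proof.
move=> t0; have K0 := KdH_gt0.
have -> : charf P (Y t) p = charf P (fun w => K * Y t w) (p / K).
  by rewrite charfZ divfK// gt_eqF.
have mf := @measurable_lfsm_kernel R delta H t.
rewrite (charf_stoch_int delta_gt0 stableM mf (lfsmY (ltW t0)))
  stable_exponent_lfsm_kernel//.
rewrite (mulrC p) psi_homogeneous ?invr_ge0 ?(ltW K0)//; congr (expC (- _)).
rewrite mulrA -rmorphM -mulrA -powRM ?invr_ge0 ?(ltW K0)// mulfV ?gt_eqF//.
by rewrite powR1 mulr1.
Qed.

Lemma lfsm_eq0 : {ae P, forall w, Y 0 w = 0}.
Proof.
have mf := @measurable_lfsm_kernel R delta H 0.
have : {ae P, forall w, K * Y 0 w = 0}.
  apply: ae_eq0_charf; first by have [] := lfsmY (lexx 0).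
  move=> p; rewrite (charf_stoch_int delta_gt0 stableM mf (lfsmY (lexx 0))).
  rewrite (_ : stable_exponent _ _ _ _ = 0) ?oppr0 ?expC0//.
  rewrite /stable_exponent; under eq_Rintegral do rewrite lfsm_kernel0 mulr0.
  under [X in Complex _ X]eq_Rintegral do rewrite lfsm_kernel0 mulr0.
  rewrite (pos_homogeneous0 delta_gt0 (@pos_homogeneous_psiRe R delta)).
  rewrite (pos_homogeneous0 delta_gt0 (pos_homogeneous_psiIm rho delta_gt0)).
  by rewrite /Rintegral integral0.
apply: filterS => w /eqP; rewrite mulf_eq0 (gt_eqF KdH_gt0)/=.
by move=> /eqP.
Qed.

End linear_fractional_stable_motion.

Lemma lfsm_skewness_rho0 (R : realType) d (T : measurableType d)
  (P : probability T R)
    (delta rho beta : R) (M : set R -> T -> R) (Y : R -> T -> R) :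
  0 < delta -> 0 < beta -> beta != 1 -> is_lfsm P M delta (beta / delta) Y ->
  rho * lfsm_skewness delta (beta / delta) = rho0 delta beta rho.
Proof.
move=> delta0 beta0; have H0 : 0 < beta / delta by rewrite divr_gt0.
rewrite /rho0 neq_lt => /orP[beta1|beta1] lfsmY; last first.
  rewrite beta1 (lfsm_skewness_eq1 delta0 H0 lfsmY) ?mulr1//.
  by rewrite ler_pdivlMr// mulVf ?gt_eqF// ltW.
rewrite ltNge (ltW beta1) /= (lfsm_skewness_le delta0 H0 lfsmY); last first.
  by rewrite ler_pdivrMr// mulVf ?gt_eqF// ltW.
have -> : delta * (beta / delta) = beta by rewrite mulrC divfK// gt_eqF.
by have -> : beta / delta - delta^-1 =
  (beta - 1) / delta by rewrite mulrBl mul1r.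
Qed.

Section exponential_taylor.
Variable R : realType.
Implicit Types (f g : R -> R) (q : nat -> R) (z w : R[i])
  (x a th y : R) (n N : nat).

Lemma normr_le_derive f f' g g' :
  (forall x : R, is_derive x 1 f (f' x)) ->
    (forall x : R, is_derive x 1 g (g' x)) ->
  (forall x, 0 <= x -> `|f' x| <= g' x) -> f 0 = 0 -> g 0 = 0 ->
  forall x, 0 <= x -> `|f x| <= g x.
Proof.
move=> df dg f'g' f0 g0 x; rewrite le_eqVlt => /predU1P[<-|x0].
  by rewrite f0 g0 normr0.
have ge0 (h h' : R -> R) : (forall x : R, is_derive x 1 h (h' x)) -> h 0 = 0 ->
    (forall x, 0 <= x -> 0 <= h' x) -> 0 <= h x.
  move=> dh h0 h'0; have [|y yx hE] := @MVT _ h h' 0 x x0 (fun y _ => dh y).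
    by apply: continuous_subspaceT; exact: is_derive_continuous dh.
  move: yx hE; rewrite in_itv/= h0 !subr0 => /andP[y0 _] ->.
  by apply: mulr_ge0; [apply: h'0|]; exact: ltW.
rewrite ler_norml; apply/andP; split.
- rewrite lerNl -subr_ge0 opprK.
  apply: (ge0 _ _ (fun y => is_derive_addf (dg y) (df y))) => [|y y0].
    by rewrite f0 g0 addr0.
  by have := f'g' y y0; rewrite ler_norml; lra.
- rewrite -subr_ge0.
  apply: (ge0 _ _ (fun y => is_derive_subf (dg y) (df y))) => [|y y0].
    by rewrite f0 g0 subr0.
  by have := f'g' y y0; rewrite ler_norml; lra.
Qed.

Lemma is_derive_expn_fact n x :
  is_derive x 1 (fun a : R => a ^+ n.+1 / n.+1`!%:R) (x ^+ n / n`!%:R).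
Proof.
have dX := @is_deriveX _ _ (id : R -> R) n.+1 x 1 1 (is_derive_id _ _).
have := is_derive_mull (n.+1`!%:R^-1) dX.
have -> : (fun y : R => n.+1`!%:R^-1 * (id ^+ n.+1) y) =
  (fun a => a ^+ n.+1 / n.+1`!%:R).
  by apply/funext => y; rewrite mulrC exprfctE.
move=> /is_derive_eq; apply; rewrite factS natrM /= /GRing.scale/= mulr1; field.
by rewrite nat1r !pnatr_eq0 -lt0n fact_gt0.
Qed.

Definition exp_sum q N a := \sum_(n < N) a ^+ n / n`!%:R * q n.

Lemma exp_sum0 q N : exp_sum q N.+1 0 = q 0.
Proof.
rewrite /exp_sum big_ord_recl expr0 fact0 divr1 mul1r big1 ?addr0// => i _.
by rewrite expr0n/= !mul0r.
Qed.

Lemma is_derive_exp_sum q N x :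
  is_derive x 1 (exp_sum q N.+1) (exp_sum (fun n => q n.+1) N x).
Proof.
elim: N => [|N IH].
  rewrite (_ : exp_sum q 1 = cst (q 0)).
    by rewrite /exp_sum big_ord0; exact: is_derive_cst.
  by apply/funext => a; rewrite /exp_sum big_ord1 expr0 fact0 divr1 mul1r.
rewrite (_ : exp_sum q N.+2 = fun a =>
  exp_sum q N.+1 a + q N.+1 * (a ^+ N.+1 / N.+1`!%:R)).
  have := is_derive_addf IH (is_derive_mull (q N.+1) (is_derive_expn_fact N x)).
  by move=> /is_derive_eq; apply;
    rewrite [RHS]/exp_sum big_ord_recr/= [in RHS](mulrC _ (q _)).
by apply/funext => a; rewrite /exp_sum big_ord_recr/= (mulrC _ (q _)).
Qed.

(* The factor [w] makes the induction on [N] work, as differentiating the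
   remainder of order [N.+1] replaces [w] by [z * w]. *)
Lemma normr_exp_remainder_le z w th N a : Re z <= 0 -> 0 <= a ->
  `|wave (expC (a%:C%C * z) * w) th - exp_sum
    (fun n => wave (z ^+ n * w) th) N a| <=
  Normc.normc z ^+ N * Normc.normc w * (a ^+ N / N`!%:R).
Proof.
move=> z0; elim: N w a => [|N IH] w a a0.
  rewrite /exp_sum big_ord0 subr0 !expr0 fact0 divr1 mulr1 mul1r.
  rewrite (le_trans (normr_wave_le _ _))// Normc.normcM normc_expC
    ler_piMl ?normc_ge0//.
  by rewrite expR_le1 -wave_Re waveZ wave_Re mulr_ge0_le0.
pose B := Normc.normc z ^+ N.+1 * Normc.normc w.
pose q n := wave (z ^+ n * w) th.
have df x := is_derive_subf (is_derive_wave_expC w z th x)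
  (is_derive_exp_sum q N x).
have dg x := is_derive_mull B (is_derive_expn_fact N x).
apply: (normr_le_derive df dg) a0.
- move=> x x0; have := IH (z * w) x x0;
    rewrite Normc.normcM (mulrA (_ ^+ N)) -exprSr.
  by congr (`|_ - _| <= _); apply: eq_bigr => n _; rewrite /q exprSr mulrA.
- by rewrite exp_sum0 mul0r expC0 /q expr0 !mul1r subrr.
- by rewrite expr0n/= mul0r mulr0.
Qed.

Definition exp_remainder N y : R :=
  (-1) ^+ N * (expR (- y) - \sum_(n < N) (- y) ^+ n / n`!%:R).

Lemma exp_remainderS N y :
  exp_remainder N.+1 y = y ^+ N / N`!%:R - exp_remainder N y.
Proof.
rewrite /exp_remainder big_ord_recr/= exprS [(- y) ^+ N]exprNn.
have sign2 : (-1) ^+ N * (-1) ^+ N = 1 :> R by rewrite -expr2 sqrr_sign.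
rewrite [X in _ = X - _](_ : _ = ((-1) ^+ N * (-1) ^+ N) * (y ^+ N / N`!%:R));
  first by ring.
by rewrite sign2 mul1r.
Qed.

Lemma exp_remainder_itv N y : 0 <= y -> 0 <= exp_remainder N y <=
  y ^+ N / N`!%:R.
Proof.
move=> y0; have rem_le M : `|exp_remainder M y| <= y ^+ M / M`!%:R.
  have Re_le0 : Re (-1 : R[i]) <= 0 by rewrite /= oppr_le0.
  have := normr_exp_remainder_le 1 0 M Re_le0 y0.
  rewrite normcN Normc.normc1 expr1n !mul1r; apply: le_trans.
  rewrite /exp_remainder normrM normrX normrN1 expr1n mul1r mulrN1 mulr1
    wave_Re /= oppr0.
  rewrite cos0 mulr1 le_eqVlt; apply/orP; left; apply/eqP.
  congr (`|_ - _|); apply: eq_bigr => n _.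
  rewrite mulr1 wave_Re -[-1 in RHS](rmorphN1 (@real_complex R)) -rmorphXn /=.
  by rewrite [(- y) ^+ n]exprNn; ring.
rewrite (le_trans (ler_norm _) (rem_le N)) andbT; case: N => [|N].
  by rewrite /exp_remainder big_ord0 subr0 mul1r expR_ge0.
by rewrite exp_remainderS subr_ge0 (le_trans (ler_norm _) (rem_le N)).
Qed.

Lemma measurable_exp_remainder N : measurable_fun setT (exp_remainder N).
Proof.
apply: measurable_funM => //; apply: measurable_funB;
  first exact: measurableT_comp.
by apply: measurable_sum => n; apply: measurable_funM => //;
  exact: measurable_funX.
Qed.

Lemma exp_remainder_scaled_cvg N y : 0 <= y ->
  exp_remainder N (m.+1%:R^-1 * y) / m.+1%:R^-1 ^+ N @[m --> \oo] -->
    y ^+ N / N`!%:R.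
Proof.
move=> y0; pose x m : R := m.+1%:R^-1; have x0 m : 0 < x m by rewrite invr_gt0.
apply: (@squeeze_cvgr _ _ _ _ (fun m =>
  y ^+ N / N`!%:R - x m * (y ^+ N.+1 / N.+1`!%:R))
   (cst (y ^+ N / N`!%:R))).
- apply: nearW => m /=; rewrite -/(x m);
    have xy : 0 <= x m * y by rewrite mulr_ge0// ltW.
  have /andP[_ remN] := exp_remainder_itv N xy.
  have /andP[_ remSN] := exp_remainder_itv N.+1 xy.
  rewrite ler_pdivlMr ?exprn_gt0// ler_pdivrMr ?exprn_gt0//; apply/andP; split.
    move: remSN; rewrite exp_remainderS !exprMn lerBlDr addrC -lerBlDr.
    by apply: le_trans; rewrite le_eqVlt; apply/orP; left; apply/eqP;
      rewrite !exprS; ring.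
  by rewrite (le_trans remN)// exprMn -mulrA mulrC.
- rewrite -[X in _ --> X]subr0; apply: cvgB; first exact: cvg_cst.
  rewrite -[X in _ --> X](mul0r (y ^+ N.+1 / N.+1`!%:R)); apply: cvgMl.
  exact: cvg_harmonic.
- exact: cvg_cst.
Qed.

End exponential_taylor.

Section laplace_transform.
Context (R : realType) d (T : measurableType d) (P : probability T R).
Variables (A : T -> R) (c : nat -> R).
Hypotheses (mA : measurable_fun setT A) (A_ge0 : forall t, 0 <= A t).
Hypothesis c_entire : entire_coefs c.
Hypothesis laplaceA : forall x : R, 0 < x ->
  \sum_(n < N) c n * (- x) ^+ n @[N --> \oo] --> \int[P]_t expR (- (x * A t)).
Implicit Types (x th r : R) (n N : nat) (z : R[i]).

Let gap N x := \int[P]_t expR (- (x * A t)) - \sum_(n < N) c n * (- x) ^+ n.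

Lemma normr_laplace_gap_le N : exists S, forall x, 0 < x <= 1 ->
  `|gap N x| <= S * x ^+ N.
Proof.
have [S cS] := c_entire ler01; exists S => x /andP[x0 x1].
pose partial M := \sum_(n < M) c n * (- x) ^+ n.
have gap_cvg : `|partial (M + N)%N - partial N| @[M --> \oo] --> `|gap N x|.
  apply: cvg_norm; apply: cvgB; last exact: cvg_cst.
  by have := laplaceA x0; rewrite -(cvg_shiftn N).
apply: (ler_cvg_to gap_cvg (cvg_cst (S * x ^+ N))); apply: nearW => M.
have -> : partial (M + N)%N - partial N =
  \sum_(N <= n < M + N) c n * (- x) ^+ n.
  rewrite /partial -!(big_mkord xpredT (fun n => c n * (- x) ^+ n)).
  by rewrite (@big_cat_nat _ _ _ N 0 (M + N))//= ?leq_addl// [LHS]addrC addKr.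
rewrite (le_trans (ler_norm_sum _ _ _))//.
apply: (@le_trans _ _ (\sum_(N <= n < M + N) `|c n| * x ^+ N)).
  rewrite big_nat [leRHS]big_nat; apply: ler_sum => n /andP[Nn _].
  by rewrite normrM normrX normrN (gtr0_norm x0) ler_wpM2l// ler_wiXn2l// ltW.
rewrite -mulr_suml ler_wpM2r ?exprn_ge0 ?(ltW x0)//
  (le_trans _ (cS (M + N)%N))//.
rewrite -(big_mkord xpredT (fun n => `|c n| * 1 ^+ n)).
under [leRHS]eq_bigr do rewrite expr1n mulr1.
by rewrite [leRHS](@big_cat_nat _ _ _ N 0 (M + N))//= ?leq_addl//
  lerDr sumr_ge0.
Qed.

Definition has_moment n := P.-integrable setT (EFin \o (fun t => A t ^+ n)) /\
  \int[P]_t A t ^+ n = n`!%:R * c n.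

Section moment_sums.
Variables (N : nat) (q : nat -> R).
Hypothesis moments : forall n, (n < N)%N -> has_moment n.

Let integrable_term (n : 'I_N) :
  P.-integrable setT (EFin \o (fun t => A t ^+ n / n`!%:R * q n)).
Proof.
have [intn _] := moments (ltn_ord n).
have := integrableZl_EFin (q n / n`!%:R) measurableT intn.
by apply: eq_integrable => // t _ /=; congr EFin; ring.
Qed.

Lemma integrable_exp_sum :
  P.-integrable setT (EFin \o (fun t => exp_sum q N (A t))).
Proof. exact: integrable_sum_EFin. Qed.

Lemma expect_exp_sum : \int[P]_t exp_sum q N (A t) = \sum_(n < N) c n * q n.
Proof.
rewrite Rintegral_sum//; apply: eq_bigr => n _;
  have [intn momn] := moments (ltn_ord n).
under eq_Rintegral do rewrite -mulrA.
rewrite RintegralZr// momn; field.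
by rewrite pnatr_eq0 -lt0n fact_gt0.
Qed.

End moment_sums.

Section moment_step.
Variable N : nat.
Hypothesis moments : forall n, (n < N)%N -> has_moment n.

Let scaled_remainder m t := exp_remainder N
  (m.+1%:R^-1 * A t) / m.+1%:R^-1 ^+ N.

Let x_gt0 m : 0 < m.+1%:R^-1 :> R. Proof. by rewrite invr_gt0. Qed.

Let scaled_remainder_itv m t : 0 <= scaled_remainder m t <= A t ^+ N / N`!%:R.
Proof.
have /andP[rem_ge0 rem_le] := exp_remainder_itv N
  (mulr_ge0 (ltW (x_gt0 m)) (A_ge0 t)).
apply/andP; split; first by rewrite divr_ge0// exprn_ge0// ltW.
by rewrite ler_pdivrMr ?exprn_gt0// (le_trans rem_le)// exprMn -mulrA mulrC.
Qed.

Let measurable_scaled_remainder m : measurable_fun setT (scaled_remainder m).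
Proof.
apply: measurable_funM => //;
  apply: (measurableT_comp (@measurable_exp_remainder R N)).
exact: measurable_funM.
Qed.

Let scaled_remainder_cvg t : scaled_remainder m t @[m --> \oo] -->
  A t ^+ N / N`!%:R.
Proof. exact: exp_remainder_scaled_cvg. Qed.

Let scaled_remainderE m t : scaled_remainder m t = (-1) ^+ N / m.+1%:R^-1 ^+ N *
  (expR (- (m.+1%:R^-1 * A t)) - exp_sum
    (fun n => (- m.+1%:R^-1) ^+ n) N (A t)).
Proof.
rewrite /scaled_remainder /exp_remainder mulrAC; congr (_ * (_ - _)).
by apply: eq_bigr => n _; rewrite -mulNr exprMn; ring.
Qed.

Let integrable_laplace m :
  P.-integrable setT (EFin \o (fun t => expR (- (m.+1%:R^-1 * A t)))).
Proof.
apply: (@integrable_bounded _ _ _ P _ 1) => [|t].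
  apply: (measurableT_comp (@measurable_expR R)); apply: measurableT_comp => //.
  exact: measurable_funM.
by rewrite ger0_norm ?expR_ge0// expR_le1 oppr_le0 mulr_ge0 ?(ltW (x_gt0 m)).
Qed.

Let integrable_scaled_remainder m :
  P.-integrable setT (EFin \o scaled_remainder m).
Proof.
rewrite (funext (scaled_remainderE m)); apply: integrableZl_EFin => //.
by apply: integrableB_EFin => //; exact: integrable_exp_sum.
Qed.

Let expect_scaled_remainder m :
  \int[P]_t scaled_remainder m t = (-1) ^+ N / m.+1%:R^-1 ^+ N *
    gap N m.+1%:R^-1.
Proof.
under eq_Rintegral do rewrite scaled_remainderE.
have intsum := integrable_exp_sum (fun n => (- m.+1%:R^-1) ^+ n) moments.
rewrite RintegralZl//; last exact: integrableB_EFin.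
by rewrite RintegralB// expect_exp_sum.
Qed.

Let expect_scaled_remainder_cvg :
  \int[P]_t scaled_remainder m t @[m --> \oo] --> c N.
Proof.
have [S gapS] := normr_laplace_gap_le N.+1.
have Sx : S * m.+1%:R^-1 @[m --> \oo] --> 0.
  by rewrite -[X in _ --> X](mulr0 S); apply: cvgMr; exact: cvg_harmonic.
apply/cvgrPdist_le => e e0; have /cvgrPdist_le /(_ _ e0) := Sx;
  apply: filterS => m.
rewrite sub0r normrN => /(le_trans (ler_norm _)); apply: le_trans.
set x : R := m.+1%:R^-1; have xN : 0 < x ^+ N by rewrite exprn_gt0// x_gt0.
have x01 : 0 < x <= 1 by rewrite x_gt0 /x invf_le1 ?ltr0n// ler1n.
have gapE : gap N x = gap N.+1 x + c N * (- x) ^+ N.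
  by rewrite /gap big_ord_recr/=; ring.
have sign2 : (-1) ^+ N * (-1) ^+ N = 1 :> R by rewrite -expr2 sqrr_sign.
rewrite expect_scaled_remainder -/x gapE [(- x) ^+ N]exprNn.
rewrite (_ : c N - _ = - ((-1) ^+ N * gap N.+1 x / x ^+ N)); last first.
  move: sign2 (lt0r_neq0 xN); move: ((-1) ^+ N) (x ^+ N) =>
    sign xpow sign2 xpow0.
  by rewrite -[X in X - _]mulr1 -sign2; field.
rewrite normrN !normrM normrX normrN1 expr1n mul1r normfV (gtr0_norm xN).
by rewrite ler_pdivrMr// -mulrA -exprS gapS.
Qed.

Let integrable_moment :
  P.-integrable setT (EFin \o (fun t => A t ^+ N / N`!%:R)).
Proof.
have mAN : measurable_fun setT (fun t => A t ^+ N / N`!%:R).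
  by apply: measurable_funM => //; exact: measurable_funX.
apply/integrableP; split; first exact/measurable_EFinP.
apply: (@le_lt_trans _ _ (c N)%:E); last exact: ltry.
have := @fatou _ _ _ P setT measurableT (fun m t => (scaled_remainder m t)%:E)
  (fun m => (measurable_EFinP _ _).2 (measurable_scaled_remainder m)).
move=> /(_ _)/wrap[|fatou_rem].
  by move=> m t _; rewrite lee_fin; have /andP[] := scaled_remainder_itv m t.
have lim_expect : limn_einf (fun m => \int[P]_t (scaled_remainder m t)%:E)%E =
  (c N)%:E.
  apply: (cvg_limn_einf_sup _).1.
  rewrite (_ : (fun m => _) = (fun m => (\int[P]_t scaled_remainder m t)%:E)).
    by apply/cvg_EFin; [exact: nearW|exact: expect_scaled_remainder_cvg].
  apply/funext => m; rewrite /Rintegral fineK//.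
  exact: integrable_fin_num (integrable_scaled_remainder m).
rewrite lim_expect in fatou_rem; apply: le_trans fatou_rem.
rewrite le_eqVlt; apply/orP; left; apply/eqP; apply: eq_integral => t _ /=.
rewrite ger0_norm; last by rewrite divr_ge0 ?exprn_ge0.
apply/esym; apply: (cvg_limn_einf_sup _).1.
by apply/cvg_EFin; [exact: nearW|exact: scaled_remainder_cvg].
Qed.

Lemma has_moment_step : has_moment N.
Proof.
have AE : (fun t => A t ^+ N) = (fun t => N`!%:R * (A t ^+ N / N`!%:R)).
  by apply/funext => t; rewrite mulrCA mulfV// mulr1.
split; first by rewrite AE; exact: integrableZl_EFin.
rewrite AE RintegralZl//; congr (_ * _).
have : \int[P]_t scaled_remainder m t @[m --> \oo] -->
  \int[P]_t (A t ^+ N / N`!%:R).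
  apply: (@Rintegral_dominated_cvg _ _ _ P _ _ _ (fun t => A t ^+ N / N`!%:R))
    => //.
  by move=> m t _; have /andP[rem0 rem_le] := scaled_remainder_itv m t;
    rewrite ger0_norm.
by move=> rem_cvg; exact: cvg_unique rem_cvg expect_scaled_remainder_cvg.
Qed.

End moment_step.

Lemma laplace_moment N : has_moment N.
Proof. by elim/ltn_ind: N => N IH; exact: has_moment_step. Qed.

Lemma entire_coefs_cvg0 r : 0 <= r -> c N * r ^+ N @[N --> \oo] --> 0.
Proof.
move=> r0; have [S cS] := c_entire (mulr_ge0 (ler0n R 2) r0).
apply: norm_cvg0;
  apply: (@squeeze_cvgr _ _ _ _ (cst 0) (fun N => S * 2^-1 ^+ N)).
- apply: nearW => N; rewrite normr_ge0/= normrM normrX (ger0_norm r0).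
  rewrite exprVn ler_pdivlMr ?exprn_gt0// -mulrA -exprMn (mulrC r).
  apply: le_trans (cS N.+1); rewrite big_ord_recr/= lerDr.
  by apply: sumr_ge0 => i _; rewrite mulr_ge0// exprn_ge0// mulr_ge0.
- exact: cvg_cst.
- rewrite -(mulr0 S); apply: cvgMr; apply: cvg_expr.
  by rewrite ger0_norm// invf_lt1// ltr1n.
Qed.

Lemma laplace_complex z th : Re z <= 0 ->
  \sum_(n < N) c n * wave (z ^+ n) th @[N --> \oo] -->
  \int[P]_t wave (expC ((A t)%:C%C * z)) th.
Proof.
move=> z0; pose q n := wave (z ^+ n) th.
have mwave : measurable_fun setT (fun t => wave (expC ((A t)%:C%C * z)) th).
  have cwave := is_derive_continuous (fun x => is_derive_wave_expC 1 z th x).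
  have := measurableT_comp (continuous_measurable_fun cwave) mA.
  by rewrite (_ : _ \o A = (fun t => wave (expC ((A t)%:C%C * z)) th))//;
    apply/funext => t /=;
    rewrite mulr1.
have intwave :
  P.-integrable setT (EFin \o (fun t => wave (expC ((A t)%:C%C * z)) th)).
  apply: (@integrable_bounded _ _ _ P _ 1) => // t.
  rewrite (le_trans (normr_wave_le _ _))// normc_expC expR_le1.
  by rewrite -wave_Re waveZ wave_Re mulr_ge0_le0.
have momc N n : (n < N)%N -> has_moment n by move=> _; exact: laplace_moment.
apply/cvgrPdist_le => e e0.
have /cvgrPdist_le /(_ _ e0) := entire_coefs_cvg0 (normc_ge0 z).
apply: filterS => N; rewrite sub0r normrN => /(le_trans (ler_norm _));
  apply: le_trans.
have [intN momN] := laplace_moment N.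
have intsum := integrable_exp_sum q (momc N).
rewrite -(expect_exp_sum q (momc N)) -RintegralB//.
have -> : c N * Normc.normc z ^+ N =
  \int[P]_t (Normc.normc z ^+ N / N`!%:R * A t ^+ N).
  by rewrite RintegralZl// momN; field.
apply: normr_Rintegral_le => //.
- by apply: measurable_funB => //; exact: integrable_measurable_fun intsum.
- move=> t _; have := normr_exp_remainder_le 1 th N z0 (A_ge0 t).
  rewrite mulr1 Normc.normc1 mulr1; congr (`|_ - _| <= _);
    last by rewrite mulrA mulrAC.
  by apply: eq_bigr => n _; rewrite mulr1.
- exact: integrableZl_EFin.
Qed.

End laplace_transform.

Section subordinated_lfsm.
Context (R : realType) d (T : measurableType d) (P : probability T R).
Variables (delta rho H : R) (M : set R -> T -> R) (Y : R -> T -> R)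
  (A : T -> R).
Hypotheses (delta_gt0 : 0 < delta) (H_gt0 : 0 < H).
Hypothesis stableM : stable_random_measure P delta rho M.
Hypothesis lfsmY : is_lfsm P M delta H Y.
Hypotheses (mA : measurable_fun setT A) (A_ge0 : forall w, 0 <= A w).
Hypothesis indepAY : indep_rv_process P A Y.
Implicit Types (t p th : R).

Definition subordinated t w : R := A w `^ delta^-1 * Y t w.

Lemma measurable_subordinated t :
  0 <= t -> measurable_fun setT (subordinated t).
Proof.
move=> t0; apply: measurable_funM;
  last exact: (measurable_lfsm delta_gt0 H_gt0 lfsmY).
exact: (measurableT_comp (measurable_powR delta^-1) mA).
Qed.

Lemma subordinated_eq0 : {ae P, forall w, subordinated 0 w = 0}.
Proof.
have := lfsm_eq0 delta_gt0 H_gt0 stableM lfsmY.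
by apply: filterS => w Y0; rewrite /subordinated Y0 mulr0.
Qed.

Lemma indep_pair_process t : 0 <= t -> indep_pair P A (Y t).
Proof.
move=> t0 B C mB mC.
have := @indepAY 1 (fun=> t) B (fun=> C) (fun=> t0) mB (fun=> mC).
have -> // : \bigcap_(i in [set: 'I_1]) (Y t @^-1` C) = Y t @^-1` C.
by apply/seteqP; split => w Yw; [exact: (Yw ord0 I)|move=> i _; exact: Yw].
Qed.

Lemma wave_charf_subordinated t p th : 0 < t ->
  wave (charf P (subordinated t) p) th = \int[P]_w wave (expC ((A w)%:C%C *
    - ((t `^ (delta * H))%:C%C * psi delta (rho * lfsm_skewness delta H) p)))
        th.
Proof.
move=> t0; have mYt := measurable_lfsm delta_gt0 H_gt0 lfsmY (ltW t0).
rewrite wave_charf; last exact: measurable_subordinated (ltW t0).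
pose F (z : R * R) : R := cos (th + p * (z.1 `^ delta^-1 * z.2)).
have mF : measurable_fun setT F.
  apply: (measurableT_comp (@measurable_cos R setT));
    apply: measurable_funD => //.
  apply: measurable_funM => //; apply: measurable_funM => //.
  exact: (measurableT_comp (measurable_powR delta^-1)).
have F1 z : `|F z| <= 1 by exact: cos_max.
rewrite (Rintegral_indep_pair mA mYt (indep_pair_process (ltW t0)) mF F1).
apply: eq_Rintegral => w _; rewrite /F /=; under eq_Rintegral do rewrite mulrA.
rewrite -(wave_charf P mYt) (charf_lfsm delta_gt0 H_gt0 stableM lfsmY)//.
rewrite (mulrC p) psi_homogeneous ?powR_ge0// -powRrM mulVf ?gt_eqF// powRr1//.
by rewrite mulrN mulrCA.
Qed.

End subordinated_lfsm.

Lemma entire_coefs_cvg (R : realType) (c : nat -> R) :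
  (forall x, 0 < x -> cvg (\sum_(n < N) c n * (- x) ^+ n @[N --> \oo])) ->
    entire_coefs c.
Proof.
move=> c_cvg r r0; pose x := 2 * r + 1;
  have x0 : 0 < x by rewrite ltr_wpDl// mulr_ge0.
have series_cvg : cvg (series (fun n => c n * (- x) ^+ n) @ \oo).
  rewrite (_ : series _ = fun N => \sum_(n < N) c n * (- x) ^+ n);
    first exact: c_cvg.
  by apply/funext => N; rewrite /series /= big_mkord.
have [B [_ boundB]] := cvg_series_bounded series_cvg; pose K := `|B| + 1.
have c_le n : `|c n| * x ^+ n <= K.
  have := boundB K (le_lt_trans (ler_norm _) (ltr_pwDr ltr01 (lexx _))) n I.
  by rewrite /= normrM normrX normrN (gtr0_norm x0).
exists (K * 2) => N; rewrite (@le_trans _ _ (\sum_(n < N) K * 2^-1 ^+ n))//.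
  apply: ler_sum => n _; rewrite (@le_trans _ _ (`|c n| * (x / 2) ^+ n))//.
    by rewrite ler_wpM2l// lerXn2r ?nnegrE ?divr_ge0 ?(ltW x0)// /x; lra.
  by rewrite exprMn mulrA ler_wpM2r ?exprn_ge0 ?invr_ge0.
rewrite -mulr_sumr ler_wpM2l ?addr_ge0//.
have -> : \sum_(n < N) (2^-1 : R) ^+ n = 2 - 2 * 2^-1 ^+ N.
  elim: (N) => [|m IH]; first by rewrite big_ord0 expr0 mulr1 subrr.
  by rewrite big_ord_recr/= IH exprS; field.
by rewrite gerBl mulr_ge0// exprn_ge0 ?invr_ge0.
Qed.

Section kernel_hypotheses.
Variables (R : realType) (k : R -> R -> R) (beta : R).
Local Notation leb := (@lebesgue_measure R).

Lemma in_L1eps_integrable eps : 0 < eps -> in_L1eps k eps ->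
  leb.-integrable `]0, 1[ (EFin \o k 1).
Proof.
move=> eps0 [mk fin].
have mpow : measurable_fun (`]0, 1[ : set R) (fun s => `|k 1 s| `^ (1 + eps)).
  have mnorm := measurableT_comp (@normr_measurable R setT) mk.
  exact: (measurableT_comp (measurable_powR (1 + eps)) mnorm).
have intpow : leb.-integrable `]0, 1[
  (EFin \o (fun s => `|k 1 s| `^ (1 + eps))).
  apply/integrableP; split; first exact/measurable_EFinP.
  by under eq_integral do rewrite /= ger0_norm ?powR_ge0//.
have int1 : leb.-integrable `]0, 1[ (EFin \o cst (1 : R)).
  apply/integrableP; split; first exact/measurable_EFinP.
  under eq_integral do rewrite /= normr1.
  have leb01 : leb (`]0%R, 1%R[ : set R) = 1%E.
    by rewrite lebesgue_measure_itv/= lte_fin ltr01 oppr0 adde0.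
  by rewrite integral_cst// mul1e [X in (X < _)%E]leb01 ltry.
apply: (@integrable_dominated _ _ _ leb _ _
  (fun s => 1 + `|k 1 s| `^ (1 + eps))) => //.
  move=> s _; have [s1|/ltW s1] := leP `|k 1 s| 1.
    by rewrite (le_trans s1)// lerDl powR_ge0.
  rewrite (@le_trans _ _ (`|k 1 s| `^ (1 + eps)))// ?lerDr//.
  by rewrite -[leLHS]powRr1// ler_powR// lerDl ltW.
exact: integrableD_EFin.
Qed.

Lemma Phi_partial0_cvg : Phi_partial k beta 0 @ \oo --> (1 : R).
Proof.
apply: cvg_near_cst; exists 1%N => // -[//|N] _;
  rewrite /Phi_partial big_ord_recl/=.
by rewrite expr0 mulr1 big1 ?addr0// => i _; rewrite expr0n/= mulr0.
Qed.

Lemma Phihat0 : Phihat k beta 0 = 1.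
Proof. exact: (cvg_lim _ Phi_partial0_cvg). Qed.

Lemma Phihat_cvg x :
  (forall x : R, 0 < x -> cvg (Phi_partial k beta (- x) @ \oo)) ->
  0 <= x -> Phi_partial k beta (- x) @ \oo --> Phihat k beta (- x).
Proof.
rewrite le_eqVlt => Phi_cvg /predU1P[<-|x0]; last exact: Phi_cvg.
by rewrite oppr0 Phihat0; exact: Phi_partial0_cvg.
Qed.

End kernel_hypotheses.

Section stochastic_solutions.
Variables (R : realType) (k : R -> R -> R) (beta : R).
Local Notation leb := (@lebesgue_measure R).
Hypotheses (beta_gt0 : 0 < beta) (hom : homogeneous k beta).
Hypothesis intk : leb.-integrable `]0, 1[ (EFin \o k 1).
Hypothesis Phi_cvg : forall x : R, 0 < x ->
  cvg (Phi_partial k beta (- x) @ \oo).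

Context d (T : measurableType d) (P : probability T R).
Variables (M : set R -> T -> R) (Y : R -> T -> R) (A : T -> R).
Hypothesis indepAY : indep_rv_process P A Y.
Variables (delta : R) (delta_gt0 : 0 < delta).

Lemma charf_series_stochastic_solution rho H gamma rho' :
  0 < H -> 0 < gamma <= 2 ->
  stable_random_measure P delta rho M -> is_lfsm P M delta H Y ->
    measurable_fun setT A ->
  (forall s p th : R, 0 < s ->
    \sum_(n < N) chat k beta n * (s `^ beta) ^+ n *
      wave ((- psi gamma rho' p) ^+ n) th
      @[N --> \oo] --> wave (charf P (subordinated delta Y A s) p) th) ->
  stochastic_solution P (subordinated delta Y A) (Lbar gamma rho') k.
Proof.
move=> H_gt0 /andP[gamma_gt0 gamma_le2] stableM lfsmY mA charf_series.
split; first exact: subordinated_eq0 delta_gt0 H_gt0 stableM lfsmY.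
move=> u0 su.
apply: (expected_shift_solves beta_gt0 gamma_gt0 gamma_le2 hom intk) => //.
- exact: entire_coefs_cvg.
- by move=> s /ltW s0;
    exact: (measurable_subordinated delta_gt0 H_gt0 lfsmY mA).
Qed.

Lemma symmetric_lfsm_stochastic_solution gamma : 0 < gamma <= 2 ->
  stable_random_measure P delta 0 M -> is_lfsm P M delta (beta / gamma) Y ->
  nonneg_rv_laplace P A (fun x => Phihat k beta (- x `^ (gamma / delta))) ->
  stochastic_solution P (subordinated delta Y A) (Lbar gamma 0) k.
Proof.
move=> gamma_itv stableM lfsmY [mA [A_ge0 laplaceA]].
have /andP[gamma_gt0 _] := gamma_itv.
have H_gt0 : 0 < beta / gamma by rewrite divr_gt0.
have laplaceA_ge0 (x : R) : 0 <= x ->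
    \int[P]_w expR (- (x * A w)) = Phihat k beta (- (x `^ (gamma / delta))).
  rewrite le_eqVlt => /predU1P[<-|x0]; last exact: laplaceA.
  rewrite powR0 ?gt_eqF ?divr_gt0// oppr0 Phihat0
    -[RHS](Rintegral_probability_cst P).
  by apply: eq_Rintegral => w _; rewrite mul0r oppr0 expR0.
have psi0 r p : psi r 0 p = (psiRe r p)%:C%C by rewrite /psi /psiIm mulr0
  !mul0r oppr0.
apply: (charf_series_stochastic_solution H_gt0 gamma_itv stableM lfsmY mA) =>
  s p th s0.
rewrite (wave_charf_subordinated delta_gt0 H_gt0 stableM lfsmY mA A_ge0
  indepAY)// mul0r !psi0.
pose x := s `^ (delta * (beta / gamma)) * psiRe delta p.
have x0 : 0 <= x by rewrite mulr_ge0 ?powR_ge0.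
have xE : x `^ (gamma / delta) = s `^ beta * psiRe gamma p.
  rewrite /x powRM ?powR_ge0// /psiRe -!powRrM; congr (_ `^ _ * _ `^ _); field.
    by rewrite !gt_eqF.
  by rewrite gt_eqF.
have y0 : 0 <= s `^ beta * psiRe gamma p by rewrite mulr_ge0 ?powR_ge0.
have intexp : P.-integrable setT (EFin \o (fun w => expR (- (x * A w)))).
  apply: (@integrable_bounded _ _ _ P _ 1) => [|w].
    apply: (measurableT_comp (@measurable_expR R));
      apply: measurableT_comp => //.
    exact: measurable_funM.
  by rewrite ger0_norm ?expR_ge0// expR_le1 oppr_le0 mulr_ge0.
rewrite (_ : \int[P]_w _ = Phihat k beta (- (s `^ beta * psiRe gamma p)) *
  cos th); last first.
  rewrite -xE -laplaceA_ge0// -RintegralZr//; apply: eq_Rintegral => w _.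
  rewrite -rmorphM -rmorphN -rmorphM /= wave_expC /= addr0.
  by rewrite mulrN (mulrC (A w)).
rewrite (_ : (fun N => _) = (fun N =>
    Phi_partial k beta (- (s `^ beta * psiRe gamma p)) N * cos th)).
  by apply: cvgMl; exact: Phihat_cvg.
apply/funext => N; rewrite /Phi_partial mulr_suml; apply: eq_bigr => n _.
by rewrite -rmorphN -rmorphXn /= waveC -mulrN exprMn; ring.
Qed.

Lemma lfsm_stochastic_solution rho : beta != 1 -> delta <= 2 ->
  stable_random_measure P delta rho M -> is_lfsm P M delta (beta / delta) Y ->
  nonneg_rv_laplace P A (fun x => Phihat k beta (- x)) ->
  stochastic_solution P (subordinated delta Y A)
    (Lbar delta (rho0 delta beta rho)) k.
Proof.
move=> beta_neq1 delta_le2 stableM lfsmY [mA [A_ge0 laplaceA]].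
have H_gt0 : 0 < beta / delta by rewrite divr_gt0.
have delta_itv : 0 < delta <= 2 by rewrite delta_gt0.
have laplace_series (x : R) : 0 < x -> \sum_(n < N) chat k beta n * (- x) ^+ n
    @[N --> \oo] --> \int[P]_t expR (- (x * A t)).
  move=> x0; have -> : \int[P]_t expR (- (x * A t)) = Phihat k beta (- x) :=
    laplaceA x x0.
  by apply: (Phihat_cvg Phi_cvg); exact: ltW.
apply: (charf_series_stochastic_solution H_gt0 delta_itv stableM lfsmY mA) =>
  s p th s0.
rewrite (wave_charf_subordinated delta_gt0 H_gt0 stableM lfsmY mA
  A_ge0 indepAY)//.
rewrite (lfsm_skewness_rho0 rho delta_gt0 beta_gt0 beta_neq1 lfsmY).
have -> : delta * (beta / delta) = beta by rewrite mulrC divfK// gt_eqF.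
set z := - (_ * _); have z_le0 : Re z <= 0.
  by rewrite /z /= mul0r subr0 oppr_le0 mulr_ge0 ?powR_ge0.
rewrite (_ : (fun N => _) =
  (fun N => \sum_(n < N) chat k beta n * wave (z ^+ n) th)).
  by apply: laplace_complex => //; exact: entire_coefs_cvg.
apply/funext => N; apply: eq_bigr => n _.
by rewrite /z -mulrN exprMn -rmorphXn waveZ mulrA.
Qed.

End stochastic_solutions.

Theorem theorem5p1 (R : realType) (k : R -> R -> R) (beta eps : R) :
  0 < beta < 2 ->
  kernel_measurable k -> homogeneous k beta ->
  0 < eps -> in_L1eps k eps ->
  (forall x : R, 0 < x -> cvg (Phi_partial k beta (- x) @ \oo)) ->
  completely_monotone (fun x => Phihat k beta (- x)) ->
  (* (i) *)
  (forall gamma delta : R,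
     beta < gamma <= 2 -> gamma <= delta <= 2 -> delta != gamma / beta ->
     forall (d : measure_display) (T : measurableType d) (P : probability T R)
       (M : set R -> T -> R) (Y : R -> T -> R) (A : T -> R),
       stable_random_measure P delta 0 M ->
       is_lfsm P M delta (beta / gamma) Y ->
       nonneg_rv_laplace P A (fun x => Phihat k beta (- x `^ (gamma / delta))) ->
       indep_rv_process P A Y ->
       stochastic_solution P (fun t w => A w `^ (delta^-1) * Y t w)
         (Lbar gamma 0) k)
  /\
  (* (ii) *)
  (beta != 1 ->
   forall delta rho : R,
     beta < delta <= 2 -> delta != 1 -> -1 <= rho <= 1 ->
     forall (d : measure_display) (T : measurableType d) (P : probability T R)
       (M : set R -> T -> R) (Y : R -> T -> R) (A : T -> R),
       stable_random_measure P delta rho M ->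
       is_lfsm P M delta (beta / delta) Y ->
       nonneg_rv_laplace P A (fun x => Phihat k beta (- x)) ->
       indep_rv_process P A Y ->
       stochastic_solution P (fun t w => A w `^ (delta^-1) * Y t w)
         (Lbar delta (rho0 delta beta rho)) k).

Proof.
move=> /andP[beta_gt0 _] _ hom eps_gt0 /(in_L1eps_integrable eps_gt0)
  intk Phi_cvg _.
split=> [gamma delta /andP[beta_gamma gamma_le2] /andP[gamma_delta _] _
  |beta_neq1 delta rho /andP[beta_delta delta_le2] _ _] d T P M Y A stableM
    lfsmY lapA indepAY.
- have gamma_gt0 : 0 < gamma := lt_trans beta_gt0 beta_gamma.
  have delta_gt0 : 0 < delta := lt_le_trans gamma_gt0 gamma_delta.
  have gamma_itv : 0 < gamma <= 2 by rewrite gamma_gt0.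
  exact: (symmetric_lfsm_stochastic_solution beta_gt0 hom intk Phi_cvg
    indepAY delta_gt0
    gamma_itv stableM lfsmY lapA).
- have delta_gt0 : 0 < delta := lt_trans beta_gt0 beta_delta.
  exact: (lfsm_stochastic_solution beta_gt0 hom intk Phi_cvg indepAY delta_gt0
    beta_neq1 delta_le2 stableM lfsmY lapA).
Qed.
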